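(* Let $\Gamma$ be a standard hyper curve in $\mathbb{R}^n\times\mathbb{R}^n$ and let $S$ and $T$ be two operators in $CZO_{\gamma}$ which share the same kernel $K$. Then there exist measurable functions $b_i$ on $\mathcal{D}_i$, $1\le i\le r$, such that for all $f\in L^2(\mathbb{R}^n)$, $$(S-T)f(x)=\sum_{i=1}^r b_i(x)\,f(\gamma_i(x))\,\chi_{\mathcal{D}_i}(x)\qquad\text{for a.e. }x.$$ Moreover, $|b_i(x)|^2\cdot|J_{\gamma_i}^{-1}(x)|\,\chi_{\mathcal{D}_i}(x)\in L^\infty$ for $1\le i\le r$.
   Context: Standard hyper curves. $\Gamma\subset\mathbb{R}^n\times\mathbb{R}^n$ is called a standard hyper curve ($\Gamma\in SHC$) if $\Gamma=\bigcup_{i=1}^r\Gamma_i$ for finitely many sets $\Gamma_i$ such that: (1) $\Gamma_i=\{(x,\gamma_i(x)): x\in\mathcal{D}_i\}$, where $\gamma_i$ is a mapping from a closed domain $\mathcal{D}_i\subset\mathbb{R}^n$ to $\mathbb{R}^n$ (the $\mathcal{D}_i$ may coincide for different $i$); (2) each $\gamma_i$ is differentiable and its Jacobian (determinant) $J_{\gamma_i}(x)$ has no zero in the interior of $\mathcal{D}_i$; (3) for $1\le i<i'\le r$, the equation $\gamma_i(x)=\gamma_{i'}(x)$ has at most finitely many solutions $x$; (4) both $\gamma_i$ and $\gamma_i^{-1}$ are Lipschitz: there is a constant $c_\gamma>1$ such that $|\gamma_i(x)-\gamma_i(x')|\le c_\gamma|x-x'|$ and $|\gamma_i^{-1}(y)-\gamma_i^{-1}(y')|\le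 c_\gamma|y-y'|$ for all $x,x'\in\mathcal{D}_i$, $y,y'\in\gamma_i(\mathcal{D}_i)$, $1\le i\le r$. For $E\subset\mathbb{R}^n$ put $\gamma^{-1}(E)=\bigcup_{i=1}^r\{x\in\mathcal{D}_i:\gamma_i(x)\in E\}$. Put $\rho_i(x,y)=\inf_{(x',y')\in\Gamma_i}|(x,y)-(x',y')|$ (Euclidean distance) and $\rho(x,y)=\min_{1\le i\le r}\rho_i(x,y)$. The class $CZO_\gamma$. $T\in CZO_\gamma$ means: $T$ is a continuous linear operator from $C_c^\infty(\mathbb{R}^n)$ into $\mathcal{D}'(\mathbb{R}^n)$ that extends to a bounded operator on $L^2(\mathbb{R}^n)$, and whose distribution kernel $K$ coincides with a function $K(x,y)$ defined on $\Gamma^c=(\mathbb{R}^n\times\mathbb{R}^n)\setminus\Gamma$ such that, for some $A,\delta>0$ and all $(x,y)\in\Gamma^c$, $|K(x,y)|\le A\rho(x,y)^{-n}$; $|K(x,y)-K(x,y')|\le A|y-y'|^\delta\rho(x,y)^{-n-\delta}$ whenever $|y-y'|\le\frac12\rho(x,y)$; $|K(x,y)-K(x',y)|\le A|x-x'|^\delta\rho(x,y)^{-n-\delta}$ whenever $|x-x'|\le\frac12\rho(x,y)$; and, for every $f\in C_c^\infty(\mathbb{R}^n)$, $Tf(x)=\int_{\mathbb{R}^n}K(x,y)f(y)\,dy$ for $x\notin\gamma^{-1}(\operatorname{supp}f)$. Sharing the same kernel $K$ means that the distribution kernels of $S$ and $T$ coincide with the same function $K$ on $\Gamma^c$. On $L^2(\mathbb{R}^n)$,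 $S$ and $T$ denote their bounded extensions. $\chi_E$ is the indicator function of $E$ (the $i$-th term of the sum is $0$ for $x\notin\mathcal{D}_i$), and $J_{\gamma_i}^{-1}(x)=1/J_{\gamma_i}(x)$. *)

(* Defs.v *)
From HB Require Import structures.
From mathcomp Require Import all_boot all_order all_algebra.
From mathcomp Require Import all_classical all_reals all_analysis.
From mathcomp Require Import complex.

Set Implicit Arguments.
Unset Strict Implicit.
Unset Printing Implicit Defensive.
Import Order.TTheory GRing.Theory Num.Theory.
Import numFieldNormedType.Exports.
Import ComplexField.Normc.

Local Open Scope classical_set_scope.
Local Open Scope ring_scope.
Local Open Scope complex_scope.

(* The sigma-algebra on row vectors is the product one (generated by the
   coordinates), as the library does for n.-tuple T; over the Borel sets of R
   it is the Borel sigma-algebra of R^n. *)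
Section measurable_rV.
Context {d} {T : measurableType d} {n : nat}.

Let coors (i : 'I_n) (x : 'rV[T]_n) : T := x ord0 i.

Let rV_set0 : g_sigma_preimage coors set0.
Proof. exact: sigma_algebra0. Qed.

Let rV_setC A : g_sigma_preimage coors A -> g_sigma_preimage coors (~` A).
Proof. exact: sigma_algebraC. Qed.

Let rV_bigcup (F : _^nat) : (forall i, g_sigma_preimage coors (F i)) ->
  g_sigma_preimage coors (\bigcup_i (F i)).
Proof. exact: sigma_algebra_bigcup. Qed.

HB.instance Definition _ := @isMeasurable.Build (measure_tuple_display d)
  'rV[T]_n (g_sigma_preimage coors) rV_set0 rV_setC rV_bigcup.

Lemma measurable_coor (i : 'I_n) :
  measurable_fun [set: 'rV[T]_n] (fun x : 'rV[T]_n => x ord0 i).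
Proof.
move=> _ Y mY; rewrite setTI; apply: sub_sigma_algebra => /=.
rewrite -bigcup_seq/=; exists i => /=; first by rewrite mem_index_enum.
by exists Y => //; rewrite setTI.
Qed.

End measurable_rV.

Lemma measurable_fun_rV d1 d2 (T1 : measurableType d1) (T2 : measurableType d2)
    n (f : T1 -> 'rV[T2]_n) :
  (forall i, measurable_fun [set: T1] (fun x => f x ord0 i)) ->
  measurable_fun [set: T1] f.
Proof.
move=> mf _ A; rewrite setTI; move: A.
suff : (measurable : set (set 'rV[T2]_n)) `<=`
    [set A | measurable (f @^-1` A)] by move=> + A; apply.
apply: smallest_sub.
  split => //=.
  - by rewrite preimage_set0.
  - by move=> A /= mA; rewrite setTD preimage_setC; exact: measurableC.
  - by move=> F mF; rewrite preimage_bigcup; exact: bigcup_measurable.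
move=> A; rewrite -bigcup_seq/= => -[i _ [B mB <-]] /=.
by rewrite setTI -[X in measurable X]setTI; exact: mf.
Qed.

Section lebesgue_rV.
Context {R : realType}.

Definition cons_rV n (p : R * 'rV[R]_n) : 'rV[R]_n.+1 :=
  row_mx (const_mx p.1 : 'rV_1) p.2.

Lemma measurable_cons_rV n : measurable_fun [set: R * 'rV[R]_n] (@cons_rV n).
Proof.
apply: measurable_fun_rV => i.
case: (split_ordP (i : 'I_(1 + n))) => j ->.
  rewrite (_ : (fun _ => _) = fst); first exact: measurable_fst.
  by apply/funext => p; apply: etrans (row_mxEl _ _ _ _) _; rewrite mxE.
rewrite (_ : (fun _ => _) = (fun v : 'rV[R]_n => v ord0 j) \o snd).
  by apply: measurableT_comp; [exact: measurable_coor|exact: measurable_snd].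
by apply/funext => p; exact: row_mxEr.
Qed.

Let uncons_rV n (v : 'rV[R]_n.+1) : R * 'rV[R]_n :=
  (v ord0 ord0, \row_j v ord0 (lift ord0 j)).

Let cons_rVK n : cancel (@cons_rV n) (@uncons_rV n).
Proof.
move=> [x v]; congr pair.
  have -> : ord0 = lshift n ord0 :> 'I_(1 + n) by exact/val_inj.
  by apply: etrans (row_mxEl _ _ _ _) _; rewrite mxE.
apply/rowP => j; rewrite mxE.
have -> : lift ord0 j = rshift 1 j :> 'I_(1 + n) by exact/val_inj.
exact: row_mxEr.
Qed.

Let measurable_uncons_rV n : measurable_fun [set: 'rV[R]_n.+1] (@uncons_rV n).
Proof.
apply: measurable_fun_pair; first exact: measurable_coor.
apply: measurable_fun_rV => i; under eq_fun do rewrite mxE.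
exact: measurable_coor.
Qed.

Section step.
Variables (n : nat) (mu : {sigma_finite_measure set 'rV[R]_n -> \bar R}).

Definition lebesgue_step : set 'rV[R]_n.+1 -> \bar R :=
  pushforward (lebesgue_measure \x mu)%E (@cons_rV n).

Let step0 : lebesgue_step set0 = 0%E.
Proof. by rewrite /lebesgue_step /pushforward preimage_set0 measure0. Qed.

Let step_ge0 A : (0 <= lebesgue_step A)%E.
Proof. by rewrite /lebesgue_step /pushforward; apply: measure_ge0. Qed.

Let measurable_step A : measurable A -> measurable (@cons_rV n @^-1` A).
Proof.
by move=> mA; rewrite -[X in measurable X]setTI; exact: measurable_cons_rV.
Qed.

Let step_sigma_additive : semi_sigma_additive lebesgue_step.
Proof.
move=> F mF tF mUF; rewrite /lebesgue_step /pushforward preimage_bigcup.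
apply: measure_semi_sigma_additive.
- by move=> k; exact: measurable_step.
- apply/trivIsetP => i j _ _ ij; rewrite -preimage_setI.
  by move/trivIsetP : tF => /(_ _ _ _ _ ij) ->//; rewrite preimage_set0.
- by rewrite -preimage_bigcup; exact: measurable_step.
Qed.

HB.instance Definition _ := isMeasure.Build _ _ _ lebesgue_step
  step0 step_ge0 step_sigma_additive.

Let step_sigma_finite : sigma_finite setT lebesgue_step.
Proof.
pose l : {sigma_finite_measure set (measurableTypeR R) -> \bar R} :=
  lebesgue_measure.
have /sigma_finiteP[F [TF ndF Foo]] := sigma_finiteT l.
have /sigma_finiteP[G [TG ndG Goo]] := sigma_finiteT mu.
exists (fun k => @uncons_rV n @^-1` (F k `*` G k)).
  rewrite -preimage_bigcup (_ : \bigcup_k _ = setT) ?preimage_setT//.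
  apply/seteqP; split => // -[x v] _.
  have [a _ Fx] : (\bigcup_k F k) x by rewrite -TF.
  have [b _ Gv] : (\bigcup_k G k) v by rewrite -TG.
  exists (maxn a b) => //; split => /=.
    by move: Fx; exact/subsetPset/ndF/leq_maxl.
  by move: Gv; exact/subsetPset/ndG/leq_maxr.
move=> k; have [mF Fk] := Foo k; have [mG Gk] := Goo k; split.
  rewrite -[X in measurable X]setTI; apply: measurable_uncons_rV => //.
  exact: measurableX.
rewrite /lebesgue_step /pushforward (_ : _ @^-1` _ = F k `*` G k).
  by rewrite product_measure1E// lte_mul_pinfty// ge0_fin_numE.
by rewrite -comp_preimage (_ : _ \o _ = id)//; apply/funext; exact: cons_rVK.
Qed.

HB.instance Definition _ := Measure_isSigmaFinite.Build _ _ _ lebesgue_step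
  step_sigma_finite.

End step.

(* lebesgue_rV n.+1 is the image of lebesgue_measure \x lebesgue_rV n under
   the identification of R * R^n with R^(n+1); R^0 carries the unit mass. *)
Fixpoint lebesgue_rV n : {sigma_finite_measure set 'rV[R]_n -> \bar R} :=
  match n with
  | 0 => \d_(0 : 'rV[R]_0)
  | n'.+1 => lebesgue_step (lebesgue_rV n')
  end.

Lemma lebesgue_rV_box n (I : 'I_n -> set R) : (forall i, measurable (I i)) ->
  lebesgue_rV n [set v | forall i, I i (v ord0 i)] =
  (\prod_(i < n) lebesgue_measure (I i))%E.
Proof.
elim: n I => [|n IH] I mI.
  by rewrite big_ord0 /= diracE mem_set//= => -[].
rewrite big_ord_recl -(IH (fun i => I (lift ord0 i)))//.
pose B := [set v : 'rV[R]_n | forall i : 'I_n, I (lift ord0 i) (v ord0 i)].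
have mB : measurable B.
  rewrite (_ : B = \big[setI/setT]_(i < n)
     ((fun v : 'rV[R]_n => v ord0 i) @^-1` I (lift ord0 i))).
    apply: bigsetI_measurable => i _.
    by rewrite -[X in measurable X]setTI; exact: measurable_coor.
  apply/seteqP; split => v; rewrite -bigcap_seq /B /=.
    by move=> Bv i _; exact: Bv.
  by move=> Bv i; apply: Bv; rewrite /= mem_index_enum.
transitivity (lebesgue_measure (I ord0) * lebesgue_rV n B)%E => [|//].
rewrite -(product_measure1E lebesgue_measure (lebesgue_rV n))//; last first.
  exact: (mI ord0).
change (((lebesgue_measure \x lebesgue_rV n)%E)
  (@cons_rV n @^-1` [set v | forall i, I i (v ord0 i)]) = 
  ((lebesgue_measure \x lebesgue_rV n)%E) (I ord0 `*` B)).
congr (_ _).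
have E (p : R * 'rV[R]_n) : (cons_rV p) ord0 ord0 = p.1.
  exact: (congr1 fst (cons_rVK p)).
have E' (p : R * 'rV[R]_n) i : (cons_rV p) ord0 (lift ord0 i) = p.2 ord0 i.
  by have /rowP/(_ i) := congr1 snd (cons_rVK p); rewrite mxE.
apply/seteqP; split => p /=.
  by move=> Ip; split => [|i]; [rewrite -E|rewrite -E'].
by move=> [I0 Ip] i; case: (unliftP ord0 i) => [j|] ->; rewrite ?E ?E'.
Qed.

End lebesgue_rV.

(* The library's norm on 'rV[R]_n is the sup norm. *)
Definition enorm (R : realType) m (v : 'rV[R]_m) : R :=
  Num.sqrt (\sum_(i < m) v ord0 i ^+ 2).

(* The Jacobian determinant of a map defined on A: the differential is taken
   along the trace on A of the neighborhoods of x, so that the values of f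
   outside A are irrelevant, also at boundary points of A. *)
Definition jac (R : realType) n (A : set 'rV[R]_n) (f : 'rV[R]_n -> 'rV[R]_n)
    (x : 'rV[R]_n) : R :=
  \det (lin1_mx ('d f (within A (nbhs x)))).

Lemma jac_interior (R : realType) n (A : set 'rV[R]_n)
    (f : 'rV[R]_n -> 'rV[R]_n) (x : 'rV[R]_n) :
  A° x -> jac A f x = \det ('J f x).
Proof.
move=> Ax; rewrite /jac /jacobian.
have AE : within A (nbhs x) = nbhs x.
  apply/seteqP; split => [B WB|B xB]; last exact: filterS xB.
  by apply: filterS2 Ax WB => y Ay; apply.
have E : within_filter_on A (nbhs_filter_on x) = nbhs_filter_on x.
  case: within_filter_on (AE : filter (within_filter_on _ _) = _).
  move=> F1 fF1 /= F1E.
  by move: fF1; rewrite F1E => fF1; congr FilterType; exact: Prop_irrelevance.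
have diffE (V : normedModType R) (F G : filter_on V) phF phG (g : V -> V) :
    F = G -> @diff _ V V F phF g = @diff _ V V G phG g.
  by move=> FG; case: _ / FG phG => phG; case: phF; case: phG.
by congr (\det (lin1_mx _)); congr GRing.Linear.sort; exact: diffE.
Qed.

Section standard_hyper_curves.
Context {R : realType} {n : nat}.

(* The closure of a domain, i.e. of a nonempty connected open set. *)
Definition closed_domain (A : set 'rV[R]_n) : Prop :=
  exists U : set 'rV[R]_n,
    [/\ open U, connected U, U !=set0 & A = closure U].

(* gamma i is only used on D i. *)
Variables (r : nat) (D : 'I_r -> set 'rV[R]_n)
  (gamma : 'I_r -> 'rV[R]_n -> 'rV[R]_n).

Definition graph_piece (i : 'I_r) : set ('rV[R]_n * 'rV[R]_n) :=
  [set z | D i z.1 /\ z.2 = gamma i z.1].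

Definition hyper_curve : set ('rV[R]_n * 'rV[R]_n) :=
  \bigcup_(i in [set: 'I_r]) graph_piece i.

(* The second Lipschitz bound is the one for the inverse of gamma i, written at
   y = gamma i x and y' = gamma i x'; it contains the injectivity of gamma i
   on D i. *)
Definition standard_hyper_curve : Prop :=
  [/\ (0 < r)%N,
      forall i, closed_domain (D i),
      (forall i x, D i x -> differentiable (gamma i) (within (D i) (nbhs x))) /\
      (forall i x, (D i)° x -> jac (D i) (gamma i) x != 0),
      (forall i i' : 'I_r, (i < i')%N ->
         finite_set [set x | [/\ D i x, D i' x & gamma i x = gamma i' x]])
    & exists2 c : R, 1 < c & forall i x x', D i x -> D i x' ->
        enorm (gamma i x - gamma i x') <= c * enorm (x - x') /\
        enorm (x - x') <= c * enorm (gamma i x - gamma i x')].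

Definition gamma_preimage (E : set 'rV[R]_n) : set 'rV[R]_n :=
  \bigcup_(i in [set: 'I_r]) [set x | D i x /\ E (gamma i x)].

Definition rho_piece (i : 'I_r) (x y : 'rV[R]_n) : R :=
  inf [set enorm (row_mx x y - row_mx z.1 z.2) | z in graph_piece i].

(* The infimum of a finite family is its minimum. *)
Definition rho (x y : 'rV[R]_n) : R :=
  inf [set rho_piece i x y | i in [set: 'I_r]].

End standard_hyper_curves.

Section test_functions.
Context {R : realType}.
Local Notation C := R[i].

Definition supp m (f : 'rV[R]_m -> C) : set 'rV[R]_m :=
  closure [set x | f x != 0].

Definition iter_partial m (s : seq 'I_m) (f : 'rV[R]_m -> R) : 'rV[R]_m -> R :=
  foldr (fun i g => 'D_(delta_mx 0 i) g) f s.

Definition smooth m (f : 'rV[R]_m -> R) : Prop :=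
  forall (s : seq 'I_m) x, differentiable (iter_partial s f) x.

Definition test_function m (f : 'rV[R]_m -> C) : Prop :=
  [/\ smooth (fun x => complex.Re (f x)),
      smooth (fun x => complex.Im (f x)) & compact (supp f)].

Definition test_cvg m (u : nat -> 'rV[R]_m -> C) (f : 'rV[R]_m -> C) : Prop :=
  (exists2 A : set 'rV[R]_m, compact A &
     supp f `<=` A /\ forall k, supp (u k) `<=` A) /\
  forall s : seq 'I_m,
    {uniform, (fun k => iter_partial s (fun x => complex.Re (u k x))) @ \oo
       --> iter_partial s (fun x => complex.Re (f x))} /\
    {uniform, (fun k => iter_partial s (fun x => complex.Im (u k x))) @ \oo
       --> iter_partial s (fun x => complex.Im (f x))}.

(* u is only used on test functions; sequential continuity is continuity for
   linear maps on the (bornological) space of test functions. *)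
Definition distribution m (u : ('rV[R]_m -> C) -> C) : Prop :=
  (forall (a : C) f g, test_function f -> test_function g ->
     u (fun x => a * f x + g x) = a * u f + u g) /\
  (forall (f_ : nat -> 'rV[R]_m -> C) f, (forall k, test_function (f_ k)) ->
     test_function f -> test_cvg f_ f ->
     (fun k => normc (u (f_ k) - u f)) @ \oo --> (0 : R)).

(* T f g is the pairing of the distribution T f with the test function g. The
   second condition says that T is linear and continuous from test functions to
   distributions with the weak-* topology. *)
Definition continuous_operator n
    (T : ('rV[R]_n -> C) -> ('rV[R]_n -> C) -> C) : Prop :=
  (forall f, test_function f -> distribution (T f)) /\
  (forall g, test_function g -> distribution (fun f => T f g)).

End test_functions.

Section complex_L2.
Context {R : realType} {n : nat}.
Local Notation C := R[i].
Local Notation mu := (@lebesgue_rV R n).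

Definition cmeasurable_fun (A : set 'rV[R]_n) (f : 'rV[R]_n -> C) : Prop :=
  measurable_fun A (fun x => complex.Re (f x)) /\
  measurable_fun A (fun x => complex.Im (f x)).

Definition cintegral (f : 'rV[R]_n -> C) : C :=
  Complex (\int[mu]_x complex.Re (f x)) (\int[mu]_x complex.Im (f x)).

Definition L2norm (f : 'rV[R]_n -> C) : \bar R :=
  'N[mu]_2%:E[(fun x => (normc (f x))%:E)].

Definition L2 (f : 'rV[R]_n -> C) : Prop :=
  cmeasurable_fun setT f /\ (L2norm f < +oo)%E.

(* Elements of L^2 are represented by functions; linearity and boundedness make
   T compatible with almost everywhere equality. *)
Definition bounded_L2_operator (T : ('rV[R]_n -> C) -> 'rV[R]_n -> C) : Prop :=
  [/\ forall f, L2 f -> L2 (T f),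
      forall (a : C) f g, L2 f -> L2 g ->
        {ae mu, forall x, T (fun y => a * f y + g y) x = a * T f x + T g x}
    & exists c : R, forall f, L2 f -> (L2norm (T f) <= c%:E * L2norm f)%E].

Definition L2_extension (T : ('rV[R]_n -> C) -> ('rV[R]_n -> C) -> C)
    (T2 : ('rV[R]_n -> C) -> 'rV[R]_n -> C) : Prop :=
  bounded_L2_operator T2 /\
  forall f g, test_function f -> test_function g ->
    T f g = cintegral (fun x => T2 f x * g x).

End complex_L2.

Section CZO.
Context {R : realType} {n : nat}.
Local Notation C := R[i].

(* k is the Schwartz kernel of T; R^n * R^n is identified with R^(n + n). *)
Definition distribution_kernel (T : ('rV[R]_n -> C) -> ('rV[R]_n -> C) -> C)
    (k : ('rV[R]_(n + n) -> C) -> C) : Prop :=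
  distribution k /\
  forall f g, test_function f -> test_function g ->
    T f g = k (fun z => g (lsubmx z) * f (rsubmx z)).

Variables (r : nat) (D : 'I_r -> set 'rV[R]_n)
  (gamma : 'I_r -> 'rV[R]_n -> 'rV[R]_n).
Local Notation Gamma := (hyper_curve D gamma).
Local Notation rho := (rho D gamma).

(* Only the values of K off the hyper curve matter. *)
Definition coincides_off_curve (k : ('rV[R]_(n + n) -> C) -> C)
    (K : 'rV[R]_n -> 'rV[R]_n -> C) : Prop :=
  forall F, test_function F ->
    (forall z, supp F z -> ~ Gamma (lsubmx z, rsubmx z)) ->
    k F = cintegral (fun z => K (lsubmx z) (rsubmx z) * F z).

Definition kernel_estimates (K : 'rV[R]_n -> 'rV[R]_n -> C) : Prop :=
  exists A delta : R, [/\ 0 < A, 0 < delta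
    & forall x y, ~ Gamma (x, y) ->
      [/\ normc (K x y) <= A * rho x y ^- n,
          forall y', enorm (y - y') <= 2^-1 * rho x y ->
            normc (K x y - K x y') <=
            A * enorm (y - y') `^ delta * rho x y `^ (- n%:R - delta)
        & forall x', enorm (x - x') <= 2^-1 * rho x y ->
            normc (K x y - K x' y) <=
            A * enorm (x - x') `^ delta * rho x y `^ (- n%:R - delta)]].

(* K is a parameter so that two operators can be said to share it. *)
Definition CZO (K : 'rV[R]_n -> 'rV[R]_n -> C)
    (T : ('rV[R]_n -> C) -> ('rV[R]_n -> C) -> C) : Prop :=
  [/\ continuous_operator T,
      exists2 k, distribution_kernel T k & coincides_off_curve k K,
      kernel_estimates K
    & exists2 T2, L2_extension T T2 & forall f, test_function f ->
        {ae lebesgue_rV n, forall x, ~ gamma_preimage D gamma (supp f) x ->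
           T2 f x = cintegral (fun y => K x y * f y)}].

End CZO.

(* Main.v *)
Require Import Defs.
From mathcomp Require Import all_boot all_order all_algebra.
From mathcomp Require Import all_classical all_reals all_analysis.
From mathcomp Require Import complex.
From mathcomp Require Import measurable_realfun ess_sup_inf.
From mathcomp Require Import perm.
From mathcomp Require Import ring lra.
Set Implicit Arguments.
Unset Strict Implicit.
Unset Printing Implicit Defensive.
Import Order.TTheory GRing.Theory Num.Theory.
Import numFieldNormedType.Exports.
Import ComplexField.Normc.
Local Open Scope classical_set_scope.
Local Open Scope ring_scope.
Local Open Scope complex_scope.

(** Put [U = S2 - T2]; this is a bounded operator on [L^2], and the proof reads
    the functions [b i] off its values on indicators of small cells.

    Locality. Outside [gamma^-1 (supp f)] both operators are given by the same
    kernel integral, so [U f = 0] there for a test function [f]. The integral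
    formula is known for some extension of [S] and some extension of [T] only,
    but two extensions agree almost everywhere on the test functions at hand,
    since they have the same pairings with all of them ([extension_unique]). The
    indicator of a half-open cell is a pointwise limit of bumps whose supports
    avoid, in the end, any given point off the cell. By Fatou's lemma
    ([L2op_limit]) locality passes to cells, and by an induction over bounded
    measurable sets ([bounded_measurable_ind]) to all of them: [U 1_A = 0] almost
    everywhere off [gamma^-1 (A)] ([bounded_local]).

    Coefficients. Off a finite set the points [gamma i x], for the [i] with
    [x] in [D i], are distinct, so they lie in disjoint cells [Q i] of a fine grid.
    There are countably many families of cells, hence countably many patches,
    made of the [x] with [gamma i x] in [Q i] whenever [x] is in [D i]
    ([patch_cover]). On a patch put [b i = U 1_(Q i)]. If [A] is bounded and
    measurable, cutting it into the [A `&` Q i] and a remainder and using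
    locality for each piece and for its complement in [Q i] gives
    [U 1_A = \sum_i b i * 1_A (gamma i)] ([indicator_representation]). Simple
    functions and [L2op_limit] extend the formula to [L^2] ([represented_L2]).

    Size of the coefficients. A map with Lipschitz constant [L] satisfies
    [mu (gamma F) <= (2 L)^n mu F] for compact [F] ([lipschitz_measure]). If
    [|b i|^2 > c (2 L)^n + 1] on a compact part [F] of a patch, then
    [U 1_(gamma i F) = b i] on [F], and the bound [c] of [U] gives
    [(c (2 L)^n + 1) mu F <= c mu (gamma i F) <= c (2 L)^n mu F], so [mu F = 0]
    ([coefficient_bound]). Hence [b i] is essentially bounded.

    Jacobian. It remains to bound [1 / J] almost everywhere on [D i]. The
    differential is taken along [D i], and says something about a direction only
    if [D i] accumulates at [x] in that direction; the points where this
    fails for some rational direction form a null set ([reachable_ae]). At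
    the other points the Lipschitz bound of the inverse of [gamma i] passes to
    the inverse of the differential ([dmx_lower_bound]), whose determinant is
    then at most [n! L^n]. *)

(** * Grid cells *)

Section grid.
Context {R : realType} {n : nat}.
Local Notation V := 'rV[R]_n.
Local Notation mu := (@lebesgue_rV R n).

Lemma coord_le_norm (x : V) j : `|x ord0 j| <= `|x|.
Proof.
rewrite [leRHS]/Num.norm /= mx_normrE; apply/bigmax_geP; right => /=.
by exists (ord0, j).
Qed.

Lemma norm_le_coord (x : V) (e : R) : 0 <= e ->
  (forall j, `|x ord0 j| <= e) -> `|x| <= e.
Proof.
move=> e0 xe; rewrite [leLHS]/Num.norm /= mx_normrE; apply/bigmax_leP; split => //.
by case=> i j _ /=; rewrite ord1.
Qed.

Definition box (I : 'I_n -> set R) : set V := [set v | forall j, I j (v ord0 j)].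

Lemma measurable_box (I : 'I_n -> set R) :
  (forall j, measurable (I j)) -> measurable (box I).
Proof.
move=> mI; rewrite (_ : box I = \big[setI/setT]_(i < n)
    ((fun v : V => v ord0 i) @^-1` I i)).
  apply: bigsetI_measurable => i _.
  by rewrite -[X in measurable X]setTI; exact: measurable_coor.
apply/seteqP; split => v; rewrite -bigcap_seq /=.
  by move=> Iv i _; exact: Iv.
by move=> Iv i; apply: Iv; rewrite /= mem_index_enum.
Qed.

Lemma measure_box (I : 'I_n -> set R) : (forall j, measurable (I j)) ->
  mu (box I) = (\prod_(i < n) lebesgue_measure (I i))%E.
Proof. exact: lebesgue_rV_box. Qed.

(** The cells of side [1 / (N + 1)] are half-open so that each grid is a partition. *)
Definition cell (N : nat) (z : 'rV[int]_n) : set V :=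
  box (fun j => `[(z ord0 j)%:~R / N.+1%:R, ((z ord0 j) + 1)%:~R / N.+1%:R[%classic).

Lemma measurable_cell N z : measurable (cell N z).
Proof. by apply: measurable_box => j; exact: measurable_itv. Qed.

Lemma measure_cell N z : mu (cell N z) = ((N.+1%:R^-1) ^+ n)%:E.
Proof.
rewrite measure_box//.
under eq_bigr => i _.
  rewrite lebesgue_measure_itv/= ifT; last first.
    by rewrite lte_fin ltr_pM2r ?invr_gt0// ltr_int ltrDl.
  rewrite -EFinB -mulrBl intrD [X in X - _]addrC addrK mul1r.
  over.
by rewrite prodEFin big_const card_ord iter_mulr_1.
Qed.

Definition cellof (N : nat) (x : V) : 'rV[int]_n :=
  \row_j Num.floor (N.+1%:R * x ord0 j).

Lemma cellP N z x : cell N z x <-> z = cellof N x.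
Proof.
have N0 : 0 < N.+1%:R :> R by [].
split=> [zx|->].
  apply/rowP => j; rewrite mxE; apply/esym/floor_def.
  have := zx j; rewrite /= in_itv/= ler_pdivrMr// ltr_pdivlMr//.
  by rewrite mulrC.
move=> j /=; rewrite in_itv/= ler_pdivrMr// ltr_pdivlMr// mxE mulrC.
exact: floor_itv.
Qed.

Lemma cell_diam N z x y : cell N z x -> cell N z y -> `|x - y| <= N.+1%:R^-1.
Proof.
move=> zx zy; apply: norm_le_coord => [//|j]; rewrite !mxE.
have := zx j; have := zy j; rewrite /= !in_itv/= intrD mulrDl mul1r.
move=> /andP[y1 y2] /andP[x1 x2]; rewrite ler_norml; apply/andP; split.
  by rewrite lerBrDl -lerBrDr opprK (le_trans (ltW y2))// lerD2r.
by rewrite lerBlDl (le_trans (ltW x2))// lerD2r.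
Qed.

End grid.

(** * Topology and measure of boxes and balls *)

Lemma near_invn_lt (R : realType) (e : R) : 0 < e ->
  \forall N \near \oo, N.+1%:R^-1 < e.
Proof.
move=> e0; exists (Num.truncn e^-1) => // N /= eN.
by rewrite invf_plt ?posrE// (lt_le_trans (truncnS_gt _))// ler_nat.
Qed.

Section regularity.
Context {R : realType} {n : nat}.
Local Notation V := 'rV[R]_n.
Local Notation mu := (@lebesgue_rV R n).

Definition nball (M : R) : set V := [set x | `|x| <= M].

Lemma nbhs_distP (x : V) (A : set V) :
  nbhs x A <-> exists2 e : R, 0 < e & forall y, `|x - y| < e -> A y.
Proof.
split=> [/nbhs_ballP[e e0 eA]|[e e0 eA]]; [|apply/nbhs_ballP]; exists e => // y.
  by move=> xy; apply: eA; rewrite -ball_normE.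
by rewrite -ball_normE => xy; exact: eA.
Qed.

Lemma closed_distP (F : set V) :
  (forall x, (forall e : R, 0 < e -> exists2 y, F y & `|x - y| < e) -> F x) ->
  closed F.
Proof.
move=> FP x Fx; apply: FP => e e0.
have /Fx[y [Fy yx]] : nbhs x [set y | `|x - y| < e].
  by apply/nbhs_distP; exists e.
by exists y.
Qed.

Lemma closed_closed_ball (c : V) (e : R) : closed [set y | `|y - c| <= e].
Proof.
apply: closed_distP => x xe; apply/ler_addgt0Pr => d d0.
have [y ye xy] := xe d d0.
rewrite (_ : x - c = (y - c) + (x - y)) ?(le_trans (ler_normD _ _))//.
  by rewrite lerD// ltW.
by rewrite [RHS]addrC addrA subrK.
Qed.

Lemma open_measurable_rV (O : set V) : open O -> measurable O.
Proof.
move=> oO; rewrite (_ : O = \bigcup_(p : nat * 'rV[int]_n)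
    (if `[< cell p.1 p.2 `<=` O >] then cell p.1 p.2 else set0)).
  apply: countable_bigcupT_measurable => [|p]; first exact: countableP.
  by case: ifP => _; [exact: measurable_cell|exact: measurable0].
apply/seteqP; split => [x Ox|x [p _]]; last by case: ifPn => // /asboolP; apply.
have /nbhs_distP[e e0 xeO] := open_nbhs_nbhs (conj oO Ox).
have [N _ /(_ N (leqnn N)) Ne] := near_invn_lt e0.
exists (N, cellof N x) => //=; case: asboolP; first by move=> _; exact/cellP.
case=> y xy; apply: xeO; apply: le_lt_trans Ne.
by apply: cell_diam xy; exact/cellP.
Qed.

Lemma closed_measurable_rV (F : set V) : closed F -> measurable F.
Proof.
move=> cF; rewrite -[F]setCK; apply: measurableC; apply: open_measurable_rV.
exact: closed_openC.
Qed.

Lemma closed_nball M : closed (nball M).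
Proof.
rewrite (_ : nball M = [set y | `|y - 0| <= M]); first exact: closed_closed_ball.
by apply/seteqP; split => y /=; rewrite subr0.
Qed.

Lemma measurable_nball M : measurable (nball M).
Proof. by apply: closed_measurable_rV; exact: closed_nball. Qed.

Lemma compact_measurable_rV (F : set V) : compact F -> measurable F.
Proof. by move=> cF; apply: closed_measurable_rV; exact: compact_closed. Qed.

Lemma measure_ball_le (c : V) (e : R) : 0 <= e ->
  (mu [set y | (`|y - c| <= e)%R] <= ((2 * e) ^+ n)%:E)%E.
Proof.
move=> e0; pose I j := `[c ord0 j - e, c ord0 j + e]%classic.
have mI j : measurable (I j) by exact: measurable_itv.
have -> : ((2 * e) ^+ n)%:E = mu (box I).
  rewrite measure_box// (eq_bigr (fun=> (2 * e)%:E)); last first.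
    move=> i _; rewrite lebesgue_measure_itv/= lte_fin.
    case: ifPn => [_|]; first by rewrite -EFinD; congr EFin; lra.
    by rewrite -leNgt => ee; congr EFin; lra.
  by rewrite prodEFin big_const card_ord iter_mulr_1.
apply: le_measure; rewrite ?inE.
- by apply: closed_measurable_rV; exact: closed_closed_ball.
- exact: measurable_box.
move=> y /= ye j; rewrite /I /= in_itv/=.
have := le_trans (coord_le_norm _ j) ye; rewrite !mxE ler_norml; lra.
Qed.

Lemma measure_nball_lty M : (mu (nball M) < +oo)%E.
Proof.
have [M0|M0] := leP 0 M.
  have := measure_ball_le 0 M0; rewrite (_ : [set _ | _] = nball M).
    by move=> /le_lt_trans; apply; rewrite ltry.
  by apply/seteqP; split => y /=; rewrite subr0.
rewrite (_ : nball M = set0) ?measure0//; apply/seteqP; split => // y /=.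
by rewrite /nball/= leNgt (lt_le_trans M0).
Qed.

Lemma bounded_lty (A : set V) M : measurable A -> A `<=` nball M ->
  (mu A < +oo)%E.
Proof.
move=> mA AM; apply: le_lt_trans (measure_nball_lty M).
by apply: le_measure; rewrite ?inE//; exact: measurable_nball.
Qed.

Lemma closed_bounded_compact (F : set V) M : closed F -> F `<=` nball M ->
  compact F.
Proof.
move=> cF FM; apply: bounded_closed_compact => //; exists M; split; first exact: num_real.
by move=> x Mx y /FM; rewrite /nball /= => /le_trans; apply; exact: ltW.
Qed.

Lemma compact_sub_nball (F : set V) : compact F -> exists M : R, F `<=` nball M.
Proof.
move=> /compact_bounded[M [Mr FM]]; exists (M + 1) => x Fx.
by apply: (FM (M + 1)) => //; rewrite ltrDl.
Qed.

Definition thick (F : set V) (e : R) : set V := [set y | exists2 x, F x & `|x - y| < e].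

Lemma open_thick F e : open (thick F e).
Proof.
rewrite (_ : thick F e = \bigcup_(x in F) ball x e).
  by apply: bigcup_open => x _; exact: ball_open.
by apply/seteqP; split => y [x Fx xy]; exists x => //; move: xy; rewrite -ball_normE.
Qed.

Lemma closed_thick (F : set V) y : closed F -> ~ F y ->
  exists2 e : R, 0 < e & ~ thick F e y.
Proof.
move=> cF Fy; have oF := closed_openC cF.
have /nbhs_distP[e e0 yeF] := open_nbhs_nbhs (conj oF Fy).
by exists e => // -[x Fx xye]; apply: (yeF x) => //; rewrite distrC.
Qed.

End regularity.

(** * Regularity of Lebesgue measure *)

Section regular.
Context {R : realType} {n : nat}.
Local Notation V := 'rV[R]_n.
Local Notation mu := (@lebesgue_rV R n).
Local Notation nball := (@nball R n).

(** Approximation from both sides, which makes the property stable under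
    complements; the error is measured in a ball because open sets may have
    infinite measure. *)
Definition regular_in (M : R) (A : set V) := forall e : R, 0 < e ->
  exists F O : set V, [/\ closed F, open O, F `<=` A, A `<=` O &
    (mu (nball M `&` (O `\` F)) < e%:E)%E].

Let mB := @measurable_nball R n.

Let nballI_lty M (A : set V) : measurable A -> (mu (nball M `&` A) < +oo)%E.
Proof.
move=> mA; apply: (@bounded_lty _ _ _ M); last by move=> x [].
exact: measurableI.
Qed.

(** Continuity from above, within a ball, where all measures are finite. *)
Lemma small_decr (G : nat -> set V) M (e : R) : 0 < e ->
  (forall k, measurable (G k)) ->
  (forall k l, (k <= l)%N -> G l `<=` G k) -> \bigcap_k G k = set0 ->
  exists k, (mu (nball M `&` G k) < e%:E)%E.
Proof.
move=> e0 mG dG G0.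
have : (mu \o (fun k => nball M `&` G k)) @ \oo --> mu (\bigcap_k (nball M `&` G k)).
  apply: nonincreasing_cvg_mu.
  - exact: nballI_lty.
  - by move=> i; exact: measurableI.
  - by apply: bigcapT_measurable => i; exact: measurableI.
  - by move=> k l kl; apply/subsetPset; apply: setIS; exact: dG.
rewrite (_ : \bigcap_k _ = set0) ?measure0; last first.
  apply/seteqP; split => // x xG; rewrite -G0 => k _.
  by have [] := xG k I.
move=> /fine_cvgP[[K1 _ HK1] /cvgr0Pnorm_lt /(_ _ e0)[K2 _ HK2]].
exists (maxn K1 K2); have := HK2 (maxn K1 K2) (leq_maxr _ _).
have := HK1 (maxn K1 K2) (leq_maxl _ _).
move=> /= f1 f2; rewrite -[ltLHS]fineK// lte_fin.
exact: le_lt_trans (ler_norm _) f2.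
Qed.

Lemma thick_small M (F : set V) (e : R) : closed F -> 0 < e ->
  exists k : nat, (mu (nball M `&` (thick F k.+1%:R^-1 `\` F)) < e%:E)%E.
Proof.
move=> cF e0; apply: small_decr => //.
- move=> k; apply: measurableD; last exact: closed_measurable_rV.
  by apply: open_measurable_rV; exact: open_thick.
- move=> k l kl y [[x Fx xy] Fy]; split => //; exists x => //.
  by rewrite (lt_le_trans xy)// lef_pV2 ?posrE// ler_nat.
- apply/seteqP; split => // y Gy; have [_ Fy] := Gy 0%N I.
  have [d d0 Fd] := closed_thick cF Fy.
  have [N _ /(_ N (leqnn N)) Nd] := near_invn_lt d0.
  have [[x Fx xy] _] := Gy N I.
  by apply: Fd; exists x => //; exact: lt_trans xy Nd.
Qed.

Lemma regular_closed M (F : set V) : closed F -> regular_in M F.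
Proof.
move=> cF e e0; have [k Gk] := thick_small M cF e0.
exists F, (thick F k.+1%:R^-1); split => //; first exact: open_thick.
by move=> x Fx; exists x => //; rewrite subrr normr0.
Qed.

Lemma regular_setC M (A : set V) : regular_in M A -> regular_in M (~` A).
Proof.
move=> rA e e0; have [F [ O [cF oO FA AO muFO]]] := rA e e0.
exists (~` O), (~` F); split.
- exact: open_closedC.
- exact: closed_openC.
- exact: subsetC.
- exact: subsetC.
- by rewrite setDE setCK (setIC (~` F)) -setDE.
Qed.

Lemma regular_bigcup M (A : nat -> set V) : (forall k, regular_in M (A k)) ->
  regular_in M (\bigcup_k A k).
Proof.
move=> rA e e0.
(* Half of the error is for the sum over the [A k], half for the closed union,
   which has to be cut down to finitely many of the [F k]. *)
have e2 k : 0 < (e / 2) / (2 ^ k.+1)%:R :> R.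
  by rewrite !divr_gt0// ltr0n expn_gt0.
have /choice[F /choice[ O FO]] : forall k, exists F O : set V,
   [/\ closed F, open O, F `<=` A k, A k `<=` O &
     (mu (nball M `&` (O `\` F)) < ((e / 2) / (2 ^ k.+1)%:R)%:E)%E].
  by move=> k; exact: rA (e2 k).
have mF k : measurable (F k).
  by apply: closed_measurable_rV; have [] := FO k.
have mO k : measurable (O k).
  by apply: open_measurable_rV; have [] := FO k.
pose G k := (\bigcup_j F j) `\` \bigcup_(j in `I_k) F j.
have mFk k : measurable (\bigcup_(j in `I_k) F j) by exact: bigcup_measurable.
have mFF : measurable (\bigcup_j F j) by exact: bigcupT_measurable.
have mOO : measurable (\bigcup_j O j) by exact: bigcupT_measurable.
have [k Gk] : exists k, (mu (nball M `&` G k) < (e / 2)%:E)%E.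
  apply: small_decr => //.
  - by rewrite divr_gt0.
  - by move=> k; exact: measurableD.
  - move=> k l kl x [Fx nFx]; split => // -[j /= jk Fj]; apply: nFx.
    by exists j => //=; exact: leq_trans jk kl.
  - apply/seteqP; split => // x xG; have [[j _ Fj] _] := xG 0%N I.
    by have [_] := xG j.+1 I; apply; exists j => /=.
exists (\bigcup_(j in `I_k) F j), (\bigcup_j O j); split.
- by apply: closed_bigcup => // i _; have [] := FO i.
- by apply: bigcup_open => i _; have [] := FO i.
- by move=> x [j _ Fj]; exists j => //; have [_ _ + _ _] := FO j; apply.
- by move=> x [j _ Aj]; exists j => //; have [_ _ _ + _] := FO j; apply.
have H1 : (mu (nball M `&` (\bigcup_j O j `\` \bigcup_j F j)) <= (e / 2)%:E)%E.
  apply: (@le_trans _ _ (mu (\bigcup_j (nball M `&` (O j `\` F j))))).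
    apply: le_measure; rewrite ?inE.
    - by apply: measurableI => //; exact: measurableD.
    - by apply: bigcupT_measurable => j; apply: measurableI => //; exact: measurableD.
    - move=> x [Mx [[j _ Oj] nF]]; exists j => //; split => //; split => //.
      by move=> Fj; apply: nF; exists j.
  apply: le_trans (le_mu_bigcup _ _ _) _.
  - by move=> j; apply: measurableI => //; exact: measurableD.
  - by apply: bigcupT_measurable => j; apply: measurableI => //; exact: measurableD.
  apply: (@le_trans _ _ (\sum_(j <oo) ((e / 2) / (2 ^ j.+1)%:R)%:E)%E).
    by apply: lee_nneseries => // j _; apply: ltW; have [] := FO j.
  by apply: epsilon_trick0; rewrite ltW// divr_gt0.
apply: (@le_lt_trans _ _ (mu ((nball M `&` (\bigcup_j O j `\` \bigcup_j F j)) `|`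
   (nball M `&` G k)))).
  apply: le_measure; rewrite ?inE.
  - by apply: measurableI => //; exact: measurableD.
  - apply: measurableU; apply: measurableI => //; first exact: measurableD.
    exact: measurableD.
  - move=> x [Mx [Ox nFx]].
    by have [Fx|Fx] := pselect ((\bigcup_j F j) x); [right|left].
apply: le_lt_trans (measureU2 _ _ _) _.
- by apply: measurableI => //; exact: measurableD.
- by apply: measurableI => //; exact: measurableD.
rewrite [e in X in (_ < X)%E]splitr EFinD lee_ltD//.
by rewrite ge0_fin_numE//; exact: le_lt_trans H1 (ltry _).
Qed.

(** The sets that are approximable from both sides form a sigma-algebra which
    contains the closed half-spaces, and these generate the measurable sets. *)
Lemma measurable_regular M (A : set V) : measurable A -> regular_in M A.
Proof.
have r0 : regular_in M set0 by apply: regular_closed; exact: closed0.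
move: A; apply: smallest_sub.
  split => //; first by move=> B rB; rewrite setTD; exact: regular_setC.
  by move=> B rB; exact: regular_bigcup.
move=> A; rewrite -bigcup_seq/= => -[i _ [B mcB <-]] /=; rewrite setTI.
move: B mcB.
suff : (measurable : set (set R)) `<=`
    [set B | regular_in M ((fun x : V => x ord0 i) @^-1` B)] by [].
rewrite [X in X `<=` _]RGenCInfty.measurableE; apply: smallest_sub.
  split => /=.
  - by rewrite preimage_set0.
  - by move=> B rB; rewrite setTD preimage_setC; exact: regular_setC.
  - by move=> B rB; rewrite preimage_bigcup; exact: regular_bigcup.
move=> B [a ->] /=; apply: regular_closed; apply: closed_distP => x xa.
rewrite /= in_itv/= andbT; apply/ler_addgt0Pr => d d0.
have [y] := xa d d0; rewrite /= in_itv/= andbT => ya xy.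
have := le_lt_trans (coord_le_norm _ i) xy; rewrite !mxE ltr_norml; lra.
Qed.

Lemma inner_regular M (A : set V) (e : R) : measurable A -> A `<=` nball M ->
  0 < e -> exists F, [/\ compact F, F `<=` A & (mu (A `\` F) < e%:E)%E].
Proof.
move=> mA AM e0; have [F [ O [cF oO FA AO muFO]]] := measurable_regular M mA e0.
exists F; split => //.
  by apply: (@closed_bounded_compact _ _ _ M) => //; exact: subset_trans AM.
apply: le_lt_trans muFO; apply: le_measure; rewrite ?inE.
- by apply: measurableD => //; exact: closed_measurable_rV.
- apply: measurableI => //; apply: measurableD; last exact: closed_measurable_rV.
  exact: open_measurable_rV.
- by move=> x [Ax nFx]; split; [exact: AM|split => //; exact: AO].
Qed.

(** Inner regularity on each ball: this is how estimates for compact sets are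
    turned into almost everywhere statements. *)
Lemma compact_null (A : set V) : measurable A ->
  (forall F, compact F -> F `<=` A -> mu F = 0%E) -> mu A = 0%E.
Proof.
move=> mA A0.
suff H k : mu (A `&` nball k%:R) = 0%E.
  rewrite (_ : A = \bigcup_k (A `&` nball k%:R)).
    apply/eqP; rewrite eq_le measure_ge0 andbT.
    apply: le_trans (le_mu_bigcup _ _ _) _.
    - by move=> k; exact: measurableI.
    - by apply: bigcupT_measurable => k; exact: measurableI.
    by rewrite eseries0// => i _ _; exact: H.
  apply/seteqP; split => [x Ax|x [k _ []]//].
  exists (Num.truncn `|x|).+1 => //; split => //.
  by rewrite /nball /= ltW// truncnS_gt.
apply/eqP; rewrite eq_le measure_ge0 andbT; apply/lee_addgt0Pr => e e0.
have [F [cF FA AF]] : exists F, [/\ compact F, F `<=` A `&` nball k%:R &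
     (mu ((A `&` nball k%:R) `\` F) < e%:E)%E].
  by apply: (@inner_regular k%:R) => //; exact: measurableI.
rewrite add0e (le_trans _ (ltW AF))// -[leRHS]add0e -(A0 F cF); last first.
  by move=> x /FA[].
have mF := compact_measurable_rV cF.
have mAk : measurable (A `&` nball k%:R) by exact: measurableI.
have mAF : measurable ((A `&` nball k%:R) `\` F) by exact: measurableD.
apply: le_trans (measureU2 _ mF mAF).
apply: le_measure; rewrite ?inE//; first exact: measurableU.
by move=> x Ax; have [Fx|Fx] := pselect (F x); [left|right].
Qed.

End regular.

(** * Approximation of bounded measurable sets by cells *)

Section hull.
Context {R : realType} {n : nat}.
Local Notation V := 'rV[R]_n.
Local Notation mu := (@lebesgue_rV R n).
Local Notation nball := (@nball R n).

Definition hull (N : nat) (F : set V) : set V :=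
  [set y | exists2 x, F x & cellof N x = cellof N y].

Lemma sub_hull N F : F `<=` hull N F.
Proof. by move=> x Fx; exists x. Qed.

Lemma hull_dist N F y : hull N F y -> exists2 x, F x & `|x - y| <= N.+1%:R^-1.
Proof.
by move=> [x Fx xy]; exists x => //; apply: (@cell_diam _ _ N (cellof N x)); apply/cellP.
Qed.

(** Slicing a union of cells by the number of the cell turns it into a countable
    disjoint union. *)
Lemma hull_pickle N F k :
  hull N F `&` [set y | pickle (cellof N y) = k] =
  if pickle_inv k is Some z then
    if `[< hull N F `&` cell N z !=set0 >] then cell N z else set0 else set0.
Proof.
case pk : (pickle_inv k) => [z|]; last first.
  by apply/seteqP; split => // y [_ /= yk]; rewrite -yk pickleK_inv in pk.
have zk : pickle z = k by have := @pickle_invK 'rV[int]_n k; rewrite pk.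
have zP y : pickle (cellof N y) = k <-> cell N z y.
  rewrite (cellP N z y); split => [yk| <-]; last by rewrite zk.
  by apply: (pcan_inj (@pickleK _)); rewrite zk.
case: asboolP => [[w [[x Fx xw] zw]]|nz]; apply/seteqP; split => // y.
- by move=> [_ /zP].
- move=> zy; split; last exact/zP.
  exists x => //; rewrite xw; move/cellP: zy => <-.
  by move/cellP: zw => <-.
- by move=> [hy /zP zy]; apply: nz; exists y.
Qed.

Lemma measurable_hull_pickle N F k :
  measurable (hull N F `&` [set y | pickle (cellof N y) = k]).
Proof.
rewrite hull_pickle; case: pickle_inv => [z|]; last exact: measurable0.
by case: ifP => _; [exact: measurable_cell|exact: measurable0].
Qed.

Lemma hull_bigcup N F :
  hull N F = \bigcup_k (hull N F `&` [set y | pickle (cellof N y) = k]).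
Proof.
apply/seteqP; split => [y hy|y [k _ []]//].
by exists (pickle (cellof N y)).
Qed.

Lemma measurable_hull N F : measurable (hull N F).
Proof.
by rewrite hull_bigcup; apply: bigcupT_measurable => k; exact: measurable_hull_pickle.
Qed.

Lemma hull_nball N F M : F `<=` nball M -> hull N F `<=` nball (M + 1).
Proof.
move=> FM y /hull_dist[x /FM xM xy]; rewrite /nball /= in xM *.
rewrite -[y](subrK x) (le_trans (ler_normD _ _))// addrC lerD// distrC.
by rewrite (le_trans xy)// invf_le1// ler1n.
Qed.

Lemma hull_closed F y : closed F -> ~ F y -> \forall N \near \oo, ~ hull N F y.
Proof.
move=> cF Fy; have [e e0 Fe] := closed_thick cF Fy.
have [N0 _ HN] := near_invn_lt e0.
exists N0 => // N /HN Ne /hull_dist[x Fx xy]; apply: Fe.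
by exists x => //; exact: le_lt_trans Ne.
Qed.

(** A union of cells is an increasing limit of finite disjoint unions, a compact
    set is the limit of the unions of cells that meet it, and a bounded measurable set
    is, up to a null set, an increasing limit of compact sets. In the limit
    clause, points outside [A] leave the [A_ k] without exception: locality
    is tested at [gamma i x], and the preimage of a null set under [gamma i] is not
    under control. *)
Lemma bounded_measurable_ind (P : set V -> Prop) :
  P set0 -> (forall N z, P (cell N z)) ->
  (forall A B M, measurable A -> measurable B -> A `<=` nball M ->
     B `<=` nball M -> A `&` B = set0 -> P A -> P B -> P (A `|` B)) ->
  (forall (A_ : nat -> set V) A M, (forall k, measurable (A_ k)) ->
     (forall k, A_ k `<=` nball M) -> measurable A -> A `<=` nball M ->
     (forall k, P (A_ k)) ->
     (forall x, ~ A x -> \forall k \near \oo, ~ A_ k x) ->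
     {ae mu, forall x, A x -> \forall k \near \oo, A_ k x} -> P A) ->
  forall A M, measurable A -> A `<=` nball M -> P A.
Proof.
move=> P0 Pcell PU Plim.
have Phull N F M : F `<=` nball M -> P (hull N F).
  move=> /(@hull_nball N) FM.
  pose H k := hull N F `&` [set y | (pickle (cellof N y) < k)%N].
  have HS k : H k.+1 = H k `|` (hull N F `&` [set y | pickle (cellof N y) = k]).
    rewrite /H -setIUr; congr (_ `&` _); apply/seteqP; split => y /=.
      by rewrite ltnS leq_eqVlt => /orP[/eqP|]; [right|left].
    by case=> [|->//]; exact: ltnW.
  have mH k : measurable (H k).
    elim: k => [|k IH].
      by rewrite (_ : H 0%N = set0) ?measurable0//; apply/seteqP; split => // y [].
    by rewrite HS; apply: measurableU => //; exact: measurable_hull_pickle.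
  have HM k : H k `<=` nball (M + 1) by move=> x [/FM].
  apply: (Plim H _ (M + 1)) => //; first exact: measurable_hull.
  - elim=> [|k IH].
      by rewrite (_ : H 0%N = set0)//; apply/seteqP; split => // y [].
    rewrite HS; apply: (PU _ _ (M + 1)) => //.
    + exact: measurable_hull_pickle.
    + by move=> y [/FM].
    + by apply/seteqP; split => // y [[_ /= yk] [_ /= ky]]; rewrite ky ltnn in yk.
    rewrite hull_pickle; case: pickle_inv => [z|//].
    by case: ifP => _.
  - by move=> x hx; near=> k => -[].
  - apply: aeW => x hx; by exists (pickle (cellof N x)).+1.
have Pcompact F M : compact F -> F `<=` nball M -> P F.
  move=> cF FM; apply: (Plim (fun N => hull N F) F (M + 1)) => //.
  - by move=> k; exact: measurable_hull.
  - by move=> k; exact: hull_nball.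
  - exact: compact_measurable_rV.
  - by move=> x /FM; rewrite /nball/= => /le_trans; apply; rewrite lerDl.
  - by move=> k; exact: (@Phull _ _ M).
  - by move=> x; apply: hull_closed; exact: compact_closed.
  - by apply: aeW => x Fx; near=> k; exact: sub_hull.
move=> A M mA AM.
have /choice[F FP] : forall k : nat, exists F : set V, [/\ compact F, F `<=` A &
    (mu (A `\` F) < (k.+1%:R^-1)%:E)%E].
  by move=> k; apply: (@inner_regular _ _ M).
pose G k := \big[setU/set0]_(j < k) F j.
have GA k : G k `<=` A.
  by rewrite /G -bigcup_mkord => x [j _ Fj]; have [_ + _] := FP j; apply.
have cG k : compact (G k).
  apply: big_ind => [|B C cB cC|j _]; [exact: compact0|exact: compactU|].
  by have [] := FP j.
apply: (Plim G A M) => //.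
- by move=> k; exact: compact_measurable_rV.
- by move=> k; exact: subset_trans AM.
- by move=> k; apply: (@Pcompact _ M) => //; exact: subset_trans AM.
- by move=> x nAx; near=> k => /GA.
exists (A `\` \bigcup_j F j); split.
- apply: measurableD => //; apply: bigcupT_measurable => j.
  by apply: compact_measurable_rV; have [] := FP j.
- apply/eqP; rewrite eq_le measure_ge0 andbT; apply/lee_addgt0Pr => e e0.
  have [k _ /(_ k (leqnn k)) ke] := near_invn_lt e0.
  have [cF _ muk] := FP k; have mF := compact_measurable_rV cF.
  rewrite add0e; apply: (@le_trans _ _ (mu (A `\` F k))).
    apply: le_measure; rewrite ?inE.
    + apply: measurableD => //; apply: bigcupT_measurable => j.
      by apply: compact_measurable_rV; have [] := FP j.
    + exact: measurableD.
    + by move=> x [Ax nF]; split => // Fx; apply: nF; exists k.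
  by rewrite (le_trans (ltW muk))// lee_fin ltW.
- move=> x /= nx; apply: contrapT => nF; apply: nx => Ax.
  have [[j _ Fj]|nFx] := pselect ((\bigcup_j F j) x); last by case: nF.
  exists j.+1 => // k /= jk; rewrite /G -bigcup_mkord.
  by exists j.
Unshelve. all: by end_near. Qed.

End hull.

(** * Lipschitz images *)

Section lipschitz.
Context {R : realType} {n : nat}.
Local Notation V := 'rV[R]_n.
Local Notation mu := (@lebesgue_rV R n).
Local Notation nball := (@nball R n).

Definition lipschitz_within (c : R) (A : set V) (f : V -> V) :=
  forall x y, A x -> A y -> `|f x - f y| <= c * `|x - y|.

Lemma lipschitz_compact (c : R) (F : set V) f : lipschitz_within c F f ->
  compact F -> compact (f @` F).
Proof.
move=> fc cF; apply: continuous_compact => //.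
apply/subspace_continuousP => x Fx B /nbhs_distP[e e0 xeB].
apply/nbhs_distP; have c0 : 0 < `|c| + 1 by rewrite ltr_wpDl.
exists (e / (`|c| + 1)); first exact: divr_gt0.
move=> y; rewrite ltr_pdivlMr// => xy Fy; apply: xeB.
apply: le_lt_trans (fc _ _ Fx Fy) _; apply: le_lt_trans xy.
by rewrite mulrC ler_wpM2l// (le_trans (ler_norm _))// lerDl.
Qed.

(** The hulls lie in arbitrarily thin neighborhoods of the compact set. *)
Lemma hull_measure (F : set V) (e : R) : compact F -> 0 < e ->
  exists N, (mu (hull N F) <= mu F + e%:E)%E.
Proof.
move=> cF e0; have [M FM] := compact_sub_nball cF.
have clF := compact_closed (@norm_hausdorff _ _) cF.
have mF := compact_measurable_rV cF.
have [k ke] := thick_small (M + 1) clF e0.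
have mT : measurable (nball (M + 1) `&` (thick F k.+1%:R^-1 `\` F)).
  apply: measurableI; first exact: measurable_nball.
  by apply: measurableD => //; apply: open_measurable_rV; exact: open_thick.
exists k.+1; apply: le_trans (leeD (lexx _) (ltW ke)).
apply: le_trans (measureU2 _ mF mT).
apply: le_measure; rewrite ?inE//; [exact: measurable_hull|exact: measurableU|].
move=> y hy; have [Fy|nFy] := pselect (F y); [by left|right].
split; first exact: hull_nball hy.
split => //; have [x Fx xy] := hull_dist hy; exists x => //.
by rewrite (le_lt_trans xy)// ltf_pV2 ?posrE// ltr_nat.
Qed.

(** The image of the part of [F] in a cell of side [s] lies in a ball of radius
    [c * s], whose measure is [(2 * c) ^ n] times that of the cell. Summing over
    the cells that meet [F] gives the same bound with a hull of [F] in place of [F]. *)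
Lemma lipschitz_measure (c : R) (F : set V) f : 0 <= c -> lipschitz_within c F f ->
  compact F -> (mu (f @` F) <= ((2 * c) ^+ n)%:E * mu F)%E.
Proof.
move=> c0 fc cF.
have mfF : measurable (f @` F).
  by apply: compact_measurable_rV; exact: (lipschitz_compact fc cF).
have c20 : 0 <= (2 * c) ^+ n by rewrite exprn_ge0// mulr_ge0.
have main N : (mu (f @` F) <= ((2 * c) ^+ n)%:E * mu (hull N F))%E.
  pose H k := hull N F `&` [set y | pickle (cellof N y) = k].
  have /choice[B BP] : forall k, exists B : set V, [/\ measurable B,
      f @` (F `&` [set y | pickle (cellof N y) = k]) `<=` B &
      (mu B <= ((2 * c) ^+ n)%:E * mu (H k))%E].
    move=> k; have [[x0 [Fx0 x0k]]|F0] :=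
        pselect (F `&` [set y | pickle (cellof N y) = k] !=set0); last first.
      exists set0; split => //; last by rewrite measure0 mule_ge0// lee_fin.
      by move=> y [x Fx _]; apply: F0; exists x.
    exists [set y | `|y - f x0| <= c * N.+1%:R^-1]; split.
    - by apply: closed_measurable_rV; exact: closed_closed_ball.
    - move=> _ [x [Fx xk] <-] /=; apply: le_trans (fc _ _ Fx Fx0) _.
      rewrite ler_wpM2l//; apply: (@cell_diam _ _ N (cellof N x)); apply/cellP => //.
      by apply: (pcan_inj (@pickleK _)); rewrite xk x0k.
    - have -> : mu (H k) = ((N.+1%:R^-1) ^+ n)%:E.
        rewrite /H hull_pickle -x0k pickleK_inv ifT; first by rewrite measure_cell.
        apply/asboolP; exists x0; split; [exact: sub_hull|exact/cellP].
      rewrite -EFinM -exprMn -mulrA; apply: measure_ball_le.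
      by rewrite mulr_ge0.
  apply: (@le_trans _ _ (mu (\bigcup_k B k))).
    apply: le_measure; rewrite ?inE//.
      by apply: bigcupT_measurable => k; have [] := BP k.
    move=> _ [x Fx <-]; exists (pickle (cellof N x)) => //.
    by have [_ + _] := BP (pickle (cellof N x)); apply; exists x.
  apply: le_trans (le_mu_bigcup _ _ _) _.
  - by move=> k; have [] := BP k.
  - by apply: bigcupT_measurable => k; have [] := BP k.
  apply: (@le_trans _ _ (\sum_(k <oo) ((2 * c) ^+ n)%:E * mu (H k))%E).
    by apply: lee_nneseries => // k _; have [] := BP k.
  rewrite nneseriesZl//.
  rewrite hull_bigcup measure_semi_bigcup//.
  - by move=> k; exact: measurable_hull_pickle.
  - by move=> i j _ _ [y [[_ <-] [_ <-]]].
  - by apply: bigcupT_measurable => k; exact: measurable_hull_pickle.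
have [c1|c1] := eqVneq ((2 * c) ^+ n) 0.
  by have := main 0%N; rewrite c1 !mul0e.
have c2 : 0 < (2 * c) ^+ n by rewrite lt_neqAle eq_sym c1.
apply/lee_addgt0Pr => e e0.
have [N hN] := hull_measure cF (divr_gt0 e0 c2).
apply: le_trans (main N) _; apply: le_trans (lee_wpmul2l _ hN) _.
  by rewrite lee_fin ltW.
rewrite ge0_muleDr//; last by rewrite lee_fin divr_ge0// ltW.
by rewrite -EFinM mulrCA divff// mulr1.
Qed.

End lipschitz.

(** * Flat functions of one variable *)

Section flat.
Context {R : realType}.
Implicit Types (p : {poly R}) (t : R).

(** The functions [p (1 / t) * exp (- 1 / t)], extended by zero: this family is
    stable under differentiation, which makes smoothness an induction. *)
Definition flat p t : R := if 0 < t then p.[t^-1] * expR (- t^-1) else 0.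

Definition flat_deriv p : {poly R} := 'X^2 * (p - p^`()).

(** Each monomial is bounded by a term of the exponential series. *)
Lemma poly_expR_bounded p : exists K, forall u : R, 0 <= u -> `|p.[u]| * expR (- u) <= K.
Proof.
exists (\sum_(i < size p) `|p`_i| * i`!%:R) => u u0.
have e0 := expR_gt0 (- u).
rewrite horner_coef -ler_pdivlMr// -expRN opprK.
apply: le_trans (ler_norm_sum _ _ _) _; rewrite mulr_suml.
apply: ler_sum => i _; rewrite normrM -mulrA ler_wpM2l// ger0_norm ?exprn_ge0//.
case: (nat_of_ord i) => [|j].
  by rewrite expr0 fact0 mul1r -expR0 ler_expR.
rewrite mulrC -ler_pdivrMr ?ltr0n ?fact_gt0//.
by apply: le_trans (expR_ge1Dxn j u0); rewrite lerDr.
Qed.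

(** A quadratic bound is enough for a zero derivative at the origin. *)
Lemma flat_quadratic p : exists K, forall t, `|flat p t| <= K * t ^+ 2.
Proof.
have [K KP] := poly_expR_bounded ('X^2 * p); exists K => t; rewrite /flat.
case: ifPn => [t0|_]; last first.
  rewrite normr0 mulr_ge0 ?sqr_ge0//; apply: le_trans (KP 0 (lexx _)).
  by rewrite mulr_ge0 ?expR_ge0.
have := KP t^-1; rewrite invr_ge0 ltW// => /(_ isT).
rewrite hornerM hornerXn normrM -mulrA.
rewrite [`|t^-1 ^+ 2|]ger0_norm ?sqr_ge0// exprVn mulrC ler_pdivrMr ?exprn_gt0//.
by rewrite normrM [`|expR _|]ger0_norm ?expR_ge0.
Qed.

Lemma quadratic_is_derive0 (f : R -> R) K :
  (forall t, `|f t| <= K * t ^+ 2) -> is_derive (0 : R) 1 f 0.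
Proof.
move=> fK; have f0 : f 0 = 0.
  by apply/eqP; rewrite -normr_le0; have := fK 0; rewrite expr0n/= mulr0.
have H : h^-1 *: ((f \o shift 0) h%:A - f 0) @[h --> 0^'] --> (0 : R).
  apply/cvgrPdist_lt => e e0; near=> h.
  have hn0 : h != 0 by near: h; exact: nbhs_dnbhs_neq.
  rewrite sub0r normrN f0 subr0 /= addr0 [h%:A]mulr1 normrM normfV mulrC.
  rewrite ltr_pdivrMr ?normr_gt0//; apply: le_lt_trans (fK h) _.
  rewrite -[h ^+ 2]real_normK ?num_real// expr2 mulrA ltr_pM2r ?normr_gt0//.
  have K0 : 0 < `|K| + 1 by rewrite ltr_wpDl.
  apply: (@le_lt_trans _ _ ((`|K| + 1) * `|h|)).
    by rewrite ler_wpM2r// (le_trans (ler_norm _))// lerDl.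
  rewrite mulrC -ltr_pdivlMr//; near: h.
  by apply: dnbhs0_lt; exact: divr_gt0.
apply: DeriveDef; first by apply/cvg_ex; exists 0.
by apply/cvg_lim.
Unshelve. all: by end_near. Qed.

Lemma is_derive_flat p t : is_derive t 1 (flat p) (flat (flat_deriv p) t).
Proof.
have [t0|t0|->] := ltgtP t 0.
- have -> : flat (flat_deriv p) t = 0 by rewrite /flat ltNge (ltW t0).
  apply: (@near_eq_is_derive _ _ _ (cst 0)).
  exists (- t); first by rewrite /= oppr_gt0.
  move=> s /=; rewrite ltr_norml => /andP[ts _].
  by rewrite /flat ltNge ifN// negbK; lra.
- rewrite /flat t0.
  apply: (@near_eq_is_derive _ _ _
    ((fun u => p.[u] * expR (- u)) \o (fun s => s^-1))).
    exists t => // s /=; rewrite ltr_norml => /andP[_ ts].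
    by rewrite /flat ifT//; lra.
  have tn0 : t != 0 by rewrite gt_eqF.
  have dV : is_derive t 1 (fun s : R => s^-1) (- t ^- 2).
    apply: is_derive_eq; first exact: is_deriveV.
    by rewrite /GRing.scale /= mulr1.
  have de : is_derive t^-1 1 (expR \o -%R) (expR (- t^-1) * - 1).
    exact: is_derive1_comp.
  have dM : is_derive t^-1 1 ((horner p) * (expR \o -%R))
      (p.[t^-1] * (expR (- t^-1) * - 1) + expR (- t^-1) * p^`().[t^-1]).
    exact: is_deriveM.
  have := is_derive1_comp dM dV.
  move=> /is_derive_eq; apply.
  rewrite /flat_deriv hornerM hornerXn hornerD hornerN exprVn.
  ring.
- have -> : flat (flat_deriv p) 0 = 0 by rewrite /flat ltxx.
  by have [K] := flat_quadratic p; exact: quadratic_is_derive0.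
Qed.

Lemma flat_ge0 t : 0 <= flat 1 t.
Proof. by rewrite /flat; case: ifP => // _; rewrite hornerE mul1r expR_ge0. Qed.

Lemma flat_le1 t : flat 1 t <= 1.
Proof.
rewrite /flat; case: ifPn => // t0; rewrite hornerE mul1r -expR0 ler_expR.
by rewrite oppr_le0 invr_ge0 ltW.
Qed.

Lemma flat_eq0 p t : t <= 0 -> flat p t = 0.
Proof. by move=> t0; rewrite /flat ltNge t0. Qed.

Lemma flat_ge t : 0 < t -> 1 - t^-1 <= flat 1 t.
Proof.
by move=> t0; rewrite /flat t0 hornerE mul1r (le_trans _ (expR_ge1Dx _)).
Qed.

End flat.

(** * Smooth functions of several variables *)

Section smooth_functions.
Context {R : realType} {n : nat}.
Local Notation V := 'rV[R]_n.
Implicit Types f g : V -> R.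

(** Smoothness stratified by order, so that products and sums can be handled
    by induction on the order. *)
Fixpoint smooth_upto (k : nat) f : Prop :=
  (forall x, differentiable f x) /\
  if k is k'.+1 then forall i : 'I_n, smooth_upto k' ('D_(delta_mx 0 i) f)
  else True.

Lemma smooth_upto_diff k f x : smooth_upto k f -> differentiable f x.
Proof. by case: k => [|k] []. Qed.

Lemma smooth_uptoW k f : smooth_upto k.+1 f -> smooth_upto k f.
Proof.
elim: k f => [|k IH] f [df dDf]; split => // i; apply: IH; exact: dDf.
Qed.

Lemma smooth_upto_smooth f : (forall k, smooth_upto k f) -> smooth f.
Proof.
move=> sf s; have {sf} := sf (size s).
elim/last_ind: s f => [|s i IH] f; first by move=> [].
rewrite size_rcons /iter_partial foldr_rcons => -[_ sDf] x.
exact: IH (sDf i) x.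
Qed.

Lemma smooth_upto_cst k (c : R) : smooth_upto k (fun=> c).
Proof.
elim: k c => [|k IH] c; split => //.
by move=> i; rewrite (_ : 'D_ _ _ = fun=> 0)//; apply/funext => x; exact: derive_cst.
Qed.

Lemma smooth_uptoD k f g : smooth_upto k f -> smooth_upto k g ->
  smooth_upto k (fun x => f x + g x).
Proof.
elim: k f g => [|k IH] f g [df sf] [dg sg]; split => //.
- by move=> x; exact: differentiableD.
- by move=> x; exact: differentiableD.
move=> i; have -> : 'D_(delta_mx 0 i) (fun x => f x + g x) =
    (fun x => 'D_(delta_mx 0 i) f x + 'D_(delta_mx 0 i) g x).
  by apply/funext => x; apply: deriveD; exact: diff_derivable.
by apply: IH; [exact: sf|exact: sg].
Qed.

Lemma smooth_uptoM k f g : smooth_upto k f -> smooth_upto k g ->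
  smooth_upto k (fun x => f x * g x).
Proof.
elim: k f g => [|k IH] f g sf sg; split => //.
- by move=> x; apply: differentiableM; [have [] := sf|have [] := sg].
- by move=> x; apply: differentiableM; [have [] := sf|have [] := sg].
move=> i; have -> : 'D_(delta_mx 0 i) (fun x => f x * g x) =
    (fun x => f x * 'D_(delta_mx 0 i) g x + g x * 'D_(delta_mx 0 i) f x).
  apply/funext => x; apply: deriveM; apply: diff_derivable.
    by have [] := sf.
  by have [] := sg.
have [_ sDf] := sf; have [_ sDg] := sg; have sf' := smooth_uptoW sf.
have sg' := smooth_uptoW sg.
by apply: smooth_uptoD; apply: IH => //; [exact: sDg|exact: sDf].
Qed.

Lemma smooth_upto_prod k (I : Type) (s : seq I) (h : I -> V -> R) :
  (forall j, smooth_upto k (h j)) ->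
  smooth_upto k (fun x => \prod_(j <- s) h j x).
Proof.
move=> sh; elim: s => [|j s IH].
  under eq_fun do rewrite big_nil; exact: smooth_upto_cst.
by under eq_fun do rewrite big_cons; exact: smooth_uptoM.
Qed.

Lemma is_derive_coord (x v : V) (j : 'I_n) (a b : R) :
  is_derive x v (fun y : V => a * y ord0 j + b) (a * v ord0 j).
Proof.
have H : h^-1 *: (((fun y : V => a * y ord0 j + b) \o shift x) (h *: v) -
    (a * x ord0 j + b)) @[h --> 0^'] --> a * v ord0 j.
  apply: cvg_near_cst; near=> h.
  have hn0 : h != 0 by near: h; exact: nbhs_dnbhs_neq.
  by rewrite /GRing.scale /= !mxE; field.
by apply: DeriveDef; [apply/cvg_ex; exists (a * v ord0 j)|exact/cvg_lim].
Unshelve. all: by end_near. Qed.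


(** The partial derivatives are again flat functions of the same affine form. *)
Lemma smooth_upto_flat k p (a b : R) (j : 'I_n) :
  smooth_upto k (fun x : V => flat p (a * x ord0 j + b)).
Proof.
have dl (x : V) : differentiable (fun y : V => a * y ord0 j + b) x.
  apply: differentiableD => //; apply: differentiableM => //.
  exact: differentiable_coord.
have df (t : R) q : differentiable (flat q) t.
  by apply/derivable1_diffP; have [] := is_derive_flat q t.
elim: k p => [|k IH] p; split => //.
- by move=> x; exact: (differentiable_comp (dl x) (df _ _)).
- by move=> x; exact: (differentiable_comp (dl x) (df _ _)).
move=> i; pose c := a * (delta_mx 0 i : V) ord0 j.
have -> : 'D_(delta_mx 0 i) (fun x : V => flat p (a * x ord0 j + b)) =
    (fun x : V => flat (c *: flat_deriv p) (a * x ord0 j + b)).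
  apply/funext => x; rewrite deriveE; last exact: (differentiable_comp (dl x) (df _ _)).
  rewrite (diff_comp (dl x) (df _ _)) /= diff1E// -deriveE//.
  have [_ ->] := is_derive_coord x (delta_mx 0 i) j a b.
  rewrite derive1E; have [_ ->] := is_derive_flat p (a * x ord0 j + b).
  rewrite /flat; case: ifP => _; last by rewrite scaler0.
  by rewrite hornerZ -mulrA.
exact: IH.
Qed.

End smooth_functions.

(** * Square-integrable complex functions *)

Section square_integral.
Context {R : realType} {n : nat}.
Local Notation V := 'rV[R]_n.
Local Notation C := R[i].
Local Notation mu := (@lebesgue_rV R n).
Local Notation Re := complex.Re.
Local Notation Im := complex.Im.
Implicit Types (f g : V -> C) (a z w : C).

Lemma sqr_normcE z : normc z ^+ 2 = Re z ^+ 2 + Im z ^+ 2.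
Proof. by case: z => x y /=; rewrite sqr_sqrtr// addr_ge0// sqr_ge0. Qed.

Lemma normc_ge0 z : 0 <= normc z.
Proof. by case: z => x y; exact: sqrtr_ge0. Qed.

Lemma ReM z w : Re (z * w) = Re z * Re w - Im z * Im w.
Proof. by case: z w => [a b] [c d]. Qed.

Lemma ImM z w : Im (z * w) = Re z * Im w + Im z * Re w.
Proof. by case: z w => [a b] [c d]. Qed.

Lemma ReD z w : Re (z + w) = Re z + Re w.
Proof. by case: z w => [a b] [c d]. Qed.

Lemma ImD z w : Im (z + w) = Im z + Im w.
Proof. by case: z w => [a b] [c d]. Qed.

Lemma ReN z : Re (- z) = - Re z. Proof. by case: z. Qed.
Lemma ImN z : Im (- z) = - Im z. Proof. by case: z. Qed.

Lemma sqr_normcD z w :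
  normc (z + w) ^+ 2 <= 2 * normc z ^+ 2 + 2 * normc w ^+ 2.
Proof.
rewrite !sqr_normcE ReD ImD; set a := Re z; set b := Im z; set c := Re w.
set d := Im w; have := sqr_ge0 (a - c); have := sqr_ge0 (b - d); nra.
Qed.

Lemma cmeasurableD A f g : cmeasurable_fun A f -> cmeasurable_fun A g ->
  cmeasurable_fun A (fun x => f x + g x).
Proof.
move=> [f1 f2] [g1 g2]; split.
- by under eq_fun do rewrite ReD; exact: measurable_funD.
- by under eq_fun do rewrite ImD; exact: measurable_funD.
Qed.

Lemma cmeasurableM A f g : cmeasurable_fun A f -> cmeasurable_fun A g ->
  cmeasurable_fun A (fun x => f x * g x).
Proof.
move=> [f1 f2] [g1 g2]; split.
- by under eq_fun do rewrite ReM; apply: measurable_funB; exact: measurable_funM.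
- by under eq_fun do rewrite ImM; apply: measurable_funD; exact: measurable_funM.
Qed.

Lemma cmeasurable_cst (A : set V) a : cmeasurable_fun A (fun=> a).
Proof. by split; exact: measurable_cst. Qed.

Lemma cmeasurable_real A (f : V -> R) : measurable_fun A f ->
  cmeasurable_fun A (fun x => (f x)%:C).
Proof. by move=> mf; split => //=; exact: measurable_cst. Qed.

Lemma cmeasurableS A B f : measurable B -> A `<=` B ->
  cmeasurable_fun B f -> cmeasurable_fun A f.
Proof. by move=> mB AB [f1 f2]; split; exact: measurable_funS mB AB _. Qed.

Lemma measurable_sqr_normc A f : cmeasurable_fun A f ->
  measurable_fun A (fun x => normc (f x) ^+ 2).
Proof.
move=> [f1 f2]; under eq_fun do rewrite sqr_normcE.
by apply: measurable_funD; exact: measurable_funX.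
Qed.

Definition sqint f : \bar R := (\int[mu]_x (normc (f x) ^+ 2)%:E)%E.

Lemma sqint_ge0 f : (0 <= sqint f)%E.
Proof. by apply: integral_ge0 => x _; rewrite lee_fin sqr_ge0. Qed.

(** Limits and linear estimates are easier for the integral of the square than
    for the norm. *)
Lemma L2norm_sqint f : (L2norm f `^ 2 = sqint f)%E.
Proof.
rewrite /L2norm poweR_Lnorm//; apply: eq_integral => x _.
by rewrite /= ger0_norm ?normc_ge0// powR_mulrn ?normc_ge0.
Qed.

Lemma L2P f : L2 f <-> cmeasurable_fun setT f /\ (sqint f < +oo)%E.
Proof.
rewrite /L2 -L2norm_sqint; split => -[mf f2]; split => //.
  exact: poweR_lty.
exact: lty_poweRy f2.
Qed.

Lemma L2norm_ge0 f : (0 <= L2norm f)%E.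
Proof. exact: Lnorm_ge0. Qed.

Lemma sqint_le_scale c f g : (L2norm f <= c%:E * L2norm g)%E ->
  (sqint f <= (c ^+ 2)%:E * sqint g)%E.
Proof.
move=> fg; rewrite -!L2norm_sqint.
have {fg} : (L2norm f <= `|c|%:E * L2norm g)%E.
  apply: le_trans fg _; apply: lee_wpmul2r; first exact: L2norm_ge0.
  by rewrite lee_fin ler_norm.
move=> fg; have := gt0_ler_poweR (ler0n R 2) _ _ fg.
rewrite !in_itv/= !leey !andbT; move=> /(_ (L2norm_ge0 _)).
rewrite mule_ge0 ?lee_fin ?normr_ge0 ?L2norm_ge0// => /(_ isT).
rewrite poweRM ?lee_fin ?L2norm_ge0// => /le_trans; apply.
by rewrite poweR_EFin powR_mulrn// real_normK ?num_real.
Qed.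

Lemma sqintD f g : cmeasurable_fun setT f -> cmeasurable_fun setT g ->
  (sqint (fun x => f x + g x)%R <= 2%:E * sqint f + 2%:E * sqint g)%E.
Proof.
move=> mf mg; have mf2 := measurable_sqr_normc mf.
have mg2 := measurable_sqr_normc mg.
rewrite /sqint -!ge0_integralZl//; first last.
- by move=> x _; rewrite lee_fin sqr_ge0.
- exact/measurable_EFinP.
- by move=> x _; rewrite lee_fin sqr_ge0.
- exact/measurable_EFinP.
rewrite -ge0_integralD//; first last.
- by apply: measurable_funeM; exact/measurable_EFinP.
- by move=> x _; rewrite -EFinM lee_fin mulr_ge0// sqr_ge0.
- by apply: measurable_funeM; exact/measurable_EFinP.
- by move=> x _; rewrite -EFinM lee_fin mulr_ge0// sqr_ge0.
apply: ge0_le_integral => //.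
- by move=> x _; rewrite lee_fin sqr_ge0.
- apply/measurable_EFinP; exact: (measurable_sqr_normc (cmeasurableD mf mg)).
- apply: emeasurable_funD; apply: measurable_funeM; exact/measurable_EFinP.
- by move=> x _; rewrite -!EFinM -EFinD lee_fin sqr_normcD.
Qed.

Lemma sqintZ a f : cmeasurable_fun setT f ->
  sqint (fun x => a * f x) = ((normc a ^+ 2)%:E * sqint f)%E.
Proof.
move=> mf; rewrite /sqint -ge0_integralZl//; first last.
- by rewrite lee_fin sqr_ge0.
- by move=> x _; rewrite lee_fin sqr_ge0.
- apply/measurable_EFinP; exact: (measurable_sqr_normc mf).
by apply: eq_integral => x _; rewrite normcM exprMn EFinM.
Qed.

Lemma L2_lin a f g : L2 f -> L2 g -> L2 (fun x => a * f x + g x).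
Proof.
move=> /L2P[mf f2] /L2P[mg g2].
have maf : cmeasurable_fun setT (fun x => a * f x).
  by apply: cmeasurableM => //; exact: cmeasurable_cst.
apply/L2P; split; first exact: cmeasurableD.
apply: le_lt_trans (sqintD maf mg) _; rewrite sqintZ//.
by rewrite lte_add_pinfty// !lte_mul_pinfty// ?lee_fin ?sqr_ge0// mule_ge0// sqint_ge0.
Qed.

Lemma L2_sub f g : L2 f -> L2 g -> L2 (fun x => f x - g x).
Proof.
move=> f2 g2; rewrite (_ : (fun x => _) = fun x => -1 * g x + f x).
  exact: L2_lin.
by apply/funext => x; rewrite mulN1r addrC.
Qed.

Lemma L2_zero : L2 ((fun=> 0) : V -> C).
Proof.
apply/L2P; split; first exact: cmeasurable_cst.
rewrite /sqint; under eq_integral do rewrite normc0 expr0n/=.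
by rewrite integral0 ltry.
Qed.

Lemma sqint_ae f g : cmeasurable_fun setT f -> cmeasurable_fun setT g ->
  {ae mu, forall x, f x = g x} -> sqint f = sqint g.
Proof.
move=> mf mg fg; apply: ge0_ae_eq_integral => //.
- apply/measurable_EFinP; exact: (measurable_sqr_normc mf).
- apply/measurable_EFinP; exact: (measurable_sqr_normc mg).
- by move=> x _; rewrite lee_fin sqr_ge0.
- by move=> x _; rewrite lee_fin sqr_ge0.
by apply: filterS fg => x -> _.
Qed.

End square_integral.

(** * Bounded operators *)

Section L2_operators.
Context {R : realType} {n : nat}.
Local Notation V := 'rV[R]_n.
Local Notation C := R[i].
Local Notation mu := (@lebesgue_rV R n).

Lemma muleDl2 (a b : R) (x : \bar R) : 0 <= a -> 0 <= b ->
  ((2 * a + 2 * b)%:E * x = 2%:E * (a%:E * x) + 2%:E * (b%:E * x))%E.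
Proof.
move=> a0 b0; rewrite EFinD ge0_muleDl ?lee_fin ?mulr_ge0//.
by rewrite !EFinM !muleA.
Qed.

(** Linearity only holds almost everywhere since functions stand for their
    classes; the bound [c] is on the squared norm. *)
Record L2_operator (c : R) (U : (V -> C) -> V -> C) : Prop := {
  L2op_ge0 : 0 <= c ;
  L2op_L2 : forall f, L2 f -> L2 (U f) ;
  L2op_lin : forall (a : C) f g, L2 f -> L2 g ->
    {ae mu, forall x, U (fun y => a * f y + g y) x = a * U f x + U g x} ;
  L2op_bound : forall f, L2 f -> (sqint (U f) <= c%:E * sqint f)%E
}.

Lemma bounded_sub_operator S T : bounded_L2_operator S -> bounded_L2_operator T ->
  exists c, L2_operator c (fun f x => S f x - T f x).
Proof.
move=> [SL SZ [cS HS]] [TL TZ [cT HT]].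
exists (2 * cS ^+ 2 + 2 * cT ^+ 2); split.
- by rewrite addr_ge0// mulr_ge0// sqr_ge0.
- by move=> f f2; apply: L2_sub; [exact: SL|exact: TL].
- move=> a f g f2 g2; apply: filterS2 (SZ a f g f2 g2) (TZ a f g f2 g2).
  by move=> x -> ->; ring.
- move=> f f2; have [mS _] := SL f f2; have [mT _] := TL f f2.
  have mT' : cmeasurable_fun setT (fun x => -1 * T f x).
    by apply: cmeasurableM => //; exact: cmeasurable_cst.
  rewrite (_ : (fun x => S f x - T f x) = (fun x => S f x + -1 * T f x)); last first.
    by apply/funext => x; rewrite mulN1r.
  apply: le_trans (sqintD mS mT') _; rewrite sqintZ//.
  have -> : normc (-1 : C) ^+ 2 = 1 by rewrite sqr_normcE /=; ring.
  rewrite mul1e (_ : (_%:E * sqint f)%E = (2%:E * ((cS ^+ 2)%:E * sqint f) +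
      2%:E * ((cT ^+ 2)%:E * sqint f))%E); last first.
    by rewrite muleDl2// sqr_ge0.
  apply: leeD; apply: lee_wpmul2l => //; apply: sqint_le_scale.
    exact: HS.
  exact: HT.
Qed.

Variables (c : R) (U : (V -> C) -> V -> C) (Uop : L2_operator c U).

Lemma L2op_sub f g : L2 f -> L2 g ->
  {ae mu, forall x, U (fun y => f y - g y) x = U f x - U g x}.
Proof.
move=> f2 g2; rewrite (_ : (fun y => f y - g y) = (fun y => -1 * g y + f y)).
  by apply: filterS (L2op_lin Uop (-1) g2 f2) => x ->; rewrite mulN1r addrC.
by apply/funext => y; rewrite mulN1r addrC.
Qed.

Lemma L2op_add f g : L2 f -> L2 g ->
  {ae mu, forall x, U (fun y => f y + g y) x = U f x + U g x}.
Proof.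
move=> f2 g2; rewrite (_ : (fun y => f y + g y) = (fun y => 1 * f y + g y)).
  by apply: filterS (L2op_lin Uop 1 f2 g2) => x ->; rewrite mul1r.
by apply/funext => y; rewrite mul1r.
Qed.

Lemma L2op_zero : {ae mu, forall x, U (fun=> 0) x = 0}.
Proof.
have := L2op_sub L2_zero L2_zero.
rewrite (_ : (fun y : V => 0 - 0) = (fun=> 0 : C)); last first.
  by apply/funext => y; rewrite subr0.
by apply: filterS => x; rewrite subrr.
Qed.

(** [U (f_ k)] tends to [U f] in mean square, so the lower limit of
    [|U f - U (f_ k)|^2] vanishes almost everywhere by Fatou's lemma. On [W] this
    lower limit is [|U f - h|^2]. *)
Lemma L2op_limit (f_ h_ : nat -> V -> C) f h (W : set V) :
  L2 f -> (forall k, L2 (f_ k)) ->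
  (fun k => sqint (fun x => f x - f_ k x)) @ \oo --> 0%E ->
  (forall k, {ae mu, forall x, W x -> U (f_ k) x = h_ k x}) ->
  (forall x, W x -> (fun k => normc (h_ k x - h x)) @ \oo --> 0) ->
  {ae mu, forall x, W x -> U f x = h x}.
Proof.
move=> f2 fk2 fcv Uh hcv.
pose g k x := (normc (U f x - U (f_ k) x) ^+ 2)%:E.
have mUf k : cmeasurable_fun setT (fun x => U f x - U (f_ k) x).
  have /L2P[] := L2_sub (L2op_L2 Uop f2) (L2op_L2 Uop (fk2 k)); by [].
have mg k : measurable_fun setT (g k).
  by apply/measurable_EFinP; exact: (measurable_sqr_normc (mUf k)).
have g0 k x : (0 <= g k x)%E by rewrite lee_fin sqr_ge0.
have ig : (fun k => \int[mu]_x g k x)%E @ \oo --> 0%E.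
  apply: (@squeeze_cvge _ _ _ _ (cst 0%E) _
     (fun k => c%:E * sqint (fun x => f x - f_ k x)%R)%E).
  - apply: nearW => k; rewrite integral_ge0//= -/(sqint (fun x => U f x - U (f_ k) x)).
    have ffk2 := L2_sub f2 (fk2 k).
    apply: le_trans (L2op_bound Uop ffk2).
    rewrite (@sqint_ae _ _ _ (U (fun y => f y - f_ k y)))//.
      by have /L2P[] := L2op_L2 Uop ffk2.
    by apply: filterS (L2op_sub f2 (fk2 k)) => x ->.
  - exact: cvg_cst.
  - rewrite -[X in _ --> X](mule0 c%:E); exact: cvgeZl.
have mlim : measurable_fun setT (fun x => limn_einf (g^~ x)).
  rewrite (_ : (fun x => _) = (fun x => - limn_esup (fun k => - g k x)))%E //.
  apply: measurableT_comp => //; apply: measurable_fun_limn_esup => k.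
  exact: measurableT_comp.
have lim0 x : (0 <= limn_einf (g^~ x))%E.
  rewrite limn_einf_lim; apply: lime_ge; first exact: is_cvg_einfs.
  by apply: nearW => k; apply: le_ereal_inf_tmp => _ [j _ <-].
have : (\int[mu]_x `|limn_einf (g^~ x)| = 0)%E.
  under eq_integral do rewrite gee0_abs//.
  apply/eqP; rewrite eq_le integral_ge0// andbT.
  apply: le_trans (fatou mu measurableT mg _) _ => //.
  by have [-> _] := cvg_limn_einf_sup ig.
move=> /(ae_eq_integral_abs mu measurableT mlim) lim_ae.
apply: filterS2 lim_ae (ae_foralln Uh) => x /(_ I) /= limx Ux Wx.
have Ux' k := Ux k Wx.
have gcv : (g^~ x) @ \oo --> (normc (U f x - h x) ^+ 2)%:E.
  apply/fine_cvgP; split; first exact: nearW.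
  rewrite /g /comp /=.
  have H : (fun k => normc (U f x - U (f_ k) x)) @ \oo --> normc (U f x - h x).
    apply/cvgrPdist_le => e e0.
    have /cvgrPdist_le/(_ e e0) := hcv x Wx.
    apply: filterS => k; rewrite sub0r normrN ger0_norm ?normc_ge0// => hk.
    apply: le_trans hk; rewrite Ux' ler_norml.
    have t1 := le_normcD (U f x - h x) (h x - h_ k x).
    have t2 := le_normcD (U f x - h_ k x) (h_ k x - h x).
    rewrite !subrKA in t1 t2; rewrite -(normcN (h x - _)) opprB in t1.
    apply/andP; split; lra.
  by rewrite expr2; under eq_fun do rewrite expr2; exact: cvgM.
have [lE _] := cvg_limn_einf_sup gcv.
move: limx; rewrite lE => -[] /eqP; rewrite expf_eq0/= => /eqP/eq0_normc/eqP.
by rewrite subr_eq0 => /eqP.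
Qed.

End L2_operators.

(** * Bumps that approximate cells *)

Section bumps.
Context {R : realType} {n : nat}.
Local Notation V := 'rV[R]_n.
Local Notation C := R[i].
Local Notation nball := (@nball R n).

Lemma differentiable_measurable (f : V -> R) : (forall x, differentiable f x) ->
  measurable_fun setT f.
Proof.
move=> df; have /continuousP cf : continuous f.
  by move=> x; exact: differentiable_continuous.
apply: (measurability _ (RGenOpens.measurableE R)) => _ [_ [a [b ->] <-]].
by rewrite setTI; apply: open_measurable_rV; apply: cf; exact: interval_open.
Qed.

Definition lo (N : nat) (z : 'rV[int]_n) j : R := (z ord0 j)%:~R / N.+1%:R.
Definition hi (N : nat) (z : 'rV[int]_n) j : R := (z ord0 j + 1)%:~R / N.+1%:R.

(** In each variable, a product of two flat functions that vanishes outside the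
    interval from [lo - 1 / m] to [hi - 1 / m], where [m = k + 1]. The shift to the left
    makes the bumps converge at every point to the indicator of the half-open cell. *)
Definition bump N z (k : nat) (x : V) : R := let m := k.+1%:R in
  \prod_(j < n) (flat 1 (m ^+ 2 * x ord0 j + (m - m ^+ 2 * lo N z j)) *
                 flat 1 (- m ^+ 2 * x ord0 j + (m ^+ 2 * hi N z j - m))).

Definition shifted_box N z (k : nat) : set V := [set x | forall j,
  lo N z j - k.+1%:R^-1 <= x ord0 j <= hi N z j - k.+1%:R^-1].

Lemma bump_ge0 N z k x : 0 <= bump N z k x.
Proof. by apply: prodr_ge0 => j _; rewrite mulr_ge0 ?flat_ge0. Qed.

Lemma bump_le1 N z k x : bump N z k x <= 1.
Proof.
suff /andP[] : 0 <= bump N z k x <= 1 by [].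
apply: (big_ind (fun y => 0 <= y <= 1)) => [|a b /andP[a0 a1] /andP[b0 b1]|j _].
- by rewrite ler01 lexx.
- by rewrite mulr_ge0// mulr_ile1.
- by rewrite mulr_ge0 ?flat_ge0//= mulr_ile1 ?flat_ge0 ?flat_le1.
Qed.

Lemma bump_neq0 N z k x : bump N z k x != 0 -> shifted_box N z k x.
Proof.
move=> + j; rewrite /bump prodf_seq_neq0 => /allP/(_ j (mem_index_enum _)) /=.
have m0 : 0 < k.+1%:R :> R by [].
rewrite mulf_eq0 negb_or => /andP[f1 f2].
have h1 : 0 < k.+1%:R ^+ 2 * x ord0 j + (k.+1%:R - k.+1%:R ^+ 2 * lo N z j).
  by rewrite ltNge; apply: contra f1 => /(@flat_eq0 R 1) ->.
have h2 : 0 < - k.+1%:R ^+ 2 * x ord0 j + (k.+1%:R ^+ 2 * hi N z j - k.+1%:R).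
  by rewrite ltNge; apply: contra f2 => /(@flat_eq0 R 1) ->.
have m1 : k.+1%:R * k.+1%:R^-1 = 1 :> R by rewrite mulfV// gt_eqF.
move: h1 h2 m0 m1; set m := k.+1%:R; set i := m^-1 => h1 h2 m0 m1.
apply/andP; split.
  rewrite -(ler_pM2l m0) -(ler_pM2l m0); nra.
by rewrite -(ler_pM2l m0) -(ler_pM2l m0); nra.
Qed.

Lemma bump_indic N z k M x : shifted_box N z k `<=` nball M ->
  `|bump N z k x| <= \1_(nball M) x.
Proof.
move=> bM; have [->|/bump_neq0/bM/mem_set xM] := eqVneq (bump N z k x) 0.
  by rewrite normr0 indicE ler0n.
by rewrite ger0_norm ?bump_ge0// indicE xM bump_le1.
Qed.

Lemma closed_shifted_box N z k : closed (shifted_box N z k).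
Proof.
apply: closed_distP => x xP j; set i := k.+1%:R^-1.
apply/andP; split; apply/ler_addgt0Pr => e e0;
  have [y /(_ j)/andP[] + + xy] := xP e e0; rewrite -/i => y1 y2;
  have := le_lt_trans (coord_le_norm _ j) xy; rewrite !mxE ltr_norml;
  by move=> /andP[xy1 xy2]; lra.
Qed.

Lemma shifted_box_bounded N z : exists M, forall k, shifted_box N z k `<=` nball M.
Proof.
exists (\sum_(j < n) (`|lo N z j| + `|hi N z j| + 1)) => k x xb.
apply: norm_le_coord => [|j]; first by apply: sumr_ge0 => j _; rewrite !addr_ge0.
apply: (@le_trans _ _ (`|lo N z j| + `|hi N z j| + 1)); last first.
  rewrite (bigD1 j)//= lerDl; apply: sumr_ge0 => i _; by rewrite !addr_ge0.
have /andP[x1 x2] := xb j.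
have k1 : k.+1%:R^-1 <= 1 :> R by rewrite invf_le1// ler1n.
have k0 : 0 <= k.+1%:R^-1 :> R by rewrite invr_ge0.
have l1 := ler_norm (- lo N z j); rewrite normrN in l1.
have h1 := ler_norm (hi N z j).
have l0 := normr_ge0 (lo N z j); have h0 := normr_ge0 (hi N z j).
move: x1 x2 k1 k0; set i := k.+1%:R^-1 => x1 x2 k1 k0.
by rewrite ler_norml; apply/andP; split; lra.
Qed.

Lemma cell_bounded N z : exists M, cell N z `<=` nball M.
Proof.
exists (\sum_(j < n) (`|lo N z j| + `|hi N z j|)) => x xb.
apply: norm_le_coord => [|j]; first by apply: sumr_ge0 => j _; rewrite !addr_ge0.
apply: (@le_trans _ _ (`|lo N z j| + `|hi N z j|)); last first.
  rewrite (bigD1 j)//= lerDl; apply: sumr_ge0 => i _; by rewrite !addr_ge0.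
have := xb j; rewrite /= in_itv/= -/(lo N z j) -/(hi N z j) => /andP[x1 x2].
have l1 := ler_norm (- lo N z j); rewrite normrN in l1.
have h1 := ler_norm (hi N z j).
have l0 := normr_ge0 (lo N z j); have h0 := normr_ge0 (hi N z j).
by rewrite ler_norml; apply/andP; split; lra.
Qed.

Lemma smooth_upto_bump N z k l : smooth_upto l (bump N z k).
Proof.
by apply: smooth_upto_prod => j; apply: smooth_uptoM; exact: smooth_upto_flat.
Qed.

Lemma measurable_bump N z k : measurable_fun setT (bump N z k).
Proof.
apply: differentiable_measurable => x.
exact: (smooth_upto_diff x (smooth_upto_bump N z k 0)).
Qed.

Definition cbump N z k (x : V) : C := (bump N z k x)%:C.

Lemma supp_cbump N z k : supp (cbump N z k) `<=` shifted_box N z k.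
Proof.
rewrite /supp closureE; apply: smallest_sub; first exact: closed_shifted_box.
move=> x /=; rewrite /cbump => bx; apply: bump_neq0; apply: contra bx => /eqP ->.
by rewrite rmorph0.
Qed.

Lemma test_function_cbump N z k : test_function (cbump N z k).
Proof.
split.
- by apply: smooth_upto_smooth => l; exact: smooth_upto_bump.
- by apply: smooth_upto_smooth => l; exact: smooth_upto_cst.
have [M MP] := shifted_box_bounded N z.
apply: (@closed_bounded_compact _ _ _ M); first exact: closed_closure.
exact: subset_trans (@supp_cbump N z k) (MP k).
Qed.

Lemma bump_out N z x : ~ cell N z x -> \forall k \near \oo, ~ shifted_box N z k x.
Proof.
move=> /existsNP[j]; rewrite /= in_itv/= -/(lo N z j) -/(hi N z j).
move=> /negP; rewrite negb_and -ltNge -leNgt => /orP[xl|hx].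
  have [K _ HK] := near_invn_lt (etrans (subr_gt0 _ _) xl).
  exists K => // k /HK + /(_ j)/andP[+ _]; set i := k.+1%:R^-1 => k1 k2; lra.
near=> k => /(_ j)/andP[_]; have : 0 < k.+1%:R^-1 :> R by rewrite invr_gt0.
by set i := k.+1%:R^-1 => k0 k1; lra.
Unshelve. all: by end_near. Qed.

Lemma cvg_prod_one (I : Type) (s : seq I) (f : I -> nat -> R) :
  (forall i, f i @ \oo --> (1 : R)) -> (fun k => \prod_(i <- s) f i k) @ \oo --> (1 : R).
Proof.
move=> f1; elim: s => [|i s IH].
  rewrite (_ : (fun k => _) = fun=> 1); first exact: cvg_cst.
  by apply/funext => k; rewrite big_nil.
rewrite (_ : (fun k => _) = (fun k => f i k * \prod_(j <- s) f j k)).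
  by rewrite -[X in _ --> X](mulr1 1); exact: cvgM.
by apply/funext => k; rewrite big_cons.
Qed.

Lemma flat_cvg1 (t : nat -> R) : (\forall k \near \oo, k.+1%:R <= t k) ->
  (fun k => flat 1 (t k)) @ \oo --> (1 : R).
Proof.
move=> tk; apply/cvgrPdist_le => e e0; near=> k.
have tk1 : k.+1%:R <= t k by near: k.
have t0 : 0 < t k by apply: lt_le_trans tk1.
have := flat_ge t0; have := @flat_le1 R (t k).
have ke : k.+1%:R^-1 < e by near: k; exact: near_invn_lt.
have tke : (t k)^-1 < e by apply: le_lt_trans ke; rewrite lef_pV2 ?posrE.
move: tke; set i := (t k)^-1 => i1 i2 i3.
by rewrite ler_norml; apply/andP; split; lra.
Unshelve. all: by end_near. Qed.

Lemma bump_in N z x : cell N z x -> (fun k => bump N z k x) @ \oo --> (1 : R).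
Proof.
move=> xc; apply: cvg_prod_one => j.
have := xc j; rewrite /= in_itv/= -/(lo N z j) -/(hi N z j) => /andP[x1 x2].
rewrite -[X in _ --> X](mulr1 1); apply: cvgM; apply: flat_cvg1.
  near=> k; set m := k.+1%:R.
  have : 0 <= m ^+ 2 * (x ord0 j - lo N z j) by rewrite mulr_ge0 ?sqr_ge0// subr_ge0.
  by lra.
have d0 : 0 < (hi N z j - x ord0 j) / 2 by rewrite divr_gt0// subr_gt0.
near=> k; have : k.+1%:R^-1 < (hi N z j - x ord0 j) / 2.
  by near: k; exact: near_invn_lt.
have m0 : 0 < k.+1%:R :> R by [].
rewrite -(ltr_pM2l m0) mulfV ?gt_eqF//; set m := k.+1%:R => H.
have : m * 1 <= m * (m * ((hi N z j - x ord0 j) / 2)) by rewrite ler_pM2l// ltW.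
by rewrite expr2; lra.
Unshelve. all: by end_near. Qed.

End bumps.

(** * Functions determined by their pairings with bumps *)

Section fundamental_lemma.
Context {R : realType} {n : nat}.
Local Notation V := 'rV[R]_n.
Local Notation mu := (@lebesgue_rV R n).
Local Notation nball := (@nball R n).

Lemma integrable_nball M : mu.-integrable setT (EFin \o (\1_(nball M) : V -> R)).
Proof.
apply/integrableP; split.
  by apply/measurable_EFinP; apply: measurable_indic; exact: measurable_nball.
under eq_integral => x _ do rewrite /= ger0_norm ?indicE ?ler0n//.
rewrite (eq_integral (fun x => (\1_(nball M) x)%:E))//.
rewrite integral_indic//; last exact: measurable_nball.
by rewrite setIT; exact: measure_nball_lty.
Qed.

Lemma indicator_limit (A_ : nat -> set V) A :
  (forall x, ~ A x -> \forall k \near \oo, ~ A_ k x) ->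
  {ae mu, forall x, A x -> \forall k \near \oo, A_ k x} ->
  {ae mu, forall x, \forall k \near \oo, (\1_(A_ k) x : R) = \1_A x}.
Proof.
move=> nA iA; apply: filterS iA => x Ax; have [xA|xA] := pselect (A x).
  apply: filterS (Ax xA) => k xAk.
  by rewrite !indicE !mem_set.
apply: filterS (nA x xA) => k xAk.
by rewrite !indicE !memNset.
Qed.

Lemma norm_indic_le (A : set V) M x : A `<=` nball M ->
  `|\1_A x : R| <= \1_(nball M) x.
Proof.
move=> AM; rewrite ger0_norm indicE ?ler0n//.
have [/set_mem/AM/mem_set xM|_] := boolP (x \in A); rewrite ?ler0n//.
by rewrite indicE xM.
Qed.

Lemma indic_disjointU (A B : set V) x : A `&` B = set0 ->
  \1_(A `|` B) x = \1_A x + \1_B x :> R.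
Proof.
move=> AB; rewrite !indicE; have [xA|xA] := pselect (A x).
  rewrite (mem_set xA) (memNset (A := B)) ?addr0; last first.
    by move=> xB; have : (A `&` B) x by []; rewrite AB.
  by rewrite mem_set//; left.
rewrite (memNset xA) add0r; have [xB|xB] := pselect (B x).
  by rewrite !mem_set//; right.
by rewrite !memNset// => -[].
Qed.

Lemma measurable_indicator (A : set V) : measurable A ->
  measurable_fun setT (\1_A : V -> R).
Proof. by move=> mA; exact: measurable_indic. Qed.

Section pairing.
Variable u : V -> R.
Hypothesis mu_u : measurable_fun setT u.
Hypothesis u2 : mu.-integrable setT (EFin \o (fun x => u x ^+ 2)).

Lemma pairing_bound M : mu.-integrable setT
  (fun x => (u x ^+ 2)%:E + (\1_(nball M) x)%:E)%E.
Proof. by apply: integrableD => //; exact: integrable_nball. Qed.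

Lemma pairing_le M x (v : R) : `|v| <= \1_(nball M) x ->
  `|u x * v| <= u x ^+ 2 + \1_(nball M) x.
Proof.
rewrite indicE => v1; have v2 : `|v| <= 1 by apply: le_trans v1 _; case: (x \in _).
have v0 := normr_ge0 v; have u0 := normr_ge0 (u x).
rewrite normrM -[u x ^+ 2]real_normK ?num_real//.
have [u1|u1] := leP `|u x| 1; nra.
Qed.

Lemma integrable_pairing M (v : V -> R) : measurable_fun setT v ->
  (forall x, `|v x| <= \1_(nball M) x) ->
  mu.-integrable setT (fun x => (u x * v x)%:E).
Proof.
move=> mv v1; apply: le_integrable (pairing_bound M) => //.
  by apply/measurable_EFinP; exact: measurable_funM.
move=> x _; rewrite -EFinD /= lee_fin.
rewrite (le_trans (pairing_le (v1 x)))// ler_norm//.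
Qed.

(** Dominated convergence, with [|u v| <= u^2 + 1] on a ball. *)
Lemma pairing_limit M (v_ : nat -> V -> R) (v : V -> R) :
  (forall k, measurable_fun setT (v_ k)) -> measurable_fun setT v ->
  (forall k x, `|v_ k x| <= \1_(nball M) x) ->
  {ae mu, forall x, (fun k => v_ k x) @ \oo --> v x} ->
  (fun k => \int[mu]_x (u x * v_ k x)%:E)%E @ \oo --> (\int[mu]_x (u x * v x)%:E)%E.
Proof.
move=> mv_ mv v1 vcv.
have m1 k : measurable_fun setT (fun x => (u x * v_ k x)%:E).
  by apply/measurable_EFinP; exact: measurable_funM.
have m2 : measurable_fun setT (fun x => (u x * v x)%:E).
  by apply/measurable_EFinP; exact: measurable_funM.
have cv : {ae mu, forall x, setT x ->
    (fun k => (u x * v_ k x)%:E) @ \oo --> (u x * v x)%:E}.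
  apply: filterS vcv => x xv _; apply: cvg_EFin; first exact: nearW.
  by apply: cvgM => //; exact: cvg_cst.
have b : {ae mu, forall x k, setT x ->
    (`|(u x * v_ k x)%:E| <= (u x ^+ 2)%:E + (\1_(nball M) x)%:E)%E}.
  by apply: aeW => x k _; rewrite -EFinD /= lee_fin pairing_le.
by have [] := dominated_convergence measurableT m1 m2 cv (pairing_bound M) b.
Qed.

Lemma pairing_limit0 M (v_ : nat -> V -> R) (v : V -> R) :
  (forall k, measurable_fun setT (v_ k)) -> measurable_fun setT v ->
  (forall k x, `|v_ k x| <= \1_(nball M) x) ->
  {ae mu, forall x, (fun k => v_ k x) @ \oo --> v x} ->
  (forall k, \int[mu]_x (u x * v_ k x)%:E = 0)%E ->
  (\int[mu]_x (u x * v x)%:E = 0)%E.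
Proof.
move=> mv_ mv v1 vcv v0; have := pairing_limit mv_ mv v1 vcv.
rewrite (_ : (fun k => _) = cst 0%E); last by apply/funext => k; rewrite v0.
by move/(cvg_unique (@ereal_hausdorff R)); apply; exact: cvg_cst.
Qed.

Hypothesis u_bump : forall N z k, (\int[mu]_x (u x * bump N z k x)%:E = 0)%E.

Lemma pairing_indic A M : measurable A -> A `<=` nball M ->
  (\int[mu]_x (u x * \1_A x)%:E = 0)%E.
Proof.
move: A M; apply: bounded_measurable_ind.
- by under eq_integral do rewrite indicE in_set0 mulr0; rewrite integral0.
- move=> N z; have [M1 M1P] := @cell_bounded R n N z.
  have [M2 M2P] := @shifted_box_bounded R n N z.
  have N1 : nball M1 `<=` nball (Num.max M1 M2).
    by move=> x; rewrite /nball /= => /le_trans; apply; rewrite le_max lexx.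
  have N2 : nball M2 `<=` nball (Num.max M1 M2).
    by move=> x; rewrite /nball /= => /le_trans; apply; rewrite le_max lexx orbT.
  have H1 k x : `|bump N z k x| <= \1_(nball (Num.max M1 M2)) x.
    by apply: bump_indic; exact: subset_trans N2.
  apply: (pairing_limit0 _ _ H1) => //.
  + exact: measurable_bump.
  + by apply: measurable_indicator; exact: measurable_cell.
  apply: aeW => x; have [xc|xc] := pselect (cell N z x).
    by rewrite indicE mem_set//; exact: bump_in.
  rewrite indicE memNset//; apply: cvg_near_cst.
  apply: filterS (bump_out xc) => k nk; apply/eqP; apply: contrapT => /negP.
  by move/bump_neq0.
- move=> A B M mA mB AM BM AB intA intB.
  rewrite (eq_integral (fun x => (u x * \1_A x)%:E + (u x * \1_B x)%:E)%E).
    rewrite integralD//.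
    + by rewrite intA intB adde0.
    + apply: (@integrable_pairing M) => [|x]; first exact: measurable_indicator.
      exact: norm_indic_le.
    + apply: (@integrable_pairing M) => [|x]; first exact: measurable_indicator.
      exact: norm_indic_le.
  move=> x _; rewrite -EFinD -mulrDr indic_disjointU//.
- move=> A_ A M mA_ A_M mA AM intA nA iA.
  apply: (@pairing_limit0 M (fun k => \1_(A_ k))) => //.
  + by move=> k x; exact: norm_indic_le.
  by apply: filterS (indicator_limit nA iA) => x xA; exact: cvg_near_cst.
Qed.

(** The pairings with indicators of bounded measurable sets vanish as well, by
    induction over these sets. *)
Lemma pairing_eq0 : {ae mu, forall x, u x = 0}.
Proof.
have H k : {ae mu, forall x, nball k%:R x -> u x = 0}.
  have mk := @measurable_nball R n k%:R.
  have : ae_eq mu (nball k%:R) (EFin \o u) (cst 0%E).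
    apply: integral_ae_eq => //.
      have := @integrable_pairing k%:R (\1_(nball k%:R)) (measurable_indicator mk).
      have H x : `|\1_(nball k%:R) x : R| <= \1_(nball k%:R) x.
        by rewrite ger0_norm// indicE ler0n.
      move=> /(_ H)/(integrableS measurableT mk (@subsetT _ _)).
      by apply: eq_integrable => // x xk; rewrite /= indicE xk mulr1.
    move=> E Ek mE; rewrite integral0 -[RHS](pairing_indic mE Ek) integral_mkcond.
    apply: eq_integral => x _; rewrite patchE indicE /=.
    by case: ifP => _; rewrite ?mulr1 ?mulr0.
  by apply: filterS => x /[apply] -[].
apply: filterS (ae_foralln H) => x xk; apply: (xk (Num.truncn `|x|).+1).
by rewrite /nball /= ltW// truncnS_gt.
Qed.

End pairing.

End fundamental_lemma.

(** * Dominated convergence in mean square *)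

Section dominated_L2.
Context {R : realType} {n : nat}.
Local Notation V := 'rV[R]_n.
Local Notation C := R[i].
Local Notation mu := (@lebesgue_rV R n).
Local Notation nball := (@nball R n).

Lemma cmeasurableB (A : set V) (f g : V -> C) :
  cmeasurable_fun A f -> cmeasurable_fun A g -> cmeasurable_fun A (fun x => f x - g x).
Proof.
move=> [f1 f2] [g1 g2]; split.
- by under eq_fun do rewrite ReD ReN; exact: measurable_funB.
- by under eq_fun do rewrite ImD ImN; exact: measurable_funB.
Qed.

Lemma sqint_dominated (f_ : nat -> V -> C) (f : V -> C) (G : V -> R) :
  (forall k, cmeasurable_fun setT (f_ k)) -> cmeasurable_fun setT f ->
  mu.-integrable setT (EFin \o G) ->
  (forall k x, normc (f_ k x) ^+ 2 <= G x) -> (forall x, normc (f x) ^+ 2 <= G x) ->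
  {ae mu, forall x, (fun k => normc (f x - f_ k x)) @ \oo --> (0 : R)} ->
  (fun k => sqint (fun x => f x - f_ k x)) @ \oo --> 0%E.
Proof.
move=> mf_ mf iG f_G fG cv.
have m1 k : measurable_fun setT (fun x => (normc (f x - f_ k x) ^+ 2)%:E).
  by apply/measurable_EFinP; exact: (measurable_sqr_normc (cmeasurableB mf (mf_ k))).
have m2 : measurable_fun setT (cst 0%E : V -> \bar R) by exact: measurable_cst.
have cv' : {ae mu, forall x, setT x ->
    (fun k => (normc (f x - f_ k x) ^+ 2)%:E) @ \oo --> 0%E}.
  apply: filterS cv => x xv _; apply: cvg_EFin; first exact: nearW.
  rewrite (_ : fine \o _ = (fun k => normc (f x - f_ k x) * normc (f x - f_ k x))).
    by rewrite -[X in _ --> X](mulr0 0); exact: cvgM.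
  by apply/funext => k /=; rewrite expr2.
have iG4 : mu.-integrable setT (fun x => 4%:E * (G x)%:E)%E.
  exact: integrableZl.
have b : {ae mu, forall x k, setT x ->
    (`|(normc (f x - f_ k x) ^+ 2)%:E| <= 4%:E * (G x)%:E)%E}.
  apply: aeW => x k _; rewrite -EFinM /= lee_fin ger0_norm ?sqr_ge0//.
  apply: le_trans (sqr_normcD _ _) _; rewrite normcN.
  by have := fG x; have := f_G k x; lra.
have [_ _] := dominated_convergence measurableT m1 m2 cv' iG4 b.
by rewrite integral0.
Qed.

Lemma normc_real (a : R) : normc (a%:C) = `|a|.
Proof. by rewrite /= [0 ^+ 2]expr0n addr0 sqrtr_sqr. Qed.

Lemma sqr_normc_real (a : R) : normc (a%:C) ^+ 2 = a ^+ 2.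
Proof. by rewrite sqr_normcE /= [0 ^+ 2]expr0n addr0. Qed.

Lemma L2_bounded (v : V -> R) M : measurable_fun setT v ->
  (forall x, `|v x| <= \1_(nball M) x) -> L2 (fun x => (v x)%:C).
Proof.
move=> mv v1; apply/L2P; split; first exact: cmeasurable_real.
have /integrableP[_] := @integrable_nball R n M.
apply: le_lt_trans; apply: ge0_le_integral => //.
- by move=> x _; rewrite lee_fin sqr_ge0.
- by apply/measurable_EFinP; exact: (measurable_sqr_normc (cmeasurable_real mv)).
- apply: measurableT_comp => //; apply/measurable_EFinP.
  by apply: measurable_indicator; exact: measurable_nball.
move=> x _; rewrite sqr_normc_real /= lee_fin ger0_norm ?indicE ?ler0n//.
rewrite -real_normK ?num_real//; have := v1 x; rewrite indicE.
case: (x \in _) => /= v2; last by have := normr_ge0 (v x); nra.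
by rewrite exprn_ile1.
Qed.

Lemma sqint_bounded_limit (v_ : nat -> V -> R) (v : V -> R) M :
  (forall k, measurable_fun setT (v_ k)) -> measurable_fun setT v ->
  (forall k x, `|v_ k x| <= \1_(nball M) x) -> (forall x, `|v x| <= \1_(nball M) x) ->
  {ae mu, forall x, (fun k => v_ k x) @ \oo --> v x} ->
  (fun k => sqint (fun x => (v x)%:C - (v_ k x)%:C)) @ \oo --> 0%E.
Proof.
move=> mv_ mv v_1 v1 cv.
have sq (a : R) x : `|a| <= \1_(nball M) x -> normc (a%:C) ^+ 2 <= \1_(nball M) x.
  rewrite sqr_normc_real -real_normK ?num_real// indicE.
  case: (x \in _) => /= v2; last by have := normr_ge0 a; nra.
  by rewrite exprn_ile1.
apply: (@sqint_dominated _ _ (\1_(nball M))) => //.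
- by move=> k; exact: cmeasurable_real.
- exact: integrable_nball.
- by move=> k x; exact: sq.
- by move=> x; exact: sq.
apply: filterS cv => x /cvgrPdist_le xv; apply/cvgrPdist_le => e /xv.
by apply: filterS => k; rewrite sub0r normrN -rmorphB normc_real normr_id.
Qed.

Definition ind (A : set V) (x : V) : C := (\1_A x : R)%:C.

Lemma L2_ind A M : measurable A -> A `<=` nball M -> L2 (ind A).
Proof.
move=> mA AM; apply: (@L2_bounded _ M); first exact: measurable_indicator.
by move=> x; exact: norm_indic_le.
Qed.

Lemma ind0 A x : ~ A x -> ind A x = 0.
Proof. by move=> Ax; rewrite /ind indicE memNset. Qed.

Lemma ind1 A x : A x -> ind A x = 1.
Proof. by move=> Ax; rewrite /ind indicE mem_set. Qed.

Lemma ind_disjointU A B : A `&` B = set0 -> ind (A `|` B) = (fun x => ind A x + ind B x).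
Proof. by move=> AB; apply/funext => x; rewrite /ind indic_disjointU// rmorphD. Qed.

Lemma sqint_ind A : measurable A -> sqint (ind A) = mu A.
Proof.
move=> mA; rewrite /sqint (eq_integral (fun x => (\1_A x)%:E)); last first.
  by move=> x _; rewrite sqr_normc_real indicE; case: (x \in A); rewrite ?expr1n ?expr0n.
by rewrite integral_indic// setIT.
Qed.

End dominated_L2.

(** * Locality *)

Section locality.
Context {R : realType} {n r : nat}.
Local Notation V := 'rV[R]_n.
Local Notation C := R[i].
Local Notation mu := (@lebesgue_rV R n).
Local Notation nball := (@nball R n).
Variables (D : 'I_r -> set V) (gamma : 'I_r -> V -> V).
Variables (c : R) (U : (V -> C) -> V -> C).
Hypothesis Uop : L2_operator c U.

Definition local_on (A : set V) : Prop :=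
  {ae mu, forall x, ~ gamma_preimage D gamma A x -> U (ind A) x = 0}.

(** There are finitely many pieces, so [gamma^-1] respects pointwise eventual
    avoidance. *)
Lemma gamma_preimage_near (A_ : nat -> set V) (A : set V) x :
  (forall y, ~ A y -> \forall k \near \oo, ~ A_ k y) ->
  ~ gamma_preimage D gamma A x ->
  \forall k \near \oo, ~ gamma_preimage D gamma (A_ k) x.
Proof.
move=> AA nx.
have H (i : 'I_r) : \forall k \near \oo, ~ (D i x /\ A_ k (gamma i x)).
  have [Dx|Dx] := pselect (D i x); last by apply: nearW => k [].
  have /AA : ~ A (gamma i x) by move=> Ax; apply: nx; exists i.
  by apply: filterS => k nAk [].
by apply: filterS (filter_forall _ H) => k Hk [i _ /Hk].
Qed.

(** At a point off [gamma^-1 (A)] the approximations vanish from some index on,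
    which is what [L2op_limit] asks for. *)
Lemma local_limit (v_ : nat -> V -> R) (A_ : nat -> set V) A M :
  (forall k, measurable_fun setT (v_ k)) ->
  (forall k x, `|v_ k x| <= \1_(nball M) x) ->
  measurable A -> A `<=` nball M ->
  {ae mu, forall x, (fun k => v_ k x) @ \oo --> (\1_A x : R)} ->
  (forall k, {ae mu, forall x, ~ gamma_preimage D gamma (A_ k) x ->
     U (fun y => (v_ k y)%:C) x = 0}) ->
  (forall y, ~ A y -> \forall k \near \oo, ~ A_ k y) ->
  local_on A.
Proof.
move=> mv_ v_1 mA AM vcv loc AA.
(* Nothing is known about [U] inside [gamma^-1 (A_ k)]; [h_] keeps its value
   there, and a point of [W] leaves this set in the end. *)
pose W := [set x | ~ gamma_preimage D gamma A x].
pose h_ k x := if `[< gamma_preimage D gamma (A_ k) x >]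
  then U (fun y => (v_ k y)%:C) x else 0.
apply: (@L2op_limit _ _ _ _ Uop (fun k y => (v_ k y)%:C) h_ (ind A) (fun=> 0) W).
- exact: L2_ind AM.
- by move=> k; exact: (@L2_bounded _ _ _ M).
- apply: (@sqint_bounded_limit _ _ _ _ M) => // x.
  exact: norm_indic_le.
- move=> k; apply: filterS (loc k) => x xk Wx; rewrite /h_.
  by case: asboolP => // /xk ->.
move=> x Wx; apply: cvg_near_cst; apply: filterS (gamma_preimage_near AA Wx).
by move=> k nk; rewrite /h_; case: asboolP => // _; rewrite subr0 normc0.
Qed.

Hypothesis local_bump : forall N z k, {ae mu, forall x,
  ~ gamma_preimage D gamma (shifted_box N z k) x -> U (cbump N z k) x = 0}.

(** Cells are reached from the bumps, and the other bounded measurable sets by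
    induction. *)
Lemma bounded_local A M : measurable A -> A `<=` nball M -> local_on A.
Proof.
move: A M; apply: bounded_measurable_ind.
- rewrite /local_on (_ : ind set0 = fun=> 0).
    by apply: filterS (L2op_zero Uop) => x -> _.
  by apply/funext => x; rewrite ind0.
- move=> N z; have [M1 M1P] := @cell_bounded R n N z.
  have [M2 M2P] := @shifted_box_bounded R n N z.
  have N1 : nball M1 `<=` nball (Num.max M1 M2).
    by move=> x; rewrite /nball /= => /le_trans; apply; rewrite le_max lexx.
  have N2 : nball M2 `<=` nball (Num.max M1 M2).
    by move=> x; rewrite /nball /= => /le_trans; apply; rewrite le_max lexx orbT.
  apply: (@local_limit (bump N z) (shifted_box N z) _ (Num.max M1 M2)).
  + exact: measurable_bump.
  + by move=> k x; apply: bump_indic; exact: subset_trans N2.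
  + exact: measurable_cell.
  + exact: subset_trans N1.
  + apply: aeW => x; have [xc|xc] := pselect (cell N z x).
      by rewrite indicE mem_set//; exact: bump_in.
    rewrite indicE memNset//; apply: cvg_near_cst.
    apply: filterS (bump_out xc) => k nk; apply/eqP; apply: contrapT => /negP.
    by move/bump_neq0.
  + exact: local_bump.
  + by move=> y; exact: bump_out.
- move=> A B M mA mB AM BM AB locA locB; rewrite /local_on ind_disjointU//.
  have A2 := L2_ind mA AM; have B2 := L2_ind mB BM.
  apply: filterS3 (L2op_add Uop A2 B2) locA locB => x -> xA xB nx.
  rewrite xA ?xB ?addr0// => -[i _ [Dx ix]]; apply: nx; exists i => //; split => //.
    by right.
  by left.
- move=> A_ A M mA_ A_M mA AM loc nA iA.
  apply: (@local_limit (fun k => \1_(A_ k)) A_ _ M) => //.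
  + by move=> k x; exact: norm_indic_le.
  + by apply: filterS (indicator_limit nA iA) => x xA; exact: cvg_near_cst.
Qed.

End locality.

(** * Measurability of pieces *)

Section pieces.
Context {R : realType} {n : nat}.
Local Notation V := 'rV[R]_n.
Local Notation C := R[i].
Local Notation mu := (@lebesgue_rV R n).
Local Notation nball := (@nball R n).

Lemma lipschitz_closed_preimage (c : R) (D : set V) (f : V -> V) (F : set V) :
  closed D -> lipschitz_within c D f -> closed F -> closed (D `&` f @^-1` F).
Proof.
move=> cD lf cF; apply: closed_distP => x xP.
have Dx : D x.
  apply: cD => B /nbhs_distP[e e0 eB]; have [y [Dy _] xy] := xP e e0.
  by exists y; split => //; exact: eB.
split => //; apply: cF => B /nbhs_distP[e e0 eB].
have c1 : 0 < `|c| + 1 by rewrite ltr_wpDl.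
have [y [Dy Fy] xy] := xP (e / (`|c| + 1)) (divr_gt0 e0 c1).
exists (f y); split => //; apply: eB; apply: le_lt_trans (lf _ _ Dx Dy) _.
move: xy; rewrite ltr_pdivlMr//; apply: le_lt_trans.
by rewrite mulrC ler_wpM2l// (le_trans (ler_norm _))// lerDl.
Qed.

(** The map is continuous on the closed set [D] but arbitrary off it, so only
    traces of preimages on [D] are considered. *)
Lemma measurable_piece (c : R) (D : set V) (f : V -> V) (A : set V) :
  closed D -> lipschitz_within c D f -> measurable A ->
  measurable (D `&` f @^-1` A).
Proof.
move=> cD lf; have mD := closed_measurable_rV cD.
pose P (B : set V) := measurable (D `&` f @^-1` B).
have P0 : P set0 by rewrite /P preimage_set0 setI0.
have PC B : P B -> P (~` B).
  move=> mB; rewrite /P preimage_setC -setDE.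
  rewrite (_ : _ `\` _ = D `\` (D `&` f @^-1` B)); first exact: measurableD.
  by rewrite setDIr setDv set0U.
have PU (B : nat -> set V) : (forall k, P (B k)) -> P (\bigcup_k B k).
  by move=> mB; rewrite /P preimage_bigcup setI_bigcupr; exact: bigcupT_measurable.
move: A; apply: smallest_sub.
  by split => [//|B mB|B mB]; [rewrite setTD; exact: PC|exact: PU].
move=> A; rewrite -bigcup_seq/= => -[i _ [B mB <-]] /=; rewrite setTI.
move: B mB; suff : (measurable : set (set R)) `<=`
    [set B | P ((fun x : V => x ord0 i) @^-1` B)] by [].
rewrite [X in X `<=` _]RGenCInfty.measurableE; apply: smallest_sub.
  split => /= [|B mB|B mB].
  - by rewrite preimage_set0.
  - by rewrite setTD preimage_setC; exact: PC.
  - by rewrite preimage_bigcup; exact: PU.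
move=> B [a ->] /=; apply: closed_measurable_rV.
apply: (lipschitz_closed_preimage cD lf).
apply: closed_distP => x xa; rewrite /= in_itv/= andbT; apply/ler_addgt0Pr => d d0.
have [y] := xa d d0; rewrite /= in_itv/= andbT => ya xy.
have := le_lt_trans (coord_le_norm _ i) xy; rewrite !mxE ltr_norml; lra.
Qed.

(** Used to define the coefficients patch by patch. *)
Lemma measurable_glue (X : nat -> set V) (g : nat -> V -> C) :
  (forall m, measurable (X m)) -> trivIset setT X ->
  (forall m, cmeasurable_fun setT (g m)) ->
  exists b : V -> C, [/\ cmeasurable_fun setT b,
    forall m x, X m x -> b x = g m x & forall x, (forall m, ~ X m x) -> b x = 0].
Proof.
move=> mX tX mg.
pose b x := if pselect (exists m, X m x) is left H then g (projT1 (cid H)) x else 0.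
have bX m x : X m x -> b x = g m x.
  move=> Xx; rewrite /b; case: pselect => [H|[]]; last by exists m.
  case: (cid H) => k /= Xk; congr (g _ x).
  by apply: tX => //; exists x.
have b0 x : (forall m, ~ X m x) -> b x = 0.
  by move=> nX; rewrite /b; case: pselect => // H; exfalso; have [m] := H; exact: nX.
exists b; split => //.
have UX : setT = (\bigcup_m X m) `|` ~` (\bigcup_m X m) by rewrite setUv.
have mU : measurable (\bigcup_m X m) by exact: bigcupT_measurable.
have gX m (p : C -> R) : measurable_fun setT (fun x => p (g m x)) ->
    measurable_fun (X m) (fun x => p (b x)).
  move=> mp; apply: (@eq_measurable_fun _ _ _ _ _ (fun x => p (g m x))).
    by move=> x /set_mem Xx; rewrite (bX m).
  exact: measurable_funS mp.
have main (p : C -> R) : (forall m, measurable_fun setT (fun x => p (g m x))) ->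
    measurable_fun setT (fun x => p (b x)).
  move=> mp; rewrite UX; apply/measurable_funU => //; first exact: measurableC.
  split; first by apply/measurable_fun_bigcup => // m; exact: gX.
  apply: (@eq_measurable_fun _ _ _ _ _ (fun=> p 0)); last exact: measurable_cst.
  by move=> x /set_mem nX; rewrite b0// => m Xm; apply: nX; exists m.
by split; apply: main => m; have [] := mg m.
Qed.

Lemma L2_sum (I : Type) (s : seq I) (f : I -> V -> C) :
  (forall i, L2 (f i)) -> L2 (fun x => \sum_(i <- s) f i x).
Proof.
move=> f2; elim: s => [|i s IH].
  by under eq_fun do rewrite big_nil; exact: L2_zero.
under eq_fun do rewrite big_cons.
by have := L2_lin 1 (f2 i) IH; under eq_fun do rewrite mul1r.
Qed.

Lemma L2op_sum c U (I : Type) (s : seq I) (f : I -> V -> C) : L2_operator c U ->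
  (forall i, L2 (f i)) ->
  {ae mu, forall x, U (fun y => \sum_(i <- s) f i y) x = \sum_(i <- s) U (f i) x}.
Proof.
move=> Uop f2; elim: s => [|i s IH].
  rewrite (_ : (fun y => _) = fun=> 0); last first.
    by apply/funext => y; rewrite big_nil.
  by apply: filterS (L2op_zero Uop) => x ->; rewrite big_nil.
rewrite (_ : (fun y => _) = fun y => f i y + \sum_(j <- s) f j y); last first.
  by apply/funext => y; rewrite big_cons.
apply: filterS2 (L2op_add Uop (f2 i) (L2_sum s f2)) IH => x -> ->.
by rewrite big_cons.
Qed.

End pieces.

(** * Coefficients on patches *)

Section representation.
Context {R : realType} {n r : nat}.
Local Notation V := 'rV[R]_n.
Local Notation C := R[i].
Local Notation mu := (@lebesgue_rV R n).
Local Notation nball := (@nball R n).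

(** Positive dimension matters here: [R^0] is a point of measure one. *)
Lemma finite_negligible (Z : set V) : (0 < n)%N -> finite_set Z -> mu.-negligible Z.
Proof.
move=> n0 /finite_seqP[s ->].
apply: (@negligibleS _ _ _ _ (\big[setU/set0]_(x <- s) [set x])).
  by move=> x xs; rewrite -bigcup_seq; exists x.
apply: big_ind => [|A B|x _]; [exact: negligible_set0|exact: negligibleU|].
have -> : [set x] = box (fun j => [set x ord0 j]).
  apply/seteqP; split => [y -> //|y yx]; apply/rowP => j; exact: yx.
apply/negligibleP; first by apply: measurable_box => j; exact: measurable_set1.
have mI (j : 'I_n) : measurable [set x ord0 j] by exact: measurable_set1.
apply: etrans (measure_box mI) _; move: mI => _.
by case: n n0 x => // m _ x; rewrite big_ord_recl lebesgue_measure_set1 mul0e.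
Qed.

Variables (D : 'I_r -> set V) (gamma : 'I_r -> V -> V).
Variables (c : R) (U : (V -> C) -> V -> C) (G : 'I_r -> set V) (L : R).
Hypothesis n_gt0 : (0 < n)%N.
Hypothesis Uop : L2_operator c U.
Hypothesis cD : forall i, closed (D i).
Hypothesis L0 : 0 <= L.
Hypothesis lip : forall i, lipschitz_within L (D i) (gamma i).
Hypothesis finZ : forall i i' : 'I_r, i != i' ->
  finite_set [set x | [/\ D i x, D i' x & gamma i x = gamma i' x]].
Hypothesis loc : forall A M, measurable A -> A `<=` nball M ->
  {ae mu, forall x, ~ gamma_preimage D gamma A x -> U (ind A) x = 0}.
Hypothesis mG : forall i, measurable (G i).
Hypothesis GD : forall i, G i `<=` D i.
Hypothesis DG : forall i, mu.-negligible (D i `\` G i).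

(** The second component attaches no cell to the branches that are not defined
    at the points of the patch. *)
Definition patch_index : Type := (nat * {ffun 'I_r -> option 'rV[int]_n})%type.

Definition target (p : patch_index) (i : 'I_r) : set V :=
  if p.2 i is Some z then cell p.1 z else set0.

Definition separated (p : patch_index) : Prop :=
  forall i i', i != i' -> target p i `&` target p i' = set0.

Definition patch (p : patch_index) : set V :=
  [set x | separated p /\ forall i, D i x -> target p i (gamma i x)].

Lemma measurable_target p i : measurable (target p i).
Proof.
by rewrite /target; case: (p.2 i) => [z|]; [exact: measurable_cell|exact: measurable0].
Qed.

Lemma target_bounded p i : exists M, target p i `<=` nball M.
Proof.
by rewrite /target; case: (p.2 i) => [z|]; [exact: cell_bounded|exists 0].
Qed.

Lemma measurable_patch p : measurable (patch p).
Proof.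
have [sp|nsp] := pselect (separated p); last first.
  by rewrite (_ : patch p = set0) ?measurable0//; apply/seteqP; split => // x [].
rewrite (_ : patch p = \big[setI/setT]_(i < r)
    ~` (D i `\` (D i `&` gamma i @^-1` target p i))).
  apply: bigsetI_measurable => i _; apply: measurableC; apply: measurableD.
    exact: closed_measurable_rV.
  exact: (measurable_piece (@cD i) (@lip i) (measurable_target p i)).
apply/seteqP; split => x; rewrite -bigcap_seq /=.
  by move=> [_ xD] i _ [Dx nx]; apply: nx; split => //; exact: xD.
move=> xD; split => // i Dx; apply: contrapT => nx.
by apply: (xD i (mem_index_enum i)); split => // -[].
Qed.

(** If the points [gamma i x], for the [i] with [x] in [D i], are distinct, a grid finer
    than their mutual distances separates them. *)
Lemma patch_cover : {ae mu, forall x, exists p, patch p x}.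
Proof.
have Zneg : mu.-negligible (\big[setU/set0]_(q : 'I_r * 'I_r | q.1 != q.2)
    [set x | [/\ D q.1 x, D q.2 x & gamma q.1 x = gamma q.2 x]]).
  apply: big_ind => [|A B|q qq]; [exact: negligible_set0|exact: negligibleU|].
  by apply: finite_negligible => //; exact: finZ.
apply: negligibleS Zneg => x /= nx; rewrite -bigcup_seq_cond /=.
apply: contrapT => nZ; apply: nx.
have sep (q : 'I_r * 'I_r) : \forall N \near \oo, q.1 != q.2 -> D q.1 x -> D q.2 x ->
    cellof N (gamma q.1 x) != cellof N (gamma q.2 x).
  have [[qq D1 D2]|nq] := pselect [/\ q.1 != q.2, D q.1 x & D q.2 x]; last first.
    by apply: nearW => N qq D1 D2; case: nq.
  have g12 : 0 < `|gamma q.1 x - gamma q.2 x|.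
    rewrite normr_gt0 subr_eq0; apply/eqP => g12; apply: nZ.
    by exists q => //=; rewrite mem_index_enum.
  apply: filterS (near_invn_lt g12) => N Ng _ _ _; apply/eqP => cc.
  have : `|gamma q.1 x - gamma q.2 x| <= N.+1%:R^-1.
    by apply: (@cell_diam _ _ N (cellof N (gamma q.1 x))); apply/cellP.
  by rewrite leNgt Ng.
have [N _ /(_ N (leqnn N)) HN] := filter_forall _ sep.
pose z := [ffun i : 'I_r => if `[< D i x >] then Some (cellof N (gamma i x)) else None].
exists (N, z); split => [i i' ii'|i Dx]; last first.
  by rewrite /target /= ffunE asboolT//; exact/cellP.
rewrite /target /= !ffunE; case: asboolP => D1; last by rewrite set0I.
case: asboolP => D2; last by rewrite setI0.
apply/seteqP; split => // y [/cellP y1 /cellP y2].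
by have /eqP := HN (i, i') ii' D1 D2; rewrite /= y1 y2.
Qed.

Definition patches (m : nat) : set V :=
  if unpickle m is Some p then patch p else set0.

Definition parts : nat -> set V := seqDU patches.

Definition part_target (m : nat) (i : 'I_r) : set V :=
  if unpickle m is Some p then target p i else set0.

Lemma measurable_parts m : measurable (parts m).
Proof.
apply: seqDU_measurable => k; rewrite /patches.
by case: unpickle => [p|]; [exact: measurable_patch|exact: measurable0].
Qed.

Lemma parts_cover : {ae mu, forall x, exists m, parts m x}.
Proof.
apply: filterS patch_cover => x [p px].
have : (\bigcup_m parts m) x.
  by rewrite -seqDU_bigcup_eq; exists (pickle p) => //; rewrite /patches pickleK.
by move=> [m _ xm]; exists m.
Qed.

Lemma parts_sub m : parts m `<=` patches m.
Proof. exact: subset_seqDU. Qed.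

Lemma parts_target m x i : parts m x -> D i x -> part_target m i (gamma i x).
Proof.
move=> /parts_sub; rewrite /patches /part_target.
by case: unpickle => // p [_ H]; exact: H.
Qed.

Lemma parts_separated m x i i' : parts m x -> i != i' ->
  part_target m i `&` part_target m i' = set0.
Proof.
move=> /parts_sub; rewrite /patches /part_target.
by case: unpickle => // p [H _]; exact: H.
Qed.

Lemma measurable_part_target m i : measurable (part_target m i).
Proof.
rewrite /part_target; case: unpickle => [p|]; last exact: measurable0.
exact: measurable_target.
Qed.

Lemma part_target_bounded m i : exists M, part_target m i `<=` nball M.
Proof.
by rewrite /part_target; case: unpickle => [p|]; [exact: target_bounded|exists 0].
Qed.

(** On a patch the target cells are disjoint, so a point of a target cell can be
    reached by its own branch only. *)
Lemma part_target_unique m x i i' : parts m x -> D i' x ->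
  part_target m i (gamma i' x) -> i' = i.
Proof.
move=> mx Dx it; apply/eqP; apply: contrapT => /negP ii'.
have : (part_target m i' `&` part_target m i) (gamma i' x).
  by split => //; exact: parts_target.
by rewrite (parts_separated mx ii').
Qed.

(** Locality of [U], where [gamma^-1 (B)] reduces to a single branch. *)
Lemma local_part m i B : measurable B -> B `<=` part_target m i ->
  {ae mu, forall x, parts m x -> ~ (D i x /\ B (gamma i x)) -> U (ind B) x = 0}.
Proof.
move=> mB Bt; have [M tM] := part_target_bounded m i.
apply: filterS (loc mB (subset_trans Bt tM)) => x xB mx nB.
apply: xB => -[i' _ [Dx Bx]]; apply: nB.
by have := part_target_unique mx Dx (Bt _ Bx) => <-.
Qed.

(** The rest of the target cell contributes nothing at [x], again by locality. *)
Lemma split_part m i B : measurable B -> B `<=` part_target m i ->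
  {ae mu, forall x, parts m x -> D i x -> B (gamma i x) ->
    U (ind B) x = U (ind (part_target m i)) x}.
Proof.
move=> mB Bt; have [M tM] := part_target_bounded m i.
have mt := measurable_part_target m i.
have tE : part_target m i = B `|` (part_target m i `\` B) by rewrite setDUK.
have BtM := subset_trans Bt tM.
have dM : part_target m i `\` B `<=` nball M by move=> x [/tM].
have md : measurable (part_target m i `\` B) by exact: measurableD.
have := L2op_add Uop (L2_ind mB BtM) (L2_ind md dM).
have tI : B `&` (part_target m i `\` B) = set0.
  by apply/seteqP; split => // x [Bx [_]].
rewrite -(ind_disjointU tI) -tE.
move=> tadd; apply: filterS2 (@local_part m i _ md (@subDsetl _ _ _)) tadd.
move=> x xd -> mx Dx Bx; rewrite [X in _ = _ + X]xd ?addr0//.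
by move=> [_ []].
Qed.

Lemma indicator_representation A M m : measurable A -> A `<=` nball M ->
  {ae mu, forall x, parts m x -> U (ind A) x =
     \sum_(i < r) U (ind (part_target m i)) x * ind A (gamma i x) * (\1_(D i) x)%:C}.
Proof.
move=> mA AM.
have [[x0 mx0]|pe] := pselect (parts m !=set0); last first.
  by apply: aeW => x mx; case: pe; exists x.
pose At i := A `&` part_target m i.
have mt := measurable_part_target m.
have mAt i : measurable (At i) by exact: measurableI.
have AtM i : At i `<=` nball M by move=> x [/AM].
have Att i : At i `<=` part_target m i by move=> x [].
(* [rest] is invisible from the part: no branch sends a point there. *)
pose rest := A `\` \big[setU/set0]_(i < r) part_target m i.
have mrest : measurable rest by apply: measurableD => //; exact: bigsetU_measurable.
have rM : rest `<=` nball M by move=> x [/AM].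
have AE : ind A = (fun x => \sum_(i < r) ind (At i) x + ind rest x).
  apply/funext => x; have [[i ix]|nix] := pselect (exists i, part_target m i x).
    rewrite (ind0 (A := rest)) ?addr0; last first.
      by move=> [_]; apply; rewrite -bigcup_seq; exists i => //=; rewrite mem_index_enum.
    rewrite (bigD1 i)//= big1 ?addr0 => [|j ji].
      have [Ax|Ax] := pselect (A x); first by rewrite !ind1.
      by rewrite !ind0// => -[].
    rewrite ind0// => -[_ jx].
    have : (part_target m j `&` part_target m i) x by [].
    by rewrite (parts_separated mx0 ji).
  rewrite big1 ?add0r => [|j _]; last first.
    by rewrite ind0// => -[_ jx]; apply: nix; exists j.
  have [Ax|Ax] := pselect (A x); last by rewrite !ind0// => -[].
  rewrite !ind1//; split => //; rewrite -bigcup_seq => -[i _ ix].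
  by apply: nix; exists i.
have At2 i : L2 (ind (At i)) by exact: L2_ind (AtM i).
have r2 : L2 (ind rest) by exact: L2_ind rM.
have H1 : {ae mu, forall x, U (ind A) x = \sum_(i < r) U (ind (At i)) x + U (ind rest) x}.
  rewrite AE; apply: filterS2 (L2op_add Uop (L2_sum (index_enum 'I_r) At2) r2)
    (L2op_sum (index_enum 'I_r) Uop At2) => x -> ->//.
have H2 : {ae mu, forall x, forall i, parts m x -> ~ (D i x /\ At i (gamma i x)) ->
    U (ind (At i)) x = 0}.
  by apply: filter_forall => i; exact: local_part.
have H3 : {ae mu, forall x, forall i, parts m x -> D i x -> At i (gamma i x) ->
    U (ind (At i)) x = U (ind (part_target m i)) x}.
  by apply: filter_forall => i; exact: split_part.
have H4 : {ae mu, forall x, parts m x -> U (ind rest) x = 0}.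
  apply: filterS (loc mrest rM) => x xr mx; apply: xr => -[i _ [Dx [_ nx]]].
  apply: nx; rewrite -bigcup_seq; exists i => /=; first exact: mem_index_enum.
  exact: parts_target.
apply: filterS2 (filterI H1 H2) (filterI H3 H4) => x [-> x2] [x3 x4] mx.
rewrite x4// addr0; apply: eq_bigr => i _.
have [Dx|Dx] := pselect (D i x); last first.
  by rewrite x2 ?indicE ?memNset ?mulr0// => -[].
rewrite indicE (mem_set Dx) mulr1; have [Ax|Ax] := pselect (A (gamma i x)).
  by rewrite ind1// mulr1 x3//; split => //; exact: parts_target.
by rewrite ind0// mulr0 x2// => -[_ []].
Qed.

(** If the bound fails on a compact set [F], then [U] takes large values on [F] at
    the indicator of [gamma i F], although the measure of [gamma i F] is controlled
    by that of [F]. *)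
Lemma coefficient_bound m i : {ae mu, forall x, parts m x -> D i x ->
  normc (U (ind (part_target m i)) x) ^+ 2 <= c * (2 * L) ^+ n + 1}.
Proof.
set K := c * (2 * L) ^+ n; set u := U (ind (part_target m i)).
have [M tM] := part_target_bounded m i.
have mt := measurable_part_target m i.
have [mu' _] : cmeasurable_fun setT u /\ (sqint u < +oo)%E.
  by apply/L2P; apply: L2op_L2 Uop _ _; exact: L2_ind tM.
have mnu := measurable_sqr_normc mu'.
(* The set where the bound fails; it is null if its compact subsets are. *)
pose X := (parts m `&` D i) `&` [set x | K + 1 < normc (u x) ^+ 2].
have mD : measurable (D i) by exact: closed_measurable_rV.
have mX : measurable X.
  apply: measurableI; first by apply: measurableI => //; exact: measurable_parts.
  rewrite -[X in measurable X]setTI.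
  have := mnu measurableT _ (measurable_itv `]K + 1, +oo[).
  congr measurable; congr setI; apply/seteqP.
  by split => x /=; rewrite in_itv/= andbT.
suff X0 : mu X = 0%E.
  have : mu.-negligible X by exact/negligibleP.
  apply: negligibleS => x /= /not_implyP[mx /not_implyP[Dx /negP]].
  by rewrite -ltNge.
apply: compact_null => // F cF FX.
have mF := compact_measurable_rV cF.
have lF : lipschitz_within L F (gamma i).
  by move=> x y /FX[[_ Dx] _] /FX[[_ Dy] _]; exact: lip.
pose H := gamma i @` F.
have cH : compact H by exact: lipschitz_compact lF cF.
have mH := compact_measurable_rV cH.
have Ht : H `<=` part_target m i.
  by move=> _ [x /FX[[mx Dx] _] <-]; exact: parts_target.
have HM := subset_trans Ht tM.
have muH : (mu H <= ((2 * L) ^+ n)%:E * mu F)%E by exact: lipschitz_measure.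
have H2 := L2_ind mH HM.
have [mUH _] : cmeasurable_fun setT (U (ind H)) /\ (sqint (U (ind H)) < +oo)%E.
  by apply/L2P; exact: L2op_L2 Uop _ _.
have b1 : (sqint (U (ind H)) <= K%:E * mu F)%E.
  apply: le_trans (L2op_bound Uop H2) _; rewrite sqint_ind//.
  rewrite /K EFinM -muleA; apply: lee_wpmul2l => //.
  by rewrite lee_fin (L2op_ge0 Uop).
have mnH := measurable_sqr_normc mUH.
have b2 : ((K + 1)%:E * mu F <= sqint (U (ind H)))%E.
  have -> : (mu F = \int[mu]_x (\1_F x)%:E)%E by rewrite integral_indic// setIT.
  rewrite -ge0_integralZl//; first last.
  - by rewrite lee_fin addr_ge0// /K mulr_ge0 ?(L2op_ge0 Uop)// exprn_ge0// mulr_ge0.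
  - by apply/measurable_EFinP; exact: measurable_indicator.
  apply: ae_ge0_le_integral => //.
  - move=> x _; rewrite -EFinM lee_fin mulr_ge0// ?indicE ?ler0n//.
    by rewrite addr_ge0// /K mulr_ge0 ?(L2op_ge0 Uop)// exprn_ge0// mulr_ge0.
  - by apply: measurable_funeM; apply/measurable_EFinP; exact: measurable_indicator.
  - by move=> x _; rewrite lee_fin sqr_ge0.
  - exact/measurable_EFinP.
  apply: filterS (split_part mH Ht) => x xH _.
  have [Fx|Fx] := pselect (F x); last first.
    by rewrite indicE memNset// mule0 lee_fin sqr_ge0.
  rewrite indicE mem_set// mule1 lee_fin; have [[mx Dx] /ltW] := FX x Fx.
  by rewrite /u -xH//; exists x.
have [M' FM'] := compact_sub_nball cF; have Foo := bounded_lty mF FM'.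
have := le_trans b2 b1; have : mu F \is a fin_num by rewrite ge0_fin_numE.
move=> /fineK <-; rewrite -!EFinM lee_fin mulrDl mul1r gerDl => F0.
by congr EFin; apply/eqP; rewrite eq_le F0 fine_ge0.
Qed.

(** The coefficients are set to zero off [G i], a subset of full measure of [D i]
    which will be the set where the Jacobian is under control. *)
Lemma coefficients_exist : exists b : 'I_r -> V -> C,
  [/\ forall i, cmeasurable_fun setT (b i),
      forall i x, ~ G i x -> b i x = 0,
      {ae mu, forall x, forall i, normc (b i x) ^+ 2 <= c * (2 * L) ^+ n + 1}
    & forall A M, measurable A -> A `<=` nball M -> {ae mu, forall x,
        U (ind A) x = \sum_(i < r) b i x * ind A (gamma i x) * (\1_(D i) x)%:C}].
Proof.
have /choice[b bP] : forall i : 'I_r, exists b : V -> C,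
    [/\ cmeasurable_fun setT b,
       forall m x, (parts m `&` G i) x -> b x = U (ind (part_target m i)) x
     & forall x, (forall m, ~ (parts m `&` G i) x) -> b x = 0].
  move=> i; apply: measurable_glue.
  - by move=> m; apply: measurableI => //; exact: measurable_parts.
  - by apply: trivIset_setIr; exact: trivIset_seqDU.
  - move=> m; have [M tM] := part_target_bounded m i.
    have : L2 (U (ind (part_target m i))).
      by apply: (L2op_L2 Uop); apply: L2_ind tM; exact: measurable_part_target.
    by move/L2P => [].
have b0 i x : ~ G i x -> b i x = 0.
  by move=> nG; have [_ _] := bP i; apply => m [].
exists b; split => //; first by move=> i; have [] := bP i.
- have H : {ae mu, forall x, forall i m, parts m x -> D i x ->
      normc (U (ind (part_target m i)) x) ^+ 2 <= c * (2 * L) ^+ n + 1}.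
    apply: filter_forall => i; apply: ae_foralln => m; exact: coefficient_bound.
  apply: filterS2 parts_cover H => x [m mx] H i.
  have [Gx|nG] := pselect (G i x); last first.
    rewrite b0// normc0 expr0n/= addr_ge0// mulr_ge0 ?(L2op_ge0 Uop)//.
    by rewrite exprn_ge0// mulr_ge0.
  have [_ bm _] := bP i; rewrite (bm m x)//.
  by apply: H => //; exact: GD.
move=> A M mA AM.
have H1 : {ae mu, forall x m, parts m x -> U (ind A) x =
     \sum_(i < r) U (ind (part_target m i)) x * ind A (gamma i x) * (\1_(D i) x)%:C}.
  by apply: ae_foralln => m; exact: indicator_representation AM.
have H2 : {ae mu, forall x, forall i, D i x -> G i x}.
  apply: filter_forall => i; apply: negligibleS (DG i) => x /= /not_implyP[].
  by [].
apply: filterS3 parts_cover H1 H2 => x [m mx] /(_ m mx) -> DGx.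
apply: eq_bigr => i _; have [Dx|nD] := pselect (D i x); last first.
  by rewrite indicE memNset// !mulr0.
by have [_ bm _] := bP i; rewrite (bm m x)//; split => //; exact: DGx.
Qed.

End representation.

(** * From indicators to square-integrable functions *)

Section L2_extension.
Import HBNNSimple.
Context {R : realType} {n r : nat}.
Local Notation V := 'rV[R]_n.
Local Notation C := R[i].
Local Notation mu := (@lebesgue_rV R n).
Local Notation nball := (@nball R n).
Variables (D : 'I_r -> set V) (gamma : 'I_r -> V -> V).
Variables (c : R) (U : (V -> C) -> V -> C) (b : 'I_r -> V -> C).
Hypothesis Uop : L2_operator c U.

Definition represented (f : V -> C) : Prop := {ae mu, forall x,
  U f x = \sum_(i < r) b i x * f (gamma i x) * (\1_(D i) x)%:C}.

Hypothesis Uind : forall A M, measurable A -> A `<=` nball M -> represented (ind A).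

Lemma represented_lin (a : C) f g : L2 f -> L2 g -> represented f -> represented g ->
  represented (fun x => a * f x + g x).
Proof.
move=> f2 g2 rf rg; apply: filterS3 (L2op_lin Uop a f2 g2) rf rg => x -> -> ->.
rewrite mulr_sumr -big_split; apply: eq_bigr => i _ /=; ring.
Qed.

Lemma normc_sum (I : Type) (s : seq I) (z : I -> C) :
  normc (\sum_(i <- s) z i) <= \sum_(i <- s) normc (z i).
Proof.
elim: s => [|i s IH]; first by rewrite !big_nil normc0.
by rewrite !big_cons (le_trans (le_normcD _ _))// lerD2l.
Qed.

Lemma cvg_sum_zero (I : Type) (s : seq I) (f : I -> nat -> R) :
  (forall i, f i @ \oo --> (0 : R)) -> (fun k => \sum_(i <- s) f i k) @ \oo --> (0 : R).
Proof.
move=> f0; elim: s => [|i s IH].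
  rewrite (_ : (fun k => _) = fun=> 0); first exact: cvg_cst.
  by apply/funext => k; rewrite big_nil.
rewrite (_ : (fun k => _) = (fun k => f i k + \sum_(j <- s) f j k)).
  by rewrite -[X in _ --> X](addr0 0); exact: cvgD.
by apply/funext => k; rewrite big_cons.
Qed.

(** Pointwise convergence is required everywhere since it is used at the points
    [gamma i x]. *)
Lemma represented_limit (f_ : nat -> V -> C) f : L2 f -> (forall k, L2 (f_ k)) ->
  (forall k, represented (f_ k)) ->
  (fun k => sqint (fun x => f x - f_ k x)) @ \oo --> 0%E ->
  (forall y, (fun k => normc (f_ k y - f y)) @ \oo --> (0 : R)) ->
  represented f.
Proof.
move=> f2 fk2 rk sq pw.
pose H (g : V -> C) x := \sum_(i < r) b i x * g (gamma i x) * (\1_(D i) x)%:C.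
have : {ae mu, forall x, setT x -> U f x = H f x}; last first.
  by apply: filterS => x /(_ I).
apply: (@L2op_limit _ _ _ _ Uop f_ (fun k => H (f_ k))) => //.
  by move=> k; apply: filterS (rk k) => x ->.
move=> x _.
have Hle k : normc (H (f_ k) x - H f x) <=
    \sum_(i < r) normc (b i x) * normc (f_ k (gamma i x) - f (gamma i x)).
  rewrite /H -sumrB; apply: le_trans (normc_sum _ _) _; apply: ler_sum => i _.
  rewrite -mulrBl -mulrBr !normcM ler_piMr ?mulr_ge0 ?normc_ge0//.
  by rewrite normc_real indicE; case: (_ \in _); rewrite ?normr1 ?normr0.
have S0 : (fun k => \sum_(i < r) normc (b i x) *
    normc (f_ k (gamma i x) - f (gamma i x))) @ \oo --> (0 : R).
  apply: cvg_sum_zero => i; rewrite -[X in _ --> X](mulr0 (normc (b i x))).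
  by apply: cvgM; [exact: cvg_cst|exact: pw].
apply: (@squeeze_cvgr _ _ _ _ (cst 0) _ _ _ _ _ S0).
  by apply: nearW => k; rewrite normc_ge0 Hle.
exact: cvg_cst.
Qed.

Lemma represented_zero : represented (fun=> 0).
Proof.
apply: filterS (L2op_zero Uop) => x ->.
by rewrite big1// => i _; rewrite mulr0 mul0r.
Qed.

Lemma represented_simple (I : Type) (s : seq I) (a : I -> C) (A : I -> set V) M :
  (forall i, measurable (A i)) -> (forall i, A i `<=` nball M) ->
  L2 (fun x => \sum_(i <- s) a i * ind (A i) x) /\
  represented (fun x => \sum_(i <- s) a i * ind (A i) x).
Proof.
move=> mA AM; elim: s => [|i s [IH1 IH2]].
  rewrite (_ : (fun x => _) = fun=> 0); last by apply/funext => x; rewrite big_nil.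
  by split; [exact: L2_zero|exact: represented_zero].
rewrite (_ : (fun x => _) = fun x => a i * ind (A i) x + \sum_(j <- s) a j * ind (A j) x).
  have i2 : L2 (ind (A i)) by exact: L2_ind (AM i).
  split; first exact: L2_lin.
  by apply: represented_lin => //; exact: Uind (AM i).
by apply/funext => x; rewrite big_cons.
Qed.

Lemma L2_integrable_sqr (f : V -> C) : L2 f ->
  mu.-integrable setT (EFin \o (fun x => normc (f x) ^+ 2)).
Proof.
move=> /L2P[mf f2]; apply/integrableP; split.
  by apply/measurable_EFinP; exact: (measurable_sqr_normc mf).
apply: le_lt_trans f2; rewrite /sqint le_eqVlt; apply/orP; left; apply/eqP.
by apply: eq_integral => x _; rewrite /= ger0_norm// sqr_ge0.
Qed.

(** Approximation by simple functions cut off to balls. *)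
Lemma represented_ge0 (f : V -> R) : (forall x, 0 <= f x) ->
  L2 (fun x => (f x)%:C) -> represented (fun x => (f x)%:C).
Proof.
move=> f0 f2; have /L2P[[mf _] _] := f2.
have mEf : measurable_fun setT (EFin \o f) by apply/measurable_EFinP.
pose gs := nnsfun_approx measurableT mEf; pose g k : V -> R := gs k.
have gcv x : (fun k => g k x) @ \oo --> f x.
  have := @cvg_nnsfun_approx _ V R setT measurableT _ mEf
    (fun x _ => lee_tofin (f0 x)) x I.
  by move/fine_cvgP => [].
have gle k x : g k x <= f x.
  rewrite -(cvg_lim (@Rhausdorff R) (gcv x)).
  apply: (@nondecreasing_cvgn_le _ (fun k => g k x)).
    move=> i j ij; apply/lefP.
    exact: (@nd_nnsfun_approx _ V R setT measurableT _ mEf i j ij).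
  by apply/cvg_ex; exists (f x).
pose h k x : R := g k x * \1_(nball k%:R) x.
have hE k : (fun x => (h k x)%:C) =
  (fun x => \sum_(y <- finmap.enum_fset (fset_set (range (gs k))))
    y%:C * ind (gs k @^-1` [set y] `&` nball k%:R) x).
  apply/funext => x; rewrite /h /g fimfunE fsbig_finite//= mulr_suml rmorph_sum.
  apply: eq_bigr => y _; rewrite -mulrA rmorphM; congr (_ * _).
  by rewrite /ind indicI.
have hP k : L2 (fun x => (h k x)%:C) /\ represented (fun x => (h k x)%:C).
  rewrite hE; apply: (@represented_simple _ _ _ _ k%:R) => y; last by move=> x [].
  by apply: measurableI; [exact: (measurable_sfunP (gs k))|exact: measurable_nball].
have hle k x : normc ((h k x)%:C) ^+ 2 <= normc ((f x)%:C) ^+ 2.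
  have g0 : 0 <= g k x by exact: (@fun_ge0 _ _ (gs k) x).
  rewrite !sqr_normc_real ler_sqr ?nnegrE// /h indicE; last first.
    by rewrite mulr_ge0.
  by case: (_ \in _); rewrite ?mulr1 ?mulr0.
have hcv x : (fun k => h k x) @ \oo --> f x.
  rewrite -[X in _ --> X]mulr1; apply: cvgM => //; apply: cvg_near_cst.
  exists (Num.truncn `|x|).+1 => // k /= xk; rewrite indicE mem_set// /nball /=.
  by rewrite (le_trans (ltW (truncnS_gt _)))// ler_nat.
have hcv2 y : (fun k => normc ((h k y)%:C - (f y)%:C)) @ \oo --> (0 : R).
  apply/cvgrPdist_le => e e0; have /cvgrPdist_le/(_ e e0) := hcv y.
  by apply: filterS => k; rewrite sub0r normrN -rmorphB normc_real normr_id distrC.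
apply: (@represented_limit (fun k x => (h k x)%:C)) => //.
- by move=> k; have [] := hP k.
- by move=> k; have [] := hP k.
apply: (@sqint_dominated _ _ _ _ (fun x => normc ((f x)%:C) ^+ 2)) => //.
- by move=> k; have [/L2P[]] := hP k.
- exact: L2_integrable_sqr.
apply: aeW => x; apply/cvgrPdist_le => e e0; have /cvgrPdist_le/(_ e e0) := hcv2 x.
apply: filterS => k; rewrite !sub0r !normrN.
by rewrite -normcN opprB.
Qed.

Lemma L2_le (f : V -> C) (g : V -> R) : measurable_fun setT g -> L2 f ->
  (forall x, g x ^+ 2 <= normc (f x) ^+ 2) -> L2 (fun x => (g x)%:C).
Proof.
move=> mg /L2P[mf f2] gf; apply/L2P; split; first exact: cmeasurable_real.
apply: le_lt_trans f2; apply: ge0_le_integral => //.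
- by move=> x _; rewrite lee_fin sqr_ge0.
- by apply/measurable_EFinP; exact: (measurable_sqr_normc (cmeasurable_real mg)).
- by apply/measurable_EFinP; exact: (measurable_sqr_normc mf).
by move=> x _; rewrite sqr_normc_real lee_fin.
Qed.

Lemma represented_real (f : V -> R) : L2 (fun x => (f x)%:C) ->
  represented (fun x => (f x)%:C).
Proof.
move=> f2; have /L2P[[mf _] _] := f2.
have p2 : L2 (fun x => (f^\+ x)%:C).
  apply: L2_le f2 _ => [|x]; first exact: measurable_funrpos.
  rewrite sqr_normc_real /funrpos; case: (leP (f x) 0) => fx //.
  by rewrite expr0n sqr_ge0.
have n2 : L2 (fun x => (f^\- x)%:C).
  apply: L2_le f2 _ => [|x]; first exact: measurable_funrneg.
  rewrite sqr_normc_real /funrneg; case: (leP (- f x) 0) => fx.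
    by rewrite expr0n sqr_ge0.
  by rewrite sqrrN.
rewrite (_ : (fun x => _) = fun x => -1 * (f^\- x)%:C + (f^\+ x)%:C).
  by apply: represented_lin => //; exact: represented_ge0.
apply/funext => x; rewrite mulN1r addrC -rmorphB; congr _%:C.
by rewrite /funrpos /funrneg; case: (leP (f x) 0); case: (leP (- f x) 0); lra.
Qed.

Lemma represented_L2 (f : V -> C) : L2 f -> represented f.
Proof.
move=> f2; have /L2P[[mr mi] _] := f2.
have r2 : L2 (fun x => (complex.Re (f x))%:C).
  by apply: (L2_le mr f2) => x; rewrite sqr_normcE lerDl sqr_ge0.
have i2 : L2 (fun x => (complex.Im (f x))%:C).
  by apply: (L2_le mi f2) => x; rewrite sqr_normcE lerDr sqr_ge0.
rewrite (_ : f = fun x => 'i%C * (complex.Im (f x))%:C + (complex.Re (f x))%:C).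
  by apply: represented_lin => //; exact: represented_real.
by apply/funext => x; rewrite addrC -complexE.
Qed.

End L2_extension.

(** * The Jacobian along a closed set *)

Section jacobian.
Context {R : realType} {n : nat}.
Local Notation V := 'rV[R]_n.
Local Notation mu := (@lebesgue_rV R n).
Local Notation nball := (@nball R n).

Definition rvec (q : 'rV[rat]_n) : V := map_mx ratr q.

Lemma rvec_dense (v : V) (e : R) : 0 < e -> exists q, `|v - rvec q| <= e.
Proof.
move=> e0; have /choice[q qP] : forall j, exists q : rat, `|v ord0 j - ratr q| <= e.
  move=> j; have /rat_in_itvoo[q] : v ord0 j - e < v ord0 j + e by lra.
  rewrite in_itv/= => /andP[q1 q2]; exists q.
  by rewrite ler_norml; apply/andP; split; lra.
exists (\row_j q j); apply: norm_le_coord => [|j]; first exact: ltW.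
by rewrite !mxE.
Qed.

Lemma norm_mulmx_le (u : V) (A : 'M[R]_n) (a : R) :
  (forall i j, `|A i j| <= a) -> `|u *m A| <= n%:R * a * `|u|.
Proof.
move=> Aa; have [n0|n0] := posnP n.
  rewrite (_ : u *m A = 0) ?normr0; last first.
    by apply/rowP => j; have := ltn_ord j; rewrite {2}n0.
  have -> : n%:R = 0 :> R by rewrite n0.
  by rewrite !mul0r.
have a0 : 0 <= a by apply: le_trans (Aa (Ordinal n0) (Ordinal n0)).
apply: norm_le_coord => [|j]; first by rewrite !mulr_ge0.
rewrite mxE; apply: le_trans (ler_norm_sum _ _ _) _.
apply: (@le_trans _ _ (\sum_(k < n) a * `|u|)); last first.
  by rewrite sumr_const card_ord -mulrA [leRHS]mulr_natl.
apply: ler_sum => k _; rewrite normrM mulrC; apply: ler_pM => //.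
exact: coord_le_norm.
Qed.

Lemma norm_entry (A : 'M[R]_n) i j : `|A i j| <= `|A|.
Proof.
rewrite [leRHS]/Num.norm /= mx_normrE; apply/bigmax_geP; right => /=.
by exists (i, j).
Qed.

(** By disjointness the measures of the translates add up. A translation is
    Lipschitz with constant 1, which compares [F] with its translates at the cost
    of a factor [2 ^ n]. *)
Lemma measure_translates (F : set V) (h : V) (M : R) (s : nat -> R) (P : nat) :
  compact F -> F `<=` nball M -> (forall l, (l < P)%N -> 0 <= s l <= 1) ->
  trivIset `I_P (fun l => (fun x => x + s l *: h) @` F) ->
  (P%:R%:E * mu F <= (2 ^+ n)%:E * mu (nball (M + `|h|)))%E.
Proof.
move=> cF FM s01 tF; pose T l := (fun x => x + s l *: h) @` F.
have cT l : compact (T l).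
  apply: (@lipschitz_compact _ _ 1) cF => x y _ _.
  by rewrite mul1r opprD addrACA subrr addr0.
have mT l : measurable (T l) by apply: compact_measurable_rV; exact: cT.
have FT l : (mu F <= (2 ^+ n)%:E * mu (T l))%E.
  have -> : F = (fun x => x - s l *: h) @` T l.
    apply/seteqP; split => [x Fx|x [_ [y Fy <-] <-]]; last by rewrite addrK.
    by exists (x + s l *: h); [exists x|rewrite addrK].
  rewrite -[X in (X ^+ _)%:E](mulr1 2); apply: lipschitz_measure => //.
  by move=> x y _ _; rewrite mul1r opprB addrA subrK.
have mUT : measurable (\big[setU/set0]_(l < P) T l) by exact: bigsetU_measurable.
apply: (@le_trans _ _ (\sum_(l < P) (2 ^+ n)%:E * mu (T l))%E).
  elim: P {s01 tF mUT} => [|P IH]; first by rewrite mul0e big_ord0.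
  rewrite big_ord_recr -natr1 EFinD ge0_muleDl ?lee_fin// mul1e.
  exact: leeD.
rewrite -ge0_sume_distrr; last by move=> l _.
apply: lee_wpmul2l; first by rewrite lee_fin exprn_ge0.
rewrite -measure_semi_additive_ord_I//.
apply: le_measure; rewrite ?inE//; first exact: measurable_nball.
move=> y; rewrite -bigcup_mkord => -[l /= lP [x Fx <-]].
have /andP[l0 l1] := s01 l lP; rewrite /nball /= (le_trans (ler_normD _ _))//.
by apply: lerD; [exact: FM|rewrite normrZ ger0_norm// ler_piMl].
Qed.

Section piece.
Variables (D : set V) (gamma : V -> V) (L : R).
Hypothesis clD : closed D.
Hypothesis L_gt0 : 0 < L.
Hypothesis lip : lipschitz_within L D gamma.
Hypothesis colip : forall x y, D x -> D y -> `|x - y| <= L * `|gamma x - gamma y|.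
Hypothesis dgamma : forall x, D x -> differentiable gamma (within D (nbhs x)).

Definition dmx (x : V) : 'M[R]_n := lin1_mx ('d gamma (within D (nbhs x))).

Lemma jacE x : jac D gamma x = \det (dmx x). Proof. by []. Qed.

Lemma dmx_expansion x (e : R) : D x -> 0 < e -> exists2 d : R, 0 < d &
  forall y, D y -> `|y - x| < d ->
    `|gamma y - gamma x - (y - x) *m dmx x| <= e * `|y - x|.
Proof.
move=> Dx e0.
have FF : ProperFilter (within D (nbhs x)).
  by apply: within_nbhs_proper; exact: subset_closure.
have limx : lim (within D (nbhs x)) = x.
  have H : id @ (within D (nbhs x)) --> x by exact: cvg_within.
  have hV : hausdorff_space V by exact: norm_hausdorff.
  exact: (cvg_lim hV H).
have [[_ dE]] := dgamma Dx.
have := (eqaddoP _ _ _ _).1 dE => /(_ e e0).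
rewrite /= limx => /nbhs_distP[d d0 H]; exists d => // y Dy yx.
have := H y; rewrite distrC => /(_ yx Dy).
by rewrite !fctE /= opprD addrA /dmx mul_rV_lin1.
Qed.

(** The points from which [D] cannot be re-entered by short steps
    [rvec q / (m + 1)]. Off these sets, which are countably many, the differential
    along [D] is determined in all rational directions. *)
Definition stuck (q : 'rV[rat]_n) (k : nat) : set V :=
  [set x | D x /\ forall m, (k <= m)%N -> ~ D (x + m.+1%:R^-1 *: rvec q)].

Lemma measurable_stuck q k : measurable (stuck q k).
Proof.
have -> : stuck q k = D `&` \bigcap_(m in [set m | (k <= m)%N])
    ~` [set x | D (x + m.+1%:R^-1 *: rvec q)].
  by apply/seteqP; split => x [Dx nx]; split => // m /nx.
apply: measurableI; first exact: closed_measurable_rV.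
apply: bigcap_measurable => [|m _]; first by exists k => /=.
apply: measurableC; apply: closed_measurable_rV; apply: closed_distP => x xP.
apply: clD => B /nbhs_distP[e e0 eB]; have [y Dy xy] := xP e e0.
exists (y + m.+1%:R^-1 *: rvec q); split => //; apply: eB.
by rewrite opprD addrACA subrr addr0.
Qed.

(** A compact subset [F] has as many disjoint translates as one wishes within
    a bounded set, namely by multiples of one small fraction of [rvec q]. *)
Lemma stuck_null q k : mu (stuck q k) = 0%E.
Proof.
apply: compact_null => [|F cF FN]; first exact: measurable_stuck.
have [M FM] := compact_sub_nball cF; have mF := compact_measurable_rV cF.
have B P : (P%:R%:E * mu F <= (2 ^+ n)%:E * mu (nball (M + `|rvec q|)))%E.
  pose s l : R := l%:R / (k.+1 * P`!)%:R.
  have kP0 : 0 < (k.+1 * P`!)%:R :> R by rewrite ltr0n muln_gt0 fact_gt0.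
  apply: (@measure_translates _ _ _ s) => //.
    move=> l lP; rewrite divr_ge0//= ler_pdivrMr// mul1r ler_nat.
    by rewrite (leq_trans (ltnW lP))// (leq_trans (fact_geq P))// leq_pmull.
  (* Two shifts differ by [(l' - l) / ((k + 1) * P!)], which is [1 / (m + 1)] for
     some [m >= k] because [l' - l] divides [P!]: a common point of the two
     translates would give a step that is excluded in [F]. *)
  have step l l' x x' : (l < l' < P)%N -> F x -> F x' ->
      x + s l *: rvec q <> x' + s l' *: rvec q.
    move=> /andP[ll' l'P] Fx Fx' xx'.
    have dd : (l' - l %| P`!)%N.
      by rewrite dvdn_fact// subn_gt0 ll'/= (leq_trans (leq_subr _ _))// ltnW.
    have [m mE] : exists m, (m.+1 * (l' - l) = k.+1 * P`!)%N.
      have /dvdnP[a aE] := dd; exists (k.+1 * a).-1.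
      rewrite prednK; first by rewrite -mulnA -aE.
      rewrite muln_gt0/=; case: a aE => // /eqP.
      by rewrite mul0n => /eqP a0; have := fact_gt0 P; rewrite a0.
    have km : (k <= m)%N.
      rewrite -ltnS -(leq_pmul2r (m := l' - l)) ?subn_gt0// mE leq_pmul2l//.
      by rewrite dvdn_leq// fact_gt0.
    have [_ /(_ m km)] := FN x' Fx'; apply.
    rewrite (_ : _ + _ = x); first by have [] := FN x Fx.
    apply: (addIr (s l *: rvec q)); rewrite xx' -addrA -scalerDl; congr (_ + _ *: _).
    rewrite /s -mE natrM natrB ?(ltnW ll')//.
    have l0 : (l'%:R - l%:R : R) != 0 by rewrite subr_eq0 eqr_nat gtn_eqF.
    have m0 : (m.+1%:R : R) != 0 by rewrite pnatr_eq0.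
    move: l0 m0; set a : R := m.+1%:R; set c : R := l'%:R; set d : R := l%:R => l0 m0.
    apply: (@mulfI _ (a * (c - d))); first by rewrite mulf_neq0.
    rewrite mulrDr [RHS]mulrC [X in _ + X]mulrC !divfK ?mulf_neq0//.
    by rewrite mulrAC divff// mul1r subrK.
  move=> l l' /= lP l'P [y [[x Fx xy] [x' Fx' xy']]].
  have [ll'|ll'|//] := ltngtP l l'.
    by exfalso; apply: (@step l l' x x') => //; rewrite ?ll' ?xy.
  by exfalso; apply: (@step l' l x' x) => //; rewrite ?ll' ?xy.
have Foo := bounded_lty mF FM.
have Boo := @measure_nball_lty R n (M + `|rvec q|).
have f1 : mu F \is a fin_num by rewrite ge0_fin_numE.
have f2 : mu (nball (M + `|rvec q|)) \is a fin_num by rewrite ge0_fin_numE.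
set a := fine (mu F); set B' := fine (mu (nball (M + `|rvec q|))).
have a0 : 0 <= a by exact: fine_ge0.
suff : a <= 0 by move=> a1; rewrite -(fineK f1); congr EFin; apply/eqP; rewrite eq_le a1.
rewrite leNgt; apply/negP => agt0.
(* A number of translates for which [B] cannot hold when [mu F > 0]. *)
have := B (Num.truncn (2 ^+ n * B' / a)).+1.
rewrite -(fineK f1) -(fineK f2) -!EFinM lee_fin -ler_pdivlMr//.
by rewrite leNgt truncnS_gt.
Qed.

Definition reachable : set V := D `\` \bigcup_(qk : 'rV[rat]_n * nat) stuck qk.1 qk.2.

Lemma measurable_reachable : measurable reachable.
Proof.
apply: measurableD; first exact: closed_measurable_rV.
apply: countable_bigcupT_measurable => [|qk]; first exact: countableP.
exact: measurable_stuck.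
Qed.

Lemma reachable_ae : mu.-negligible (D `\` reachable).
Proof.
pose N (m : nat) := if unpickle m is Some qk then stuck qk.1 qk.2 else set0.
apply: (@negligibleS _ _ _ _ (\bigcup_m N m)).
  move=> x [Dx nG]; apply: contrapT => nN; apply: nG; split => // -[qk _ xqk].
  by apply: nN; exists (pickle qk) => //; rewrite /N pickleK.
apply: negligible_bigcup => m; rewrite /N; case: unpickle => [qk|].
  by apply/negligibleP; [exact: measurable_stuck|exact: stuck_null].
exact: negligible_set0.
Qed.

Lemma reachable_step x q (d : R) : reachable x -> 0 < d ->
  exists t : R, [/\ 0 < t, D (x + t *: rvec q) & `|t *: rvec q| < d].
Proof.
move=> [Dx nx] d0; have q1 : 0 < `|rvec q| + 1 by rewrite ltr_wpDl.
have [k _ kP] := near_invn_lt (divr_gt0 d0 q1).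
have [[m km Dm]|nm] := pselect (exists2 m, (k <= m)%N & D (x + m.+1%:R^-1 *: rvec q)).
  exists m.+1%:R^-1; split => //.
  have := kP m km; rewrite ltr_pdivlMr// mulrDr mulr1; apply: le_lt_trans.
  by rewrite normrZ ger0_norm// lerDl.
exfalso; apply: nx; exists (q, k) => //; split => // m km Dm.
by apply: nm; exists m.
Qed.

(** The inverse of the differential inherits the Lipschitz constant of the
    inverse map: along a rational direction, divide the Lipschitz bound by the
    length of a short step; then use density. *)
Lemma dmx_lower_bound x (v : V) : reachable x -> `|v| <= L * `|v *m dmx x|.
Proof.
move=> xG; have [Dx _] := xG.
have rat_bound q : `|rvec q| <= L * `|rvec q *m dmx x|.
  apply/ler_addgt0Pr => e e0.
  have q1 : 0 < L * (`|rvec q| + 1) by rewrite mulr_gt0// ltr_wpDl.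
  have [d d0 dP] := dmx_expansion Dx (divr_gt0 e0 q1).
  have [t [t0 Dt td]] := reachable_step q xG d0.
  have := dP _ Dt; rewrite addrC addKr => /(_ td).
  have := colip Dt Dx; rewrite addrC addKr.
  rewrite -scalemxAl !normrZ (ger0_norm (ltW t0)) => H1 H2.
  rewrite -(ler_pM2l t0); apply: le_trans H1 _.
  apply: (@le_trans _ _ (L * (t * `|rvec q *m dmx x| +
      e / (L * (`|rvec q| + 1)) * (t * `|rvec q|)))).
    rewrite ler_pM2l//.
    have -> : gamma (x + t *: rvec q) - gamma x = t *: (rvec q *m dmx x) +
        (gamma (x + t *: rvec q) - gamma x - t *: (rvec q *m dmx x)).
      by rewrite [RHS]addrC subrK.
    rewrite (le_trans (ler_normD _ _))// lerD// ?normrZ ?(ger0_norm (ltW t0))//.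
  rewrite mulrDr [leRHS]mulrDr; apply: lerD; first by rewrite mulrCA.
  rewrite (_ : L * _ = t * e * (`|rvec q| / (`|rvec q| + 1))).
    rewrite ler_piMr ?mulr_ge0 ?(ltW e0) ?(ltW t0)//.
    by rewrite ler_pdivrMr ?ltr_wpDl// mul1r lerDl.
  by field; rewrite !gt_eqF// ltr_wpDl.
pose a := `|dmx x|; have Aa := norm_entry (dmx x).
apply/ler_addgt0Pr => e e0.
have c0 : 0 < L * (n%:R * a) + 1.
  by rewrite ltr_wpDl// !mulr_ge0 ?normr_ge0// ltW.
have [q qv] := rvec_dense v (divr_gt0 e0 c0).
have t1 : `|v| <= `|v - rvec q| + `|rvec q|.
  by rewrite -{1}(subrK (rvec q) v) ler_normD.
have t2 : `|rvec q *m dmx x| <= `|v *m dmx x| + `|(v - rvec q) *m dmx x|.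
  rewrite (_ : rvec q *m dmx x = v *m dmx x - (v - rvec q) *m dmx x).
    by rewrite (le_trans (ler_normB _ _)).
  by rewrite mulmxBl opprB addrC subrK.
have t3 := norm_mulmx_le (v - rvec q) Aa.
have t4 := rat_bound q.
have t5 : L * `|rvec q *m dmx x| <= L * (`|v *m dmx x| + n%:R * a * `|v - rvec q|).
  by rewrite ler_pM2l// (le_trans t2)// lerD2l.
move: qv; rewrite ler_pdivlMr// => qv.
apply: le_trans t1 _; apply: le_trans (lerD (lexx _) (le_trans t4 t5)) _.
rewrite mulrDr addrCA lerD2l; apply: le_trans qv; rewrite mulrDr mulr1 addrC.
by rewrite lerD2r mulrA [leRHS]mulrC.
Qed.

Lemma norm_delta_le (i : 'I_n) : `|delta_mx 0 i : V| <= 1.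
Proof.
apply: norm_le_coord => // j; rewrite mxE.
by case: (_ && _); rewrite ?normr1 ?normr0.
Qed.

(** The entries of the inverse matrix are at most [L]. *)
Lemma jac_lower_bound x : reachable x ->
  `|(jac D gamma x)^-1| <= \sum_(s : 'S_n) L ^+ n.
Proof.
move=> xG; have LB (v : V) := dmx_lower_bound v xG.
have uA : dmx x \in unitmx.
  rewrite unitmxE unitfE; apply/det0P => -[v v0 vA].
  by have := LB v; rewrite vA normr0 mulr0 normr_le0 (negbTE v0).
have invL i j : `|invmx (dmx x) i j| <= L.
  pose v : V := delta_mx 0 i *m invmx (dmx x).
  have -> : invmx (dmx x) i j = v ord0 j by rewrite /v -rowE mxE.
  apply: le_trans (coord_le_norm _ _) _; apply: le_trans (LB v) _.
  rewrite /v mulmxKV// -[leRHS]mulr1 ler_pM2l//; exact: norm_delta_le.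
rewrite jacE -det_inv /determinant; apply: le_trans (ler_norm_sum _ _ _) _.
apply: ler_sum => s _; rewrite normrM normr_sign mul1r normr_prod.
rewrite (_ : L ^+ n = \prod_(i < n) L); last by rewrite prodr_const card_ord.
apply: ler_prod => i _.
by rewrite normr_ge0 invL.
Qed.

Definition ratmx (q : 'M[rat]_n) : 'M[R]_n := map_mx ratr q.

(** Comparison with rational matrices leaves countably many sets, and the uniform
    bound over a ball of fixed radius makes each of them closed. *)
Definition approx (q : 'M[rat]_n) (k m : nat) : set V :=
  D `&` [set x | forall y, D y -> `|y - x| < m.+1%:R^-1 ->
    `|gamma y - gamma x - (y - x) *m ratmx q| <= k.+1%:R^-1 * `|y - x|].

Lemma measurable_approx q k m : measurable (approx q k m).
Proof.
apply: closed_measurable_rV; apply: closed_distP => x xP.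
have Dx : D x.
  apply: clD => B /nbhs_distP[e e0 eB]; have [y [Dy _] xy] := xP e e0.
  by exists y; split => //; exact: eB.
split => // y Dy yx; apply/ler_addgt0Pr => e e0.
pose C := k.+1%:R^-1 + L + n%:R * `|ratmx q| + 1.
have k0 : 0 < k.+1%:R^-1 :> R by rewrite invr_gt0.
have nq0 : 0 <= n%:R * `|ratmx q| by rewrite mulr_ge0 ?normr_ge0.
have C0 : 0 < C.
  by rewrite /C ltr_wpDl// !addr_ge0// ltW.
pose d := Num.min (e / C) (m.+1%:R^-1 - `|y - x|).
have d0 : 0 < d by rewrite lt_min divr_gt0//= subr_gt0.
have [x' [Dx' x'P] xx'] := xP d d0.
have {xx'} : `|x - x'| < e / C /\ `|x - x'| < m.+1%:R^-1 - `|y - x|.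
  by move: xx'; rewrite lt_min => /andP[].
rewrite ltr_pdivlMr// => -[xx1 xx2].
have tri : `|y - x'| <= `|y - x| + `|x - x'|.
  by rewrite -{1}(subrK x y) -addrA ler_normD.
have := x'P y Dy (le_lt_trans tri _); rewrite -ltrBrDl => /(_ xx2) H1.
have H2 := lip Dx' Dx; rewrite distrC in H2.
have H3 := norm_mulmx_le (x - x') (norm_entry (ratmx q)).
have -> : gamma y - gamma x - (y - x) *m ratmx q =
    (gamma y - gamma x' - (y - x') *m ratmx q) - (gamma x - gamma x') +
    (x - x') *m ratmx q.
  rewrite !mulmxBl !opprB; set a := y *m _; set b := x *m _; set c := x' *m _.
  by apply/rowP => j; rewrite !mxE; ring.
apply: le_trans (ler_normD _ _) _.
apply: le_trans (lerD (ler_normB _ _) (lexx _)) _.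
rewrite (distrC x' x) in H2.
have H4 : k.+1%:R^-1 * `|y - x'| <= k.+1%:R^-1 * `|y - x| + k.+1%:R^-1 * `|x - x'|.
  by rewrite -mulrDr ler_pM2l.
apply: le_trans (lerD (lerD (le_trans H1 H4) H2) H3) _.
rewrite -!addrA lerD2l; apply: le_trans (ltW xx1).
rewrite /C; set i := k.+1%:R^-1; set t := `|x - x'|; have t0 : 0 <= t by exact: normr_ge0.
by nra.
Qed.

Lemma approx_entry x q k m i j : reachable x -> approx q k m x ->
  `|dmx x i j - ratr (q i j)| <= k.+1%:R^-1.
Proof.
move=> xG [Dx xP]; apply/ler_addgt0Pr => e e0.
have [d d0 dP] := dmx_expansion Dx e0.
have m0 : 0 < m.+1%:R^-1 :> R by rewrite invr_gt0.
have dm0 : 0 < Num.min d m.+1%:R^-1 by rewrite lt_min d0.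
have [t [t0 + +]] := reachable_step (delta_mx 0 i) xG dm0.
rewrite (_ : rvec _ = delta_mx 0 i); last first.
  by apply/rowP => l; rewrite !mxE; case: (_ && _); rewrite ?rmorph1 ?rmorph0.
rewrite lt_min => Dy /andP[yd ym].
pose v : V := delta_mx 0 i.
have yE : x + t *: v - x = t *: v by rewrite addrC addKr.
have := dP _ Dy; have := xP _ Dy; rewrite yE => /(_ ym) H1 /(_ yd) H2.
have : `|t *: (v *m (dmx x - ratmx q))| <= (k.+1%:R^-1 + e) * (t * `|v|).
  rewrite -{2}(gtr0_norm t0) -normrZ scalemxAl mulmxBr mulrDl.
  apply: le_trans (lerD H1 H2).
  apply: le_trans (ler_normB _ _).
  set g := gamma _ - _; set a := _ *m dmx x; set b := _ *m ratmx q.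
  by rewrite (_ : g - b - (g - a) = a - b)// opprB addrC addrA subrK.
rewrite normrZ (gtr0_norm t0) mulrCA ler_pM2l// => H3.
have -> : dmx x i j - ratr (q i j) = (v *m (dmx x - ratmx q)) ord0 j.
  by rewrite /v -rowE !mxE.
apply: le_trans (coord_le_norm _ _) _; apply: le_trans H3 _.
rewrite -[leRHS]mulr1 ler_wpM2l ?norm_delta_le// addr_ge0 ?invr_ge0 ?(ltW e0)//.
Qed.

Lemma approx_exists x k (e : R) : reachable x -> 0 < e ->
  exists q m, approx q k m x /\ forall i j, `|dmx x i j - ratr (q i j)| <= e.
Proof.
move=> [Dx _] e0; have k0 : 0 < k.+1%:R^-1 :> R by rewrite invr_gt0.
(* Half of the error is for the expansion, half for the rational matrix. *)
pose i2 : R := k.+1%:R^-1 / 2; have i20 : 0 < i2 by rewrite divr_gt0.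
(* [n] entries per column, and [n + 1] to avoid a division by zero. *)
pose a := Num.min e (i2 / n.+1%:R).
have a0 : 0 < a by rewrite lt_min e0 divr_gt0.
have /choice[q qP] : forall ij : 'I_n * 'I_n, exists q : rat,
    `|dmx x ij.1 ij.2 - ratr q| <= a.
  move=> ij; have /rat_in_itvoo[q] : dmx x ij.1 ij.2 - a < dmx x ij.1 ij.2 + a by lra.
  rewrite in_itv/= => /andP[q1 q2]; exists q.
  by rewrite ler_norml; apply/andP; split; lra.
have [d d0 dP] := dmx_expansion Dx i20.
have [m _ md] := near_invn_lt d0.
exists (\matrix_(i, j) q (i, j)), m; split; last first.
  by move=> i j; rewrite mxE (le_trans (qP (i, j)))// ge_min lexx.
split => // y Dy yx; have H1 := dP y Dy (lt_trans yx (md m (leqnn _))).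
set Q := ratmx _; have H2 : `|(y - x) *m (dmx x - Q)| <= i2 * `|y - x|.
  apply: le_trans (norm_mulmx_le (a := a) _ _) _ => [i j|].
    by rewrite /Q; move: (dmx x) (qP (i, j)) => A; rewrite !mxE.
  rewrite ler_wpM2r//; apply: (@le_trans _ _ (n%:R * (i2 / n.+1%:R))).
    by rewrite ler_wpM2l// ge_min lexx orbT.
  by rewrite mulrCA ler_piMr ?(ltW i20)// ler_pdivrMr// mul1r ler_nat.
have -> : k.+1%:R^-1 * `|y - x| = i2 * `|y - x| + i2 * `|y - x|.
  by rewrite -mulrDl /i2 -splitr.
apply: le_trans (lerD H1 H2); apply: le_trans (ler_normD _ _).
by rewrite mulmxBr addrA subrK.
Qed.

(** An entry exceeds [a] exactly when some good rational approximation does so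
    by more than its error. *)
Lemma measurable_dmx i j : measurable_fun reachable (fun x => dmx x i j).
Proof.
move=> mG; apply: (measurability _ (@RGenOInfty.measurableE R)) => //.
move: mG => _.
move=> _ [_ [a ->] <-].
pose P (p : 'M[rat]_n * nat * nat) := a < ratr (p.1.1 i j) - p.1.2.+1%:R^-1.
rewrite (_ : _ `&` _ = reachable `&`
    \bigcup_p [set x | P p /\ approx p.1.1 p.1.2 p.2 x]); last first.
  apply/seteqP; split => x [xG].
    rewrite /= in_itv/= andbT => ax; split => //.
    have e0 : 0 < (dmx x i j - a) / 2 by rewrite divr_gt0// subr_gt0.
    have [k _ kP] := near_invn_lt e0.
    have [q [m [xq qP]]] := approx_exists k xG e0.
    exists (q, k, m) => //; split => //; rewrite /P/=.
    have := qP i j; have := kP k (leqnn _).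
    by rewrite ler_norml => + /andP[]; set u := k.+1%:R^-1; lra.
  move=> [[[q k] m] _ [Pq xq]]; split => //; rewrite /= in_itv/= andbT.
  have := approx_entry i j xG xq; rewrite ler_norml => /andP[H _].
  by move: Pq H; rewrite /P/=; set u := k.+1%:R^-1; lra.
apply: measurableI; first exact: measurable_reachable.
apply: countable_bigcupT_measurable => [|p]; first exact: countableP.
have [Pp|nPp] := pselect (P p).
  rewrite (_ : [set _ | _] = approx p.1.1 p.1.2 p.2); first exact: measurable_approx.
  by apply/seteqP; split => [x []|x].
by rewrite (_ : [set _ | _] = set0)//; apply/seteqP; split => x // -[].
Qed.

Lemma measurable_jac : measurable_fun reachable (jac D gamma).
Proof.
rewrite (_ : jac D gamma = fun x => \det (dmx x)); last exact/funext/jacE.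
apply: measurable_sum => s; apply: measurable_funM => //.
apply: measurable_prod => i _; exact: measurable_dmx.
Qed.

Lemma jac_regular_part : exists G M, [/\ measurable G, G `<=` D,
  mu.-negligible (D `\` G), measurable_fun G (jac D gamma) &
  forall x, G x -> `|(jac D gamma x)^-1| <= M].
Proof.
exists reachable, (\sum_(s : 'S_n) L ^+ n); split.
- exact: measurable_reachable.
- by move=> x [].
- exact: reachable_ae.
- exact: measurable_jac.
- exact: jac_lower_bound.
Qed.

End piece.

End jacobian.

(** * Operators that share a kernel *)

Section shared_kernel.
Context {R : realType} {n : nat}.
Local Notation C := R[i].
Local Notation V := 'rV[R]_n.
Local Notation mu := (@lebesgue_rV R n).
Local Notation nball := (@nball R n).

Lemma norm_le_enorm (v : V) : `|v| <= enorm v.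
Proof.
apply: norm_le_coord => [|j]; first exact: sqrtr_ge0.
rewrite -sqrtr_sqr; apply: ler_wsqrtr.
by rewrite (bigD1 j)//= lerDl sumr_ge0// => i _; exact: sqr_ge0.
Qed.

Lemma enorm_le_norm (v : V) : enorm v <= n%:R * `|v|.
Proof.
have nv0 : 0 <= n%:R * `|v| by rewrite mulr_ge0 ?normr_ge0.
rewrite -(ger0_norm nv0) -sqrtr_sqr; apply: ler_wsqrtr.
apply: (@le_trans _ _ (\sum_(i < n) `|v| ^+ 2)).
  apply: ler_sum => i _; rewrite -[leLHS]real_normK ?num_real//.
  by rewrite ler_pXn2r ?nnegrE ?normr_ge0//; exact: coord_le_norm.
rewrite sumr_const card_ord -[leLHS]mulr_natl exprMn ler_wpM2r ?sqr_ge0//.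
by rewrite -natrX ler_nat -mulnn; case: (n) => // m; rewrite leq_pmulr.
Qed.

Lemma pairing_inj (u v : V -> R) :
  measurable_fun setT u -> mu.-integrable setT (EFin \o (fun x => u x ^+ 2)) ->
  measurable_fun setT v -> mu.-integrable setT (EFin \o (fun x => v x ^+ 2)) ->
  (forall N z k, \int[mu]_x (u x * bump N z k x) = \int[mu]_x (v x * bump N z k x)) ->
  {ae mu, forall x, u x = v x}.
Proof.
move=> mu_ u2 mv v2 uv.
have mw : measurable_fun setT (fun x => u x - v x) by exact: measurable_funB.
have w2 : mu.-integrable setT (EFin \o (fun x => (u x - v x) ^+ 2)).
  have i2 : mu.-integrable setT
      (fun x => (2%:E * (u x ^+ 2)%:E + 2%:E * (v x ^+ 2)%:E)%E).
    by apply: integrableD => //; exact: integrableZl.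
  apply: le_integrable i2 => //.
  - by apply/measurable_EFinP; exact: measurable_funX.
  - move=> x _ /=; rewrite lee_fin ger0_norm ?sqr_ge0// (le_trans _ (ler_norm _))//.
    by rewrite -subr_ge0; have := sqr_ge0 (u x + v x); nra.
suff : {ae mu, forall x, u x - v x = 0}.
  by apply: filterS => x /eqP; rewrite subr_eq0 => /eqP.
apply: pairing_eq0 => // N z k.
have [M bM] := @shifted_box_bounded R n N z.
have b1 x : `|bump N z k x| <= \1_(nball M) x.
  by apply: bump_indic; exact: bM.
have iu := integrable_pairing mu_ u2 (measurable_bump (n := n) N z k) b1.
have iv := integrable_pairing mv v2 (measurable_bump (n := n) N z k) b1.
under eq_integral do rewrite mulrBl EFinB.
rewrite integralB//; have := uv N z k; rewrite /Rintegral => uvk.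
rewrite -(fineK (integrable_fin_num measurableT iu)).
by rewrite -(fineK (integrable_fin_num measurableT iv)) uvk -EFinB subrr.
Qed.

(** Bumps are real-valued, so real and imaginary parts can be treated
    separately. *)
Lemma cpairing_inj (f g : V -> C) : L2 f -> L2 g ->
  (forall N z k, cintegral (fun x => f x * cbump N z k x) =
                 cintegral (fun x => g x * cbump N z k x)) ->
  {ae mu, forall x, f x = g x}.
Proof.
move=> f2 g2 fg.
have bound h (p : C -> R) : (forall w, `|p w| <= normc w) ->
    measurable_fun setT (fun x : V => p (h x)) -> L2 h ->
    mu.-integrable setT (EFin \o (fun x => p (h x) ^+ 2)).
  move=> pn mp h2; apply: le_integrable (L2_integrable_sqr h2) => //.
    by apply/measurable_EFinP; exact: measurable_funX.
  move=> x _ /=; rewrite lee_fin !ger0_norm ?sqr_ge0//.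
  rewrite -[leLHS]real_normK ?num_real//.
  by rewrite ler_pXn2r ?nnegrE ?normr_ge0 ?normc_ge0//; exact: pn.
have Ren (w : C) : `|complex.Re w| <= normc w.
  by case: w => s t /=; rewrite -sqrtr_sqr ler_wsqrtr// lerDl sqr_ge0.
have Imn (w : C) : `|complex.Im w| <= normc w.
  by case: w => s t /=; rewrite -sqrtr_sqr ler_wsqrtr// lerDr sqr_ge0.
have [[mf1 mf2] _] := f2; have [[mg1 mg2] _] := g2.
have ReE (h : V -> C) N z k : (fun x => complex.Re (h x * cbump N z k x)) =
    (fun x => complex.Re (h x) * bump N z k x).
  by apply/funext => x; rewrite /cbump; case: (h x) => s t /=; rewrite mulr0 subr0.
have ImE (h : V -> C) N z k : (fun x => complex.Im (h x * cbump N z k x)) =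
    (fun x => complex.Im (h x) * bump N z k x).
  by apply/funext => x; rewrite /cbump; case: (h x) => s t /=; rewrite mulr0 add0r.
have reE : {ae mu, forall x, complex.Re (f x) = complex.Re (g x)}.
  apply: pairing_inj => // [||N z k]; [exact: bound|exact: bound|].
  by have [+ _] := fg N z k; rewrite !ReE.
have imE : {ae mu, forall x, complex.Im (f x) = complex.Im (g x)}.
  apply: pairing_inj => // [||N z k]; [exact: bound|exact: bound|].
  by have [_ +] := fg N z k; rewrite !ImE.
apply: filterS2 reE imE => x.
by case: (f x) (g x) => s t [s' t'] /= -> ->.
Qed.

(** Both sides pair with a test function [g] as [S (cbump N z k) g] does. *)
Lemma extension_unique (S : (V -> C) -> (V -> C) -> C) S1 S2 N z k :
  L2_extension S S1 -> L2_extension S S2 ->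
  {ae mu, forall x, S1 (cbump N z k) x = S2 (cbump N z k) x}.
Proof.
move=> [[L1 _ _] E1] [[L2' _ _] E2].
have [M bM] := @shifted_box_bounded R n N z.
have b2 : L2 (@cbump R n N z k).
  apply: (@L2_bounded _ _ _ M); first exact: measurable_bump.
  by move=> x; apply: bump_indic; exact: bM.
apply: cpairing_inj; [exact: L1|exact: L2'|] => N' z' k'.
by rewrite -E1 -?E2//; exact: test_function_cbump.
Qed.

Lemma Lfun_oo_bounded (h : V -> R) (M : R) : measurable_fun setT h ->
  {ae mu, forall x, `|h x| <= M} -> h \in Lfun mu +oo%E.
Proof.
move=> mh hM; apply/andP; split; rewrite inE//= /finite_norm unlock /=.
case: ifP => // _; apply: (@le_lt_trans _ _ M%:E); last exact: ltry.
by apply/ess_supP; apply: filterS hM => x; rewrite /= lee_fin.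
Qed.

(** The inverse is written as the power [-1], which vanishes at zero too. *)
Lemma measurable_norm_inv (G D : set V) gamma : measurable G -> G `<=` D ->
  measurable_fun G (jac D gamma) ->
  measurable_fun setT (fun x => `|((jac D gamma \_ G) x)^-1|).
Proof.
move=> mG GD /measurable_restrictT => /(_ mG) mj.
rewrite [X in measurable_fun _ X](_ : _ = (fun x => `|(jac D gamma \_ G) x| `^ (-1))).
  apply: (measurableT_comp (f := fun t : R => t `^ (-1))) => //.
  exact: measurableT_comp.
by apply/funext => x; rewrite powR_inv1// normfV.
Qed.

End shared_kernel.

Theorem corollary2p4 (R : realType) (n : nat) (n_gt0 : (0 < n)%N) (r : nat)
    (D : 'I_r -> set 'rV[R]_n) (gamma : 'I_r -> 'rV[R]_n -> 'rV[R]_n)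
    (K : 'rV[R]_n -> 'rV[R]_n -> R[i])
    (S T : ('rV[R]_n -> R[i]) -> ('rV[R]_n -> R[i]) -> R[i])
    (S2 T2 : ('rV[R]_n -> R[i]) -> 'rV[R]_n -> R[i]) :
  standard_hyper_curve D gamma ->
  CZO D gamma K S -> CZO D gamma K T ->
  L2_extension S S2 -> L2_extension T T2 ->
  exists b : 'I_r -> 'rV[R]_n -> R[i],
    [/\ forall i, cmeasurable_fun (D i) (b i),
        forall f, L2 f ->
          {ae lebesgue_rV n, forall x,
             S2 f x - T2 f x =
             \sum_(i < r) b i x * f (gamma i x) * (\1_(D i) x)%:C}
      & forall i,
          (fun x => normc (b i x) ^+ 2 * `|(jac (D i) (gamma i) x)^-1| *
                    \1_(D i) x) \in Lfun (lebesgue_rV n) +oo%E].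
Proof.
move=> [_ domD [diffg _] finD [a a1 lipg]] CS CT ES ET.
(* The factor [n] passes between the sup norm and the Euclidean norm. *)
pose L : R := a * n%:R; have L0 : 0 < L by rewrite mulr_gt0 ?ltr0n// (lt_trans _ a1).
have a0 : 0 <= a by rewrite (le_trans _ (ltW a1)).
have lip i : lipschitz_within L (D i) (gamma i).
  move=> x y Dx Dy; apply: le_trans (norm_le_enorm _) _.
  have [+ _] := lipg i x y Dx Dy; move/le_trans; apply.
  by rewrite -mulrA ler_wpM2l// enorm_le_norm.
have colip i x y : D i x -> D i y -> `|x - y| <= L * `|gamma i x - gamma i y|.
  move=> Dx Dy; apply: le_trans (norm_le_enorm _) _.
  have [_ +] := lipg i x y Dx Dy; move/le_trans; apply.
  by rewrite -mulrA ler_wpM2l// enorm_le_norm.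
have clD i : closed (D i).
  by have [U [_ _ _ ->]] := domD i; exact: closed_closure.
have finZ (i i' : 'I_r) : i != i' ->
    finite_set [set x | [/\ D i x, D i' x & gamma i x = gamma i' x]].
  rewrite neq_ltn => /orP[|/finD]; first exact: finD.
  by apply: sub_finite_set => x [].
have [c Uop] := bounded_sub_operator ES.1 ET.1.
set U := (fun f x => _) in Uop.
have loc_bump N z k : {ae lebesgue_rV n, forall x,
    ~ gamma_preimage D gamma (shifted_box N z k) x -> U (cbump N z k) x = 0}.
  have [_ _ _ [S' ES' S'K]] := CS; have [_ _ _ [T' ET' T'K]] := CT.
  have tf := @test_function_cbump R n N z k.
  have SS := extension_unique N z k ES ES'.
  have TT := extension_unique N z k ET ET'.
  apply: filterS2 (filterI SS TT) (filterI (S'K _ tf) (T'K _ tf)).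
  move=> x [Sx Tx] [S'x T'x] nx.
  have {}nx : ~ gamma_preimage D gamma (supp (cbump N z k)) x.
    by move=> [i _ [Dx ix]]; apply: nx; exists i => //; split => //; exact: supp_cbump.
  by rewrite /U Sx Tx S'x// T'x// subrr.
have loc := bounded_local Uop loc_bump.
(* On [G i], of full measure in [D i], the inverse Jacobian is bounded. *)
have /choice[G GP] : forall i, exists G, exists M, [/\ measurable G, G `<=` D i,
    (lebesgue_rV n).-negligible (D i `\` G),
    measurable_fun G (jac (D i) (gamma i)) &
    forall x, G x -> `|(jac (D i) (gamma i) x)^-1| <= M].
  move=> i; apply: (@jac_regular_part _ _ _ _ L) => //.
  - exact: colip.
  - exact: diffg.
have mG i : measurable (G i) by have [M []] := GP i.
have GD i : G i `<=` D i by have [M []] := GP i.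
have DG i : (lebesgue_rV n).-negligible (D i `\` G i) by have [M []] := GP i.
have [b [mb b0 bb rep]] := coefficients_exist n_gt0 Uop clD (ltW L0) lip finZ loc mG GD DG.
exists b; split.
- by move=> i; apply: cmeasurableS (mb i).
- by move=> f f2; exact: (represented_L2 Uop rep f2).
move=> i; have [M [_ _ _ mj jM]] := GP i.
have E x : normc (b i x) ^+ 2 * `|(jac (D i) (gamma i) x)^-1| * \1_(D i) x =
    normc (b i x) ^+ 2 * `|((jac (D i) (gamma i) \_ (G i)) x)^-1|.
  have [Gx|nGx] := pselect (G i x).
    by rewrite patchE mem_set// indicE mem_set ?mulr1//; exact: GD.
  by rewrite b0// normc0 expr0n/= !mul0r.
rewrite (funext E).
apply: (@Lfun_oo_bounded _ _ _ ((c * (2 * L) ^+ n + 1) * `|M|)).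
  apply: measurable_funM; first exact: (measurable_sqr_normc (mb i)).
  exact: (measurable_norm_inv (mG i) (@GD i)).
apply: filterS bb => x /(_ i) bx.
rewrite ger0_norm; last by rewrite mulr_ge0 ?sqr_ge0.
apply: ler_pM => //; first exact: sqr_ge0.
rewrite patchE; case: ifPn => [/set_mem/jM|_]; last by rewrite invr0 normr0.
by move=> /le_trans; apply; exact: ler_norm.
Qed.
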